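(* Let $L$ be a link that is not an unlink. (i) Let $n = 4k+2$ with $k\ge 0$ an integer. Then for every integer $m \ge 3n+1$, $\beta_n(L) \le \beta_m(L)$. (ii) Let $n = 4k$ with $k \ge 1$ an integer. Then for every integer $m \ge 3n+1$, $\beta_n(L) \le \beta_m(L)+1$; moreover, if $m\equiv 0$ or $m \equiv 1 \pmod 4$, then $\beta_n(L)\le \beta_m(L)$.
   Context: An $n$-crossing ($n\ge 2$) in a link projection is a point where $n$ strands meet, each bisecting the crossing, with the strands assigned distinct levels $1,\dots,n$ (level $1$ on top) recording their heights. An $m$-string $n$-crossing braid is a braid diagram on $m$ strings all of whose crossings are $n$-crossings; each such crossing involves strings in consecutive positions $j,\dots,j+n-1$ and reverses their order. The $n$-crossing braid index $\beta_n(L)$ is the minimum number of strings of an $n$-crossing braid whose closure is isotopic to $L$, with $\beta_n(L)=\infty$ if none exists. *)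

(* Defs.v *)
From HB Require Import structures.
From mathcomp Require Import all_boot all_order all_algebra all_fingroup.
From mathcomp Require Import all_classical all_reals all_analysis.
Unset Printing Implicit Defensive.
Import Order.TTheory GRing.Theory Num.Theory.
Import numFieldNormedType.Exports.
Local Open Scope classical_set_scope.
Local Open Scope ring_scope.

Section LinkDefs.
Variable R : realType.

(** Points of R^3, coordinates (x, t, z): (x, t) is the projection plane,
    z is the height. *)
Definition R3pt := 'rV[R]_3.
Definition pt (x y z : R) : R3pt := \row_(i < 3) [:: x; y; z]`_i.

Definition seg (a b : R3pt) : set R3pt :=
  [set (1 - s) *: a + s *: b | s in [set s : R | 0 <= s <= 1]].

(** A crossing of an n-crossing braid: the leftmost position j of the n
    consecutive strings it involves, and a permutation sigma of 'I_n assigning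
    to the strand entering at position j+i the level (sigma i)+1
    (level 1 = on top). *)
Definition ncrossing (n : nat) := (nat * {perm 'I_n})%type.

Definition cross_height n (c : ncrossing n) (i : nat) : R :=
  if insub i is Some o then (n - val (c.2 o))%:R else 0.

(** Geometric piece of the string occupying position p (0-based) during the
    k-th time slot [k, k+1], when the crossing in that slot is c. Strings
    in positions c.1 .. c.1+n-1 rise to their (distinct) heights, travel along
    straight segments all passing over the common R3pt
    ((2 c.1 + n - 1)/2, k + 1/2) of the projection plane, reversing their order,
    and come back to height 0; the other strings go straight. *)
Definition strand_piece n (c : ncrossing n) (k p : nat) : set R3pt :=
  let t := k%:R in let x := p%:R in
  if ((c.1 <= p) && (p < c.1 + n))%N then
    let h := cross_height n c (p - c.1)%N in
    let x1 := (c.1 + (n - 1 - (p - c.1)))%N%:R in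
    seg (pt x t 0) (pt x (t + 4^-1) h) `|`
    seg (pt x (t + 4^-1) h) (pt x1 (t + 3 / 4) h) `|`
    seg (pt x1 (t + 3 / 4) h) (pt x1 (t + 1) 0)
  else seg (pt x t 0) (pt x (t + 1) 0).

(** The closing arc of the string at position p (p < m) of an m-string braid
    of length T: a rectangle in the plane z = 0 with corners (p,T),(p,T+p+1),(-(p+1),T+p+1),(-(p+1),-(p+1)),(p,-(p+1)); these are nested and disjoint for distinct p. *)
Definition closure_arc (T m p : nat) : set R3pt :=
  let x := p%:R in let a := p.+1%:R in let top := T%:R + a in
  seg (pt x T%:R 0) (pt x top 0) `|` seg (pt x top 0) (pt (- a) top 0) `|`
  seg (pt (- a) top 0) (pt (- a) (- a) 0) `|` seg (pt (- a) (- a) 0) (pt x (- a) 0) `|`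
  seg (pt x (- a) 0) (pt x 0 0).

Definition nbraid (n m : nat) (w : seq (ncrossing n)) : bool :=
  (2 <= n)%N && all (fun c : ncrossing n => (c.1 + n <= m)%N) w.

Definition braid_closure (n m : nat) (w : seq (ncrossing n)) : set R3pt :=
  (\bigcup_(k in [set k : nat | (k < size w)%N])
     \bigcup_(p in [set p : nat | (p < m)%N]) strand_piece n (nth (0%N, 1%g) w k) k p)
  `|` \bigcup_(p in [set p : nat | (p < m)%N]) closure_arc (size w) m p.

Definition ambient_isotopic (A B : set R3pt) : Prop :=
  exists H : R * R3pt -> R3pt,
    continuous H /\ (forall x, H (0, x) = x) /\
    (forall t, 0 <= t <= 1 -> exists g : R3pt -> R3pt,
        continuous g /\ cancel (fun x => H (t, x)) g /\ cancel g (fun x => H (t, x))) /\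
    (fun x => H (1, x)) @` A = B.

Definition is_link (L : set R3pt) : Prop :=
  exists (c : nat) (f : 'I_c -> R -> R3pt),
    (0 < c)%N /\ (forall i, continuous (f i)) /\
    (forall i t, f i (t + 1) = f i t) /\
    (forall i j s t, 0 <= s < 1 -> 0 <= t < 1 -> f i s = f j t -> i = j /\ s = t) /\
    L = \bigcup_(i in [set: 'I_c]) range (f i).

(** The unlink with c >= 1 components: closure of the trivial braid on c strings
    (c disjoint nested planar circles). *)
Definition is_unlink (L : set R3pt) : Prop :=
  exists c : nat, (0 < c)%N /\ ambient_isotopic (braid_closure 2 c [::]) L.

Definition realizable (n : nat) (L : set R3pt) (m : nat) : Prop :=
  exists w : seq (ncrossing n), nbraid n m w /\ ambient_isotopic (braid_closure n m w) L.

(** n-crossing braid index, in nat extended by infinity (None = infinity). *)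
Definition beta (n : nat) (L : set R3pt) : option nat :=
  if pselect (exists m, realizable n L m) then
    Some (xget 0%N [set m | realizable n L m /\
                            forall m', realizable n L m' -> (m <= m')%N])
  else None.

End LinkDefs.

Arguments is_link {R}.
Arguments is_unlink {R}.
Arguments realizable {R}.
Arguments beta {R}.
Arguments ambient_isotopic {R}.
Arguments braid_closure {R}.

Definition le_ext (a b : option nat) : Prop :=
  match a, b with
  | _, None => True
  | Some x, Some y => (x <= y)%N
  | None, Some _ => False
  end.
Definition add1_ext (a : option nat) : option nat := omap S a.

(* Main.v *)
(* A braid on which every string keeps its own constant height depends, up to isotopy, only on its
   permutation and on the relative heights of the pairs of strings that it inverts: two such motions
   are joined by a straight-line homotopy without collisions. An m-crossing is of this kind, and so
   is a product of n-crossings whose levels are read off one assignment of heights to all strings.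
   Hence an m-crossing on s strings is a product of n-crossings as soon as its permutation lies in
   the group generated by the reversals of n consecutive positions. For n even and s >= 2n this
   group contains the alternating group, and it is symmetric if n = 2 mod 4, since a generator is
   then odd; this settles (i), and (ii) for m = 0, 1 mod 4, where an m-crossing is even.
   For n = 0 mod 4 and a braid of even total parity, two consecutive odd letters are made even by
   inserting transpositions between them: p q = (p a) (a b) (b q), where a and b are disjoint
   adjacent transpositions with crossing signs dictated by the heights in p and in q. If the total
   parity is odd, one stabilization makes it even at the cost of one string.
   All isotopies come from one criterion: if points a_i are moved along straight lines to b_i in such
   a way that the displacements are Lipschitz with respect to the moving points, uniformly in time,
   then the motion extends to an ambient isotopy of R^3. *)
Require Import Defs.
From HB Require Import structures.
From mathcomp Require Import all_boot all_order all_algebra all_fingroup.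
From mathcomp Require Import all_classical all_reals all_analysis.
From mathcomp Require Import ring lra zify.
Set Implicit Arguments.
Unset Strict Implicit.
Unset Printing Implicit Defensive.
Import Order.TTheory GRing.Theory Num.Theory.
Import numFieldNormedType.Exports.
Local Open Scope classical_set_scope.
Local Open Scope ring_scope.
Local Notation pt := (@pt _).
Local Notation seg := (@seg _).

(** * Ambient isotopies of straight-line motions *)

(** Two obstacles shape the proof. The idle strings of a crossing lie at height 0, whereas merging
    two letters may let any two strings meet in projection on the way; so every string is first
    given a height of its own, which is harmless for strings that take part in no inversion. In the
    stabilization, the closing arc of the new string is flat, and contracting it inside its plane
    could bring distinct parts of it together. A shear first makes the height strictly monotone
    along the loop; the projection is then free to shrink, and once time increases along the result
    the height can be flattened in turn. A stabilization of a single sign is enough, because it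
    serves only to change the parity.

    The hypotheses on [L] and [m] act through one fact: a braid without crossings closes to an
    unlink, so some m-crossing occurs and the number of strings is at least [m]. This leaves room
    both for the reversals of [n] positions to generate all even permutations and for the two
    disjoint transpositions. *)

Lemma pair_continuous (T U V : topologicalType) (f : T -> U) (g : T -> V) (x : T) :
  {for x, continuous f} -> {for x, continuous g} -> {for x, continuous (fun u => (f u, g u))}.
Proof. by move=> cf cg; exact: (cvg_pair cf cg). Qed.

(** Makes the complete normed structure of matrices available, so that the Banach fixed point
    theorem applies to points of space. *)
HB.instance Definition _ (R : realType) m n := Complete.on 'M[R]_(m, n).

Section Isotopy.
Variable R : realType.
Implicit Types (A B C : set (R3pt R)) (x y : R) (p q : R3pt R).

(** The building block of nearly all piecewise linear profiles below: a combination of clamps is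
    Lipschitz term by term, and case analysis with [clamp01P] reduces it to linear arithmetic. *)
Definition clamp01 x : R := Num.max 0 (Num.min 1 x).

Lemma clamp01_ge0 x : 0 <= clamp01 x. Proof. by rewrite le_max lexx. Qed.
Lemma clamp01_le1 x : clamp01 x <= 1.
Proof. by rewrite ge_max ler01 ge_min lexx. Qed.
Lemma clamp01_id x : 0 <= x <= 1 -> clamp01 x = x.
Proof. by move=> /andP[x0 x1]; rewrite /clamp01 min_r// max_r. Qed.
Lemma clamp01_eq0 x : x <= 0 -> clamp01 x = 0.
Proof. by move=> x0; rewrite /clamp01 max_l// ge_min x0 orbT. Qed.
Lemma clamp01_eq1 x : 1 <= x -> clamp01 x = 1.
Proof. by move=> x0; rewrite /clamp01 min_l// max_r. Qed.
Lemma clamp01P x : [\/ x <= 0 /\ clamp01 x = 0, 0 <= x <= 1 /\ clamp01 x = x | 1 <= x /\ clamp01 x = 1].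
Proof.
have [x0|x0] := leP x 0; first by constructor 1; rewrite clamp01_eq0.
have [x1|x1] := leP x 1; last by constructor 3; rewrite clamp01_eq1 ltW.
by constructor 2; rewrite clamp01_id ltW.
Qed.
Lemma clamp01_homo x y : x <= y -> 0 <= clamp01 y - clamp01 x <= y - x.
Proof.
by case: (clamp01P x) => -[? ->]; case: (clamp01P y) => -[? ->] ?; lra.
Qed.
Lemma clamp01_lip x y : `|clamp01 x - clamp01 y| <= `|x - y|.
Proof.
wlog yx : x y / y <= x.
  by move=> H; have [/H//|/ltW/H] := leP y x; rewrite distrC (distrC x).
by have /andP[? ?] := clamp01_homo yx; rewrite !ger0_norm// subr_ge0.
Qed.

Lemma continuous_clamp01 : continuous clamp01.
Proof.
move=> x; apply/cvgrPdist_lt => e e0; near=> y.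
apply: le_lt_trans (clamp01_lip _ _) _.
by near: y; apply: cvgr_dist_lt.
Unshelve. all: by end_near. Qed.

Lemma ambient_isotopic_refl A : ambient_isotopic A A.
Proof.
exists snd; split; first by move=> ?; exact: cvg_snd.
split=> //; split; last by rewrite image_id.
by move=> t _; exists id; split => // ?; exact: cvg_id.
Qed.

(** The first isotopy runs on [0, 1/2] and the second on [1/2, 1]. Clamping the two clocks keeps the
    result continuous at all real times, as the definition of isotopy demands. *)
Lemma ambient_isotopic_trans B A C :
  ambient_isotopic A B -> ambient_isotopic B C -> ambient_isotopic A C.
Proof.
move=> [H1 [cH1 [H10 [H1i H11]]]] [H2 [cH2 [H20 [H2i H21]]]].
pose c1 (t : R) : R := clamp01 (2 * t); pose c2 (t : R) : R := clamp01 (2 * t - 1).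
have cc1 : continuous c1.
  move=> t; apply: (@continuous_comp R R R (fun t => 2 * t) clamp01 t _ (@continuous_clamp01 _)).
  exact: (@mulrl_continuous R 2 t).
have cc2 : continuous c2.
  move=> t; apply: (@continuous_comp R R R (fun t => 2 * t - 1) clamp01 t _ (@continuous_clamp01 _)).
  by apply: continuousB; [exact: (@mulrl_continuous R 2 t)|exact: cst_continuous].
have c1i t : 0 <= c1 t <= 1 by rewrite clamp01_ge0 clamp01_le1.
have c2i t : 0 <= c2 t <= 1 by rewrite clamp01_ge0 clamp01_le1.
exists (fun u => H2 (c2 u.1, H1 (c1 u.1, u.2))); split; last split; last split.
- move=> u; apply: (@continuous_comp _ _ _ (fun u => (c2 u.1, H1 (c1 u.1, u.2))) H2 u _ (cH2 _)).
  apply: pair_continuous => /=.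
    exact: (@continuous_comp _ _ _ fst c2 u (cvg_fst) (cc2 _)).
  apply: (@continuous_comp _ _ _ (fun u => (c1 u.1, u.2)) H1 u _ (cH1 _)).
  apply: pair_continuous => /=; last exact: cvg_snd.
  exact: (@continuous_comp _ _ _ fst c1 u (cvg_fst) (cc1 _)).
- move=> x; rewrite /c1 /c2/= mulr0 sub0r !clamp01_eq0// ?H10//.
- move=> t _.
  have [g1 [cg1 [g1K Kg1]]] := H1i _ (c1i t).
  have [g2 [cg2 [g2K Kg2]]] := H2i _ (c2i t).
  exists (g1 \o g2); split; first by move=> x; exact: continuous_comp (cg2 _) (cg1 _).
  split=> x /=; first by rewrite g2K g1K.
  by rewrite Kg1 Kg2.
- rewrite /c1 /c2/= !clamp01_eq1; last 2 first.
  + by lra.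
  + by lra.
  rewrite -H21 -H11; apply/seteqP; split => [_ [x Ax <-]|_ [_ [x Ax <-] <-]].
    by exists (H1 (1, x)) => //; exists x.
  by exists x.
Qed.

Lemma ambient_isotopic_sym A B : ambient_isotopic A B -> ambient_isotopic B A.
Proof.
move=> [H [cH [H0 [Hi <-]]]].
have [|g [cg [gK Kg]]] := Hi 1; first by rewrite ler01 lexx.
(* The isotopy is run backwards, after its end map has been undone by [g]. *)
exists (fun u => H (1 - u.1, g u.2)); split; last split; last split.
- move=> u; apply: (@continuous_comp (R * R3pt R)%type (R * R3pt R)%type (R3pt R) (fun u => (1 - u.1, g u.2)) H u _ (cH _)).
  apply: pair_continuous => /=.
    by apply: cvgB; [exact: cvg_cst|exact: cvg_fst].
  exact: (@continuous_comp _ _ _ snd g u (cvg_snd) (cg _)).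
- by move=> x; rewrite /= subr0 Kg.
- move=> t /andP[t0 t1]; have [|k [ck [kK Kk]]] := Hi (1 - t).
    by rewrite subr_ge0 t1 gerBl t0.
  exists (fun x : R3pt R => H (1, k x)); split.
    move=> x; apply: (@continuous_comp (R3pt R) (R * R3pt R)%type (R3pt R) (fun x : R3pt R => (1, k x)) H x _ (cH _)).
    by apply: pair_continuous; [apply: cst_continuous|exact: ck].
  by split=> x /=; [rewrite (kK (g x)); exact: Kg|rewrite (gK (k x)); exact: Kk].
- apply/seteqP; split => [_ [_ [x Ax <-] <-]|x Ax] /=.
    by rewrite subrr H0 gK.
  by exists (H (1, x)); [exists x|rewrite subrr H0 gK].
Qed.

Lemma lipschitz_continuous (L : R) (g : R3pt R -> R3pt R) :
  0 < L -> (forall p q, `|g p - g q| <= L * `|p - q|) -> continuous g.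
Proof.
move=> L0 gL p; apply/(@cvgrPdist_lt _ _ _ (nbhs p) (nbhs_filter p)) => e e0.
apply: (iffRL (@nbhs_normP R 'rV[R]_3 p _)); exists (e / L); first by rewrite /= divr_gt0.
by move=> q /= pq; apply: le_lt_trans (gL _ _) _; rewrite mulrC -ltr_pdivlMr.
Qed.

Lemma pt_entry p (j : 'I_3) : `|p 0 j| <= `|p|.
Proof.
rewrite [leRHS]/Num.norm /= mx_normrE; apply/bigmax_geP; right => /=.
by exists (ord0, j).
Qed.

Lemma pt_norm_le p (c : R) : 0 <= c -> (forall j, `|p 0 j| <= c) -> `|p| <= c.
Proof.
move=> c0 pc; rewrite [leLHS]/Num.norm /= mx_normrE; apply/bigmax_leP; split=> //.
by move=> [i j] _ /=; rewrite (ord1 i).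
Qed.

(* McShane's formula, coordinate by coordinate: the sup norm keeps the constant. *)
Lemma lipschitz_extension (I : Type) (S : set I) (a d : I -> R3pt R) (L : R) :
  0 <= L -> S !=set0 ->
  (forall i j, S i -> S j -> `|d i - d j| <= L * `|a i - a j|) ->
  exists V : R3pt R -> R3pt R, (forall i, S i -> V (a i) = d i) /\
    forall p q, `|V p - V q| <= L * `|p - q|.
Proof.
move=> L0 [i0 Si0] dL.
pose E p (j : 'I_3) := [set d i 0 j + L * `|p - a i| | i in S].
have Elb p j i : S i -> lbound (E p j) (d i 0 j - L * `|p - a i|).
  move=> Si _ [k Sk <-].
  have h1 := le_trans (pt_entry (d i - d k) j) (dL _ _ Si Sk).
  have h2 : `|a i - a k| <= `|p - a i| + `|p - a k|.
    rewrite (distrC p (a i)); have -> : a i - a k = (a i - p) + (p - a k) by rewrite addrA subrK.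
    exact: ler_normD.
  have h3 := ler_wpM2l L0 h2.
  rewrite !mxE in h1; move: h1; rewrite ler_norml => /andP[_ h1].
  rewrite mulrDr in h3; lra.
have Einf p j : has_inf (E p j).
  by split; [exists (d i0 0 j + L * `|p - a i0|), i0 | exists (d i0 0 j - L * `|p - a i0|); exact: Elb].
exists (fun p => \row_j inf (E p j)); split.
  move=> i Si; apply/rowP => j; rewrite mxE; apply/eqP; rewrite eq_le; apply/andP; split.
    have : E (a i) j (d i 0 j + L * `|a i - a i|) by exists i.
    move/(ge_inf (Einf _ _).2); by rewrite subrr normr0 mulr0 addr0.
  apply: lb_le_inf; first exact: (Einf _ _).1.
  by move=> y /(Elb _ _ _ Si); rewrite subrr normr0 mulr0 subr0.
have half p q j : inf (E p j) - inf (E q j) <= L * `|p - q|.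
  rewrite lerBlDr -lerBlDl; apply: lb_le_inf; first exact: (Einf _ _).1.
  move=> _ [i Si <-]; rewrite lerBlDl.
  have : E p j (d i 0 j + L * `|p - a i|) by exists i.
  move/(ge_inf (Einf _ _).2)/le_trans; apply; rewrite [leRHS]addrC -addrA lerD2l -mulrDr.
  apply: ler_wpM2l => //; rewrite [leRHS]addrC.
  have -> : p - a i = (p - q) + (q - a i) by rewrite addrA subrK.
  exact: ler_normD.
move=> p q; apply: pt_norm_le => [|j]; first by rewrite mulr_ge0.
by rewrite !mxE ler_norml half andbT lerNl opprB distrC half.
Qed.

(** Solving [y = p + V p] for [p] is a fixed point problem for the contraction [p |-> y - V p]; the
    factor 1/2 also makes the inverse 2-Lipschitz. *)
Lemma lipschitz_homeo (V : R3pt R -> R3pt R) :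
  (forall p q, `|V p - V q| <= 2^-1 * `|p - q|) ->
  exists g : R3pt R -> R3pt R, continuous g /\ cancel (fun p => p + V p) g /\
    cancel g (fun p => p + V p).
Proof.
move=> VL.
have ex (y : R3pt R) : exists p, y = p + V p :> R3pt R.
  pose f : 'rV[R]_3 -> 'rV[R]_3 := fun p => y - V p.
  have cf : is_contraction [fun of totalfun f].
    exists (2^-1)%:nng; split; first by rewrite /= invf_lt1 ?ltr1n.
    move=> [p q] _ /=; rewrite /f opprB addrC addrA subrK distrC.
    exact: VL.
  have [p _ fp] := @banach_fixed_point R 'rV[R]_3 setT _ cf closedT (ex_intro _ 0 I).
  by exists p; rewrite {1}fp /= /f subrK.
pose g (y : R3pt R) := sval (cid (ex y)).
have gP (y : R3pt R) : y = g y + V (g y) := svalP (cid (ex y)).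
have inj p q : `|p - q| <= 2 * `|(p + V p) - (q + V q)|.
  have -> : p + V p - (q + V q) = (p - q) + (V p - V q) by rewrite opprD addrACA.
  have := lerB_normD (p - q) (V p - V q); have := VL p q.
  set u := `|_ - _|; set v := `|p - q|; set w := `|_|; lra.
exists g; split; last split.
- apply: (@lipschitz_continuous 2) => // y z.
  by have := inj (g y) (g z); rewrite -!gP.
- move=> p; have := inj (g (p + V p)) p; rewrite -gP subrr normr0 mulr0.
  by rewrite normr_le0 subr_eq0 => /eqP.
- by move=> y; rewrite -gP.
Qed.

(** The displacement extends to a 1/2-Lipschitz field on all of space, and multiplying it by a
    clamped time keeps that bound, so every stage is a homeomorphism. *)
Lemma small_displacement_isotopic (I : Type) (S : set I) (a d : I -> R3pt R) :
  (forall i j, S i -> S j -> `|d i - d j| <= 2^-1 * `|a i - a j|) ->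
  ambient_isotopic (a @` S) ((fun i => a i + d i) @` S).
Proof.
move=> daL; have [->|S0] := eqVneq S set0.
  by rewrite !image_set0; exact: ambient_isotopic_refl.
have [||V [Vd VL]] := lipschitz_extension _ _ daL; [by rewrite invr_ge0|exact/set0P|].
have cV : continuous V by apply: lipschitz_continuous VL; rewrite invr_gt0.
exists (fun u => u.2 + clamp01 u.1 *: V u.2); split; last split; last split.
- move=> u; apply: cvgD; first exact: cvg_snd.
  apply: cvgZ.
    exact: (@continuous_comp _ _ _ fst clamp01 u (cvg_fst) (@continuous_clamp01 _)).
  exact: (@continuous_comp _ _ _ snd V u (cvg_snd) (cV _)).
- by move=> x; rewrite /= clamp01_eq0// scale0r addr0.
- move=> t _; apply: lipschitz_homeo => p q.
  rewrite -scalerBr normrZ ger0_norm ?clamp01_ge0//.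
  by rewrite (le_trans _ (VL p q))// ler_piMl ?clamp01_le1.
- rewrite /= clamp01_eq1//; apply/seteqP; split=> [_ [_ [i Si <-] <-]|_ [i Si <-]].
    by exists i => //; rewrite Vd// scale1r.
  by exists (a i); [exists i|rewrite Vd// scale1r].
Qed.

(* In N small steps the displacement of each step is 1/2-Lipschitz on the points already moved. *)
Lemma straight_line_isotopic (I : Type) (S : set I) (a b : I -> R3pt R) (C : R) :
  (forall i j r, S i -> S j -> 0 <= r <= 1 ->
    `|(b i - a i) - (b j - a j)| <=
      C * `|(1 - r) *: (a i - a j) + r *: (b i - b j)|) ->
  ambient_isotopic (a @` S) (b @` S).
Proof.
move=> abC.
have [N NC] : exists N : nat, 2 * C <= N.+1%:R.
  exists (Num.bound `|2 * C|); apply: le_trans (ler_norm _) _.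
  by rewrite (le_trans (ltW (archi_boundP (normr_ge0 _))))// ler_nat.
pose c r i := (1 - r) *: a i + r *: b i.
have step k : (k <= N.+1)%N -> ambient_isotopic (a @` S) (c (k%:R / N.+1%:R) @` S).
  elim: k => [_|k IH kN].
    have -> : c (0%:R / N.+1%:R) = a.
      by apply/funext => i; rewrite /c mul0r subr0 scale1r scale0r addr0.
    exact: ambient_isotopic_refl.
  apply: ambient_isotopic_trans (IH (ltnW kN)) _.
  have -> : c (k.+1%:R / N.+1%:R) =
            fun i => c (k%:R / N.+1%:R) i + N.+1%:R^-1 *: (b i - a i).
    apply/funext => i; rewrite /c -natr1 mulrDl mul1r; apply/rowP => j; rewrite !mxE; ring.
  apply: small_displacement_isotopic => i j Si Sj; rewrite -scalerBr normrZ.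
  rewrite ger0_norm ?invr_ge0//.
  have -> : c (k%:R / N.+1%:R) i - c (k%:R / N.+1%:R) j =
      (1 - k%:R / N.+1%:R) *: (a i - a j) + k%:R / N.+1%:R *: (b i - b j).
    by apply/rowP => l; rewrite !mxE; ring.
  rewrite mulrC ler_pdivrMr ?ltr0n//.
  apply: le_trans (abC i j (k%:R / N.+1%:R) Si Sj _) _.
    by apply/andP; split; [rewrite divr_ge0|rewrite ler_pdivrMr ?ltr0n// mul1r ler_nat ltnW].
  rewrite mulrAC; apply: ler_wpM2r; rewrite ?normr_ge0//; lra.
have := step _ (leqnn _); rewrite divff ?pnatr_eq0//.
suff -> : c 1 = b by [].
by apply/funext => i; rewrite /c subrr scale0r scale1r add0r.
Qed.
End Isotopy.

(** * Straight-line isotopies in coordinates *)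

Section Coordinates.
Variable R : realType.
Implicit Types (A B K : set (R3pt R)) (x y t z c L m r : R) (p q : R3pt R).

Definition xc p : R := p 0 (@Ordinal 3 0 isT).
Definition tc p : R := p 0 (@Ordinal 3 1 isT).
Definition zc p : R := p 0 (@Ordinal 3 2 isT).

Lemma xc_pt x t z : xc (pt x t z) = x. Proof. by rewrite /xc mxE. Qed.
Lemma tc_pt x t z : tc (pt x t z) = t. Proof. by rewrite /tc mxE. Qed.
Lemma zc_pt x t z : zc (pt x t z) = z. Proof. by rewrite /zc mxE. Qed.

Lemma ptP p q : xc p = xc q -> tc p = tc q -> zc p = zc q -> p = q.
Proof.
move=> ex et ez; apply/rowP => -[[|[|[|//]]] lt3]; [move: ex|move: et|move: ez];
  by rewrite /xc /tc /zc (bool_irrelevance lt3 isT).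
Qed.

Lemma pt_eta p : p = pt (xc p) (tc p) (zc p).
Proof. by apply: ptP; rewrite ?xc_pt ?tc_pt ?zc_pt. Qed.

Lemma ptD x t z x' t' z' : pt x t z + pt x' t' z' = pt (x + x') (t + t') (z + z').
Proof. by apply: ptP; rewrite /xc /tc /zc !mxE. Qed.
Lemma ptN x t z : - pt x t z = pt (- x) (- t) (- z).
Proof. by apply: ptP; rewrite /xc /tc /zc !mxE. Qed.
Lemma ptZ c x t z : c *: pt x t z = pt (c * x) (c * t) (c * z).
Proof. by apply: ptP; rewrite /xc /tc /zc !mxE. Qed.

Lemma pt_norm_leP x t z m : 0 <= m ->
  (`|pt x t z| <= m) = [&& `|x| <= m, `|t| <= m & `|z| <= m].
Proof.
move=> m0; apply/idP/idP => [ptm|/and3P[xm tm zm]].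
  by apply/and3P; split; apply: le_trans ptm;
    [rewrite -[x in `|x| <= _](xc_pt x t z)|rewrite -[t in `|t| <= _](tc_pt x t z)|
     rewrite -[z in `|z| <= _](zc_pt x t z)]; exact: pt_entry.
by apply: pt_norm_le => // -[[|[|[|//]]] lt3]; rewrite mxE.
Qed.

(** The sup norm is replaced by an arbitrary common bound [m] of the three coordinate distances, so
    that the criterion can be checked by linear arithmetic. *)
Lemma straight_line_pt (I : Type) (S : set I) (ax at_ az bx bt bz : I -> R) C :
  (forall i j r m, S i -> S j -> 0 <= r <= 1 ->
    `|(1 - r) * (ax i - ax j) + r * (bx i - bx j)| <= m ->
    `|(1 - r) * (at_ i - at_ j) + r * (bt i - bt j)| <= m ->
    `|(1 - r) * (az i - az j) + r * (bz i - bz j)| <= m ->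
    [/\ `|(bx i - ax i) - (bx j - ax j)| <= C * m,
        `|(bt i - at_ i) - (bt j - at_ j)| <= C * m &
        `|(bz i - az i) - (bz j - az j)| <= C * m]) ->
  ambient_isotopic ((fun i => pt (ax i) (at_ i) (az i)) @` S)
                   ((fun i => pt (bx i) (bt i) (bz i)) @` S).
Proof.
move=> H; apply: (@straight_line_isotopic _ _ _ _ _ C) => i j r Si Sj r01.
rewrite !(ptN, ptD, ptZ).
set m := `|pt ((1 - r) * _ + _) _ _|; have m0 : 0 <= m by rewrite normr_ge0.
have : m <= m by []. rewrite {1}/m pt_norm_leP// => /and3P[h1 h2 h3].
have [k1 k2 k3] := H i j r m Si Sj r01 h1 h2 h3.
have Cm0 : 0 <= C * m by exact: le_trans (normr_ge0 _) k1.
by rewrite pt_norm_leP// k1 k2 k3.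
Qed.

(** Interpolating between the identity and a map of slope at least [c], with [c <= 1], keeps slope
    at least [c]; hence points never approach by more than the factor [c]. *)
Lemma coord_isotopic K (f g : R -> R) c C : 0 < c -> c <= 1 ->
  (forall x y, x <= y -> c * (y - x) <= f y - f x <= C * (y - x)) ->
  (forall x y, x <= y -> c * (y - x) <= g y - g x <= C * (y - x)) ->
  ambient_isotopic K ((fun p => pt (f (xc p)) (g (tc p)) (zc p)) @` K).
Proof.
move=> c0 c1 fC gC.
have {1}-> : K = (fun p => pt (xc p) (tc p) (zc p)) @` K.
  apply/seteqP; split => [p Kp|_ [p Kp <-]]; last by rewrite -pt_eta.
  by exists p => //; rewrite -pt_eta.
have mono (h : R -> R) x y r m : (forall x y, x <= y -> c * (y - x) <= h y - h x <= C * (y - x)) ->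
  0 <= r <= 1 -> `|(1 - r) * (x - y) + r * (h x - h y)| <= m ->
  `|(h x - x) - (h y - y)| <= (`|C| + 1) / c * m.
  move=> hC /andP[r0 r1]; wlog yx : x y / y <= x.
    move=> W; have [/W//|/ltW/W] := leP y x.
    have -> : `|(1 - r) * (x - y) + r * (h x - h y)| = `|(1 - r) * (y - x) + r * (h y - h x)|.
      by rewrite -normrN; congr (`|_|); ring.
    by rewrite (distrC (h x - x)).
  have /andP[h1 h2] := hC _ _ yx.
  have d0 : 0 <= x - y by rewrite subr_ge0.
  move: h1 h2; set d := x - y in d0 *; set e := h x - h y => h1 h2.
  have -> : h x - x - (h y - y) = e - d by rewrite /e /d; ring.
  have e0 : 0 <= e by apply: le_trans h1; rewrite mulr_ge0// ltW.
  have : c * d <= (1 - r) * d + r * e.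
    have : r * (c * d) <= r * e by exact: ler_wpM2l.
    have : (1 - r) * (c * d) <= (1 - r) * d.
      by apply: ler_wpM2l; [rewrite subr_ge0|rewrite ler_piMl].
    lra.
  move=> /le_trans H /(le_trans (ler_norm _))/H cdm.
  have : `|e - d| <= (`|C| + 1) * d.
    rewrite mulrDl mul1r; have : e <= `|C| * d.
      by apply: le_trans h2 _; apply: ler_wpM2r => //; exact: ler_norm.
    by rewrite ler_norml => ?; apply/andP; split; lra.
  move=> /le_trans; apply; rewrite -mulrA; apply: ler_wpM2l; first by rewrite addr_ge0.
  by rewrite mulrC ler_pdivlMr// mulrC.
apply: (@straight_line_pt _ _ _ _ _ _ _ _ ((`|C| + 1) / c)) => p q r m _ _ r01 h1 h2 h3.
split; [exact: mono h1|exact: mono h2|].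
rewrite !subrr normr0; apply: le_trans (normr_ge0 _) (mono f _ _ _ _ fC r01 h1).
Qed.

(** Projections do not move, and they alone control the differences of displacements. The factor 2
    passes from the sum of two coordinate distances to their maximum. *)
Lemma shear_isotopic K (f : R -> R -> R) L :
  (forall x t x' t', `|f x t - f x' t'| <= L * (`|x - x'| + `|t - t'|)) ->
  ambient_isotopic K ((fun p => pt (xc p) (tc p) (zc p + f (xc p) (tc p))) @` K).
Proof.
move=> fL.
have {1}-> : K = (fun p => pt (xc p) (tc p) (zc p)) @` K.
  apply/seteqP; split => [p Kp|_ [p Kp <-]]; last by rewrite -pt_eta.
  by exists p => //; rewrite -pt_eta.
have L0 : 0 <= L.
  have := fL 1 0 0 0; rewrite subr0 subrr normr0 normr1 addr0 mulr1.
  exact: le_trans (normr_ge0 _).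
apply: (@straight_line_pt _ _ _ _ _ _ _ _ (2 * L)) => p q r m _ _ r01 h1 h2 h3.
rewrite (_ : _ + _ * _ = xc p - xc q) in h1; last by ring.
rewrite (_ : _ + _ * _ = tc p - tc q) in h2; last by ring.
have m0 : 0 <= m by exact: le_trans h1.
rewrite !subrr normr0; split; rewrite ?mulr_ge0//.
rewrite (_ : _ - _ = f (xc p) (tc p) - f (xc q) (tc q)); last by ring.
apply: le_trans (fL _ _ _ _) _; rewrite (mulrC 2) -mulrA; apply: ler_wpM2l => //; lra.
Qed.
End Coordinates.

(** * Replacing the strands inside a slab *)

Section Slab.
Variable R : realType.
Implicit Types (A K : set (R3pt R)) (x y t z C k m r u v : R) (p q : R3pt R).

Definition lipschitz1 (f : R -> R) := exists2 C, 0 <= C & forall u v, `|f u - f v| <= C * `|u - v|.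

Lemma lipschitz1_cst c : lipschitz1 (fun=> c).
Proof. by exists 0 => // u v; rewrite subrr normr0 mul0r. Qed.
Lemma lipschitz1_id : lipschitz1 id.
Proof. by exists 1 => // u v; rewrite mul1r. Qed.
Lemma lipschitz1D f g : lipschitz1 f -> lipschitz1 g -> lipschitz1 (fun u => f u + g u).
Proof.
move=> [C C0 fC] [D D0 gD]; exists (C + D) => [|u v]; first exact: addr_ge0.
rewrite mulrDl opprD addrACA; apply: le_trans (ler_normD _ _) _.
by apply: lerD.
Qed.
Lemma lipschitz1Z c f : lipschitz1 f -> lipschitz1 (fun u => c * f u).
Proof.
move=> [C C0 fC]; exists (`|c| * C) => [|u v]; first by rewrite mulr_ge0.
by rewrite -mulrBr normrM -mulrA ler_wpM2l.
Qed.
Lemma lipschitz1N f : lipschitz1 f -> lipschitz1 (fun u => - f u).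
Proof.
by move=> [C C0 fC]; exists C => // u v; rewrite -opprD normrN; exact: fC.
Qed.
Lemma lipschitz1B f g : lipschitz1 f -> lipschitz1 g -> lipschitz1 (fun u => f u - g u).
Proof. by move=> lf lg; apply: lipschitz1D => //; exact: lipschitz1N. Qed.
Lemma lipschitz1_comp f g : lipschitz1 f -> lipschitz1 g -> lipschitz1 (fun u => f (g u)).
Proof.
move=> [C C0 fC] [D D0 gD]; exists (C * D) => [|u v]; first exact: mulr_ge0.
by apply: le_trans (fC _ _) _; rewrite -mulrA ler_wpM2l.
Qed.
Lemma lipschitz1_clamp01 : lipschitz1 (@clamp01 R).
Proof. by exists 1 => // u v; rewrite mul1r clamp01_lip. Qed.
Lemma lipschitz1_continuous f : lipschitz1 f -> continuous f.
Proof.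
move=> [C C0 fC] u; apply/(@cvgrPdist_lt _ _ _ (nbhs u) (nbhs_filter u)) => e e0.
have C1 : 0 < C + 1 by rewrite ltr_wpDl.
apply: (iffRL (@nbhs_normP R R u _)); exists (e / (C + 1)); first by rewrite /= divr_gt0.
move=> v; rewrite /= ltr_pdivlMr// => uv; apply: le_lt_trans (fC u v) _.
by have := normr_ge0 (u - v); rewrite mulrDr mulr1 in uv => ?; lra.
Qed.

Lemma finite_uniform_bound (F : finType) (P : F -> R -> Prop) :
  (forall i C D, C <= D -> P i C -> P i D) -> (forall i, exists C, P i C) ->
  exists2 C, 0 <= C & forall i, P i C.
Proof.
move=> Pmono /choice[f Pf]; exists (\sum_i `|f i|); first by rewrite sumr_ge0.
move=> i; apply: Pmono (Pf i); rewrite (bigD1 i)//=.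
by rewrite (le_trans (ler_norm _))// lerDl sumr_ge0.
Qed.

Definition slab (s : nat) (k : R) (X Z : 'I_s -> R -> R) : set (R3pt R) :=
  [set p | exists i u, 0 <= u <= 1 /\ p = pt (X i u) (k + u) (Z i u)].

(** Compactness: the sum of the three distances is continuous on the cube of all [(r, u, v)]. Where
    it vanishes, its middle term gives [u = v], and the last hypothesis excludes that; so it has a
    positive minimum. The conclusion [1 <= C * m] says that two strands keep distance at least
    [1 / C] throughout the homotopy. *)
Lemma separation (f g f' g' h j h' j' : R -> R) :
  lipschitz1 f -> lipschitz1 g -> lipschitz1 f' -> lipschitz1 g' ->
  lipschitz1 h -> lipschitz1 j -> lipschitz1 h' -> lipschitz1 j' ->
  (forall r u, 0 <= r <= 1 -> 0 <= u <= 1 ->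
     (1 - r) * (f u - g u) + r * (f' u - g' u) = 0 ->
     (1 - r) * (h u - j u) + r * (h' u - j' u) = 0 -> False) ->
  exists C, 0 <= C /\ forall r u v m, 0 <= r <= 1 -> 0 <= u <= 1 -> 0 <= v <= 1 ->
     `|(1 - r) * (f u - g v) + r * (f' u - g' v)| <= m ->
     `|u - v| <= m ->
     `|(1 - r) * (h u - j v) + r * (h' u - j' v)| <= m -> 1 <= C * m.
Proof.
move=> /lipschitz1_continuous cf /lipschitz1_continuous cg /lipschitz1_continuous cf'
  /lipschitz1_continuous cg' /lipschitz1_continuous ch /lipschitz1_continuous cj
  /lipschitz1_continuous ch' /lipschitz1_continuous cj' H.
have c1 : continuous (fun w : R * (R * R) => w.1) by move=> w; exact: cvg_fst.
have c2 : continuous (fun w : R * (R * R) => w.2.1).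
  by move=> w; apply: (@continuous_comp _ _ _ snd fst w); [exact: cvg_snd|exact: cvg_fst].
have c3 : continuous (fun w : R * (R * R) => w.2.2).
  by move=> w; apply: (@continuous_comp _ _ _ snd snd w); [exact: cvg_snd|exact: cvg_snd].
have cc (a : R * (R * R) -> R) (e : R -> R) : continuous e -> continuous a -> continuous (fun w => e (a w)).
  by move=> ce ca w; exact: (@continuous_comp _ _ _ a e w (ca w) (ce _)).
have cN (a : R * (R * R) -> R) : continuous a -> continuous (fun w => `|a w|).
  by move=> ca w; exact: (@continuous_comp _ _ _ a (fun x : R => `|x|) w (ca w) (@norm_continuous _ _ _)).
have cD (a b : R * (R * R) -> R) : continuous a -> continuous b -> continuous (fun w => a w + b w).
  by move=> ca cb w; apply: continuousD; [exact: ca|exact: cb].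
have cB (a b : R * (R * R) -> R) : continuous a -> continuous b -> continuous (fun w => a w - b w).
  by move=> ca cb w; apply: continuousB; [exact: ca|exact: cb].
have cM (a b : R * (R * R) -> R) : continuous a -> continuous b -> continuous (fun w => a w * b w).
  by move=> ca cb w; apply: continuousM; [exact: ca|exact: cb].
pose G (e e' d d' : R -> R) (w : R * (R * R)) :=
  `|(1 - w.1) * (e w.2.1 - d w.2.2) + w.1 * (e' w.2.1 - d' w.2.2)|.
have cG (e e' d d' : R -> R) : continuous e -> continuous e' -> continuous d ->
    continuous d' -> continuous (G e e' d d').
  move=> ce ce' cd cd'.
  have h1 : continuous (fun w : R * (R * R) => 1 - w.1) by apply: (cB) => //; move=> w; exact: cst_continuous.
  apply: (cN); apply: (cD); apply: (cM) => //; apply: (cB).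
  - exact: (cc _ _ ce c2).
  - exact: (cc _ _ cd c3).
  - exact: (cc _ _ ce' c2).
  - exact: (cc _ _ cd' c3).
pose F w := G f f' g g' w + `|w.2.1 - w.2.2| + G h h' j j' w.
have cF : continuous F.
  apply: (cD); last exact: cG.
  apply: (cD); first exact: cG.
  by apply: (cN); apply: (cB).
pose D : set (R * (R * R)) := `[0, 1] `*` (`[0, 1] `*` `[0, 1]).
have cD01 : compact D by apply: compact_setX; [|apply: compact_setX]; exact: segment_compact.
have [||w Dw Fw] := @compact_EVT_min (R * (R * R))%type R F D _ cD01.
- by exists (0, (0, 0)); split => /=; [|split => /=]; rewrite in_itv/= lexx ler01.
- exact: continuous_subspaceT.
move: Dw; rewrite inE => -[/= w1 [w2 w3]]; rewrite !in_itv/= in w1 w2 w3.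
have Fpos : 0 < F w.
  have F0 : 0 <= F w by rewrite /F /G !addr_ge0 ?normr_ge0.
  rewrite lt_neqAle F0 andbT; apply/negP => /eqP/esym/eqP.
  rewrite /F /G paddr_eq0 ?addr_ge0 ?normr_ge0// paddr_eq0 ?normr_ge0// -andbA => /and3P[/eqP/normr0_eq0 e1 /eqP/normr0_eq0 e2 /eqP/normr0_eq0 e3].
  move/eqP: e2; rewrite subr_eq0 => /eqP e2; rewrite -e2 in e1 e3.
  exact: H w1 w2 e1 e3.
(* Each of the three terms of [F] is at most [m], so the minimum [F w] is at most [3 * m]. *)
exists (3 / F w); split; first by rewrite divr_ge0// ltW.
move=> r u v m r01 u01 v01 h1 h2 h3.
have : F w <= F (r, (u, v)).
  by apply: Fw; rewrite inE; split => /=; [|split => /=]; rewrite in_itv.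
rewrite {2}/F /G /= => FF; rewrite mulrAC ler_pdivlMr// mul1r; lra.
Qed.

(* [A] may touch the slab only at its two end levels or in the region reserved for the closing arcs. *)
Lemma slab_isotopic (s : nat) A k (X Z X' Z' : 'I_s -> R -> R) :
  (forall i, lipschitz1 (X i)) -> (forall i, lipschitz1 (Z i)) ->
  (forall i, lipschitz1 (X' i)) -> (forall i, lipschitz1 (Z' i)) ->
  (forall i, X i 0 = X' i 0) -> (forall i, Z i 0 = Z' i 0) ->
  (forall i, X i 1 = X' i 1) -> (forall i, Z i 1 = Z' i 1) ->
  (forall i u, 0 <= u <= 1 -> 0 <= X i u /\ 0 <= X' i u) ->
  (forall i j r u, i != j -> 0 <= r <= 1 -> 0 <= u <= 1 ->
     (1 - r) * (X i u - X j u) + r * (X' i u - X' j u) = 0 ->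
     (1 - r) * (Z i u - Z j u) + r * (Z' i u - Z' j u) = 0 -> False) ->
  (forall p, A p -> [\/ tc p <= k, k + 1 <= tc p | xc p <= -1]) ->
  ambient_isotopic (A `|` slab k X Z) (A `|` slab k X' Z').
Proof.
move=> lX lZ lX' lZ' X0 Z0 X1 Z1 Xge0 ncol AP.
have [L L0 HL] : exists2 L, 0 <= L & forall i,
    (forall u v, `|(X' i u - X i u) - (X' i v - X i v)| <= L * `|u - v|) /\
    (forall u v, `|(Z' i u - Z i u) - (Z' i v - Z i v)| <= L * `|u - v|).
  apply: finite_uniform_bound => [i C D CD [h1 h2]|i].
    by split=> u v; [apply: le_trans (h1 u v) _|apply: le_trans (h2 u v) _];
      apply: ler_wpM2r.
  have [C C0 h1] := lipschitz1B (lX' i) (lX i).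
  have [D D0 h2] := lipschitz1B (lZ' i) (lZ i).
  exists (C + D); split=> u v; [apply: le_trans (h1 u v) _|apply: le_trans (h2 u v) _];
    by apply: ler_wpM2r => //; lra.
have [C C0 HC] : exists2 C, 0 <= C & forall ij : 'I_s * 'I_s, ij.1 != ij.2 ->
    forall r u v m, 0 <= r <= 1 -> 0 <= u <= 1 -> 0 <= v <= 1 ->
     `|(1 - r) * (X ij.1 u - X ij.2 v) + r * (X' ij.1 u - X' ij.2 v)| <= m ->
     `|u - v| <= m ->
     `|(1 - r) * (Z ij.1 u - Z ij.2 v) + r * (Z' ij.1 u - Z' ij.2 v)| <= m -> 1 <= C * m.
  apply: finite_uniform_bound => [ij C D CD h ne r u v m r01 u01 v01 h1 h2 h3|[i j]/=].
    apply: le_trans (h ne r u v m r01 u01 v01 h1 h2 h3) _.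
    by apply: ler_wpM2r => //; exact: le_trans h2.
  have [->|ne] := eqVneq i j; first by exists 0.
  have [|C [C0 h]] := @separation (X i) (X j) (X' i) (X' j) (Z i) (Z j) (Z' i) (Z' j)
    (lX _) (lX _) (lX' _) (lX' _) (lZ _) (lZ _) (lZ' _) (lZ' _).
    by move=> r u; exact: ncol.
  by exists C => _; exact: h.
(* Both motions agree at the two ends of the slab, so a displacement is at most [L] times the
   distance in time to either end. *)
have dle i u : 0 <= u <= 1 -> [/\ `|X' i u - X i u| <= L * u, `|X' i u - X i u| <= L * (1 - u),
    `|Z' i u - Z i u| <= L * u & `|Z' i u - Z i u| <= L * (1 - u)].
  move=> /andP[u0 u1]; have [hX hZ] := HL i.
  have := hX u 0; rewrite X0 subrr !subr0 (ger0_norm u0) => ->.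
  have := hZ u 0; rewrite Z0 subrr !subr0 (ger0_norm u0) => ->.
  have := hX u 1; rewrite X1 subrr !subr0 distrC (distrC u) (ger0_norm (_ : 0 <= 1 - u)) ?subr_ge0// distrC => ->.
  by have := hZ u 1; rewrite Z1 subrr !subr0 distrC (distrC u) (ger0_norm (_ : 0 <= 1 - u)) ?subr_ge0// distrC => ->.
pose J := (('I_s * R) + R3pt R)%type.
pose S : set J := fun w => match w with inl iu => 0 <= iu.2 <= 1 | inr p => A p end.
pose cx (Y : 'I_s -> R -> R) (w : J) := match w with inl iu => Y iu.1 iu.2 | inr p => xc p end.
pose cz (Y : 'I_s -> R -> R) (w : J) := match w with inl iu => Y iu.1 iu.2 | inr p => zc p end.
pose ct (w : J) := match w with inl iu => k + iu.2 | inr p => tc p end.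
have setE (Y W : 'I_s -> R -> R) : A `|` slab k Y W = (fun w => pt (cx Y w) (ct w) (cz W w)) @` S.
  apply/seteqP; split => [p [Ap|[i [u [u01 ->]]]]|_ [[[i u]|p] /= Sw <-]].
  - by exists (inr p) => //=; rewrite -pt_eta.
  - by exists (inl (i, u)).
  - by right; exists i, u.
  - by left; rewrite -pt_eta.
rewrite !setE.
(* A point of [A] outside the slab is at least as far from the strand as the nearer end level, where
   the displacement vanishes. A point with [x <= -1] is at distance at least 1, because strands have
   [x >= 0], and 1 bounds [u]. *)
have mixed i u p r m : 0 <= u <= 1 -> A p -> 0 <= r <= 1 ->
    `|(1 - r) * (X i u - xc p) + r * (X' i u - xc p)| <= m ->
    `|k + u - tc p| <= m ->
    `|X' i u - X i u| <= L * m /\ `|Z' i u - Z i u| <= L * m.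
  move=> u01 Ap /andP[r0 r1] h1 h2; have [d1 d2 d3 d4] := dle i u u01.
  have /andP[u0 u1] := u01.
  have um : u <= m \/ 1 - u <= m.
    case: (AP _ Ap) => h.
    - by left; have := ler_norm (k + u - tc p); lra.
    - by right; have := ler_norm (- (k + u - tc p)); rewrite normrN; lra.
    - left; have := ler_norm ((1 - r) * (X i u - xc p) + r * (X' i u - xc p)).
      have [x0 x0'] := Xge0 i u u01.
      have : 0 <= (1 - r) * X i u by rewrite mulr_ge0// subr_ge0.
      have : 0 <= r * X' i u by rewrite mulr_ge0.
      lra.
  case: um => /(ler_wpM2l L0) um.
    by split; [exact: le_trans d1 um|exact: le_trans d3 um].
  by split; [exact: le_trans d2 um|exact: le_trans d4 um].
have widen m y : 0 <= m -> y <= L * m -> y <= (L + 2 * L * C) * m.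
  by move=> m0 /le_trans; apply; apply: ler_wpM2r => //; rewrite lerDl !mulr_ge0.
have widen2 m a b : 0 <= m -> 1 <= C * m -> `|a| <= L -> `|b| <= L -> `|a - b| <= (L + 2 * L * C) * m.
  move=> m0 Cm aL bL; apply: le_trans (ler_normB _ _) _; apply: le_trans (lerD aL bL) _.
  have h : L * 1 <= L * (C * m) by exact: ler_wpM2l.
  by have := mulr_ge0 L0 m0; lra.
apply: (@straight_line_pt _ _ _ _ _ _ _ _ _ (L + 2 * L * C)) => -[[i u]|p] [[j v]|q] r m /= Sw Sw' r01 h1 h2 h3.
- have e2 : (1 - r) * (k + u - (k + v)) + r * (k + u - (k + v)) = u - v by ring.
  rewrite e2 in h2; have m0 : 0 <= m by exact: le_trans h2.
  have Lm : 0 <= L * m by rewrite mulr_ge0.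
  rewrite (_ : `|k + u - _ - _| = 0); last by apply/normr0P/eqP; ring.
  have [ij|ij] := eqVneq i j.
    subst j; have [hX hZ] := HL i.
    have uv : L * `|u - v| <= L * m by exact: ler_wpM2l.
    by split; apply: widen => //; [exact: le_trans (hX u v) uv|exact: le_trans (hZ u v) uv].
  have Cm := HC (i, j) ij r u v m r01 Sw Sw' h1 h2 h3.
  have [d1 _ d3 _] := dle i u Sw; have [d1' _ d3' _] := dle j v Sw'.
  have Lu : L * u <= L by rewrite ler_piMr//; case/andP: Sw.
  have Lv : L * v <= L by rewrite ler_piMr//; case/andP: Sw'.
  split; [|exact: widen|]; apply: widen2 => //;
    [exact: le_trans d1 Lu|exact: le_trans d1' Lv|exact: le_trans d3 Lu|exact: le_trans d3' Lv].
- have e2 : (1 - r) * (k + u - tc q) + r * (k + u - tc q) = k + u - tc q by ring.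
  rewrite e2 in h2; have m0 : 0 <= m by exact: le_trans h2.
  have [k1 k2] := mixed i u q r m Sw Sw' r01 h1 h2.
  by rewrite !subrr !subr0 normr0; split; apply: widen => //; rewrite mulr_ge0.
- have e2 : (1 - r) * (tc p - (k + v)) + r * (tc p - (k + v)) = - (k + v - tc p) by ring.
  rewrite e2 normrN in h2; have m0 : 0 <= m by exact: le_trans h2.
  have e1 : (1 - r) * (xc p - X j v) + r * (xc p - X' j v) =
    - ((1 - r) * (X j v - xc p) + r * (X' j v - xc p)) by ring.
  rewrite e1 normrN in h1.
  have [k1 k2] := mixed j v p r m Sw' Sw r01 h1 h2.
  by rewrite !subrr !sub0r !normrN normr0; split; apply: widen => //; rewrite mulr_ge0.
- have m0 : 0 <= m by exact: le_trans h1.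
  by rewrite !subrr normr0 mulr_ge0// addr_ge0// !mulr_ge0.
Qed.
End Slab.

(** * Words of constant-height braids *)

Section Reversal.
Variable s : nat.

(** Taking the identity when the window leaves the row gives an injection for all [j] and [m], so
    [rev_perm] needs no proof that the window fits. *)
Definition rev_fun (j m : nat) (i : 'I_s) : 'I_s :=
  insubd i (if [&& j + m <= s, j <= i & i < j + m]%N then (j + (m - 1 - (i - j)))%N else i).

Lemma val_rev_fun j m i : rev_fun j m i =
  (if [&& j + m <= s, j <= i & i < j + m]%N then (j + (m - 1 - (i - j)))%N else i) :> nat.
Proof.
rewrite val_insubd; case: ifP => // /negP[].
by case: ifP => [/and3P[? ? ?]|_]; [lia|exact: ltn_ord].
Qed.

Lemma rev_fun_inj j m : injective (rev_fun j m).
Proof.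
move=> i i' /(congr1 val); rewrite /= !val_rev_fun => e; apply/val_inj => /=; move: e.
case: ifP => [/and3P[? ? ?]|/and3P h1]; case: ifP => [/and3P[? ? ?]|/and3P h2] //; try lia.
- by move=> e; exfalso; apply: h2; rewrite -e; split; lia.
- by move=> e; exfalso; apply: h1; rewrite e; split; lia.
Qed.

Definition rev_perm j m : {perm 'I_s} := perm (@rev_fun_inj j m).

Lemma rev_permE j m (i : 'I_s) : (j + m <= s)%N ->
  rev_perm j m i = (if (j <= i < j + m)%N then (j + (m - 1 - (i - j)))%N else i) :> nat.
Proof. by move=> h; rewrite permE val_rev_fun h. Qed.
End Reversal.

Section Words.
Variable R : realType.
Implicit Types (x y t z c r u v : R) (p q : R3pt R) (k T : nat).

(** [rho] and [lam] encode the three phases of [strand_piece]: a string rises during [0, 1/4],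
    travels sideways during [1/4, 3/4] and comes down afterwards. Sideways motion thus happens only
    at full height. *)
Definition rho u : R := clamp01 (2 * u - 2^-1).
Definition lam u : R := clamp01 (4 * u) + clamp01 (4 - 4 * u) - 1.

Lemma rho01 u : 0 <= rho u <= 1.
Proof. by rewrite clamp01_ge0 clamp01_le1. Qed.
Lemma rho0 : rho 0 = 0. Proof. by rewrite /rho clamp01_eq0//; lra. Qed.
Lemma rho1 : rho 1 = 1. Proof. by rewrite /rho clamp01_eq1//; lra. Qed.
Lemma lam_ge0 u : 0 <= lam u.
Proof.
rewrite /lam; case: (clamp01P (4 * u)) => -[? ->];
  case: (clamp01P (4 - 4 * u)) => -[? ->]; lra.
Qed.
Lemma lam0 : lam 0 = 0.
Proof. by rewrite /lam clamp01_eq0 ?clamp01_eq1//; lra. Qed.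
Lemma lam1 : lam 1 = 0.
Proof. by rewrite /lam clamp01_eq1 ?clamp01_eq0//; lra. Qed.
Lemma lam_gt0 u : 0 < u < 1 -> 0 < lam u.
Proof.
rewrite /lam; case: (clamp01P (4 * u)) => -[? ->];
  case: (clamp01P (4 - 4 * u)) => -[? ->]; lra.
Qed.
Lemma lam_rho u : 0 < rho u < 1 -> lam u = 1.
Proof.
rewrite /rho /lam; case: (clamp01P (2 * u - 2^-1)) => -[? ->] ?;
case: (clamp01P (4 * u)) => -[? ->];
  case: (clamp01P (4 - 4 * u)) => -[? ->]; lra.
Qed.

Lemma lipschitz1_rho : lipschitz1 rho.
Proof.
apply: lipschitz1_comp; first exact: lipschitz1_clamp01.
by apply: lipschitz1B; [apply: lipschitz1Z; exact: lipschitz1_id|exact: lipschitz1_cst].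
Qed.
Lemma lipschitz1_lam : lipschitz1 lam.
Proof.
apply: lipschitz1B; last exact: lipschitz1_cst.
apply: lipschitz1D; apply: lipschitz1_comp; try exact: lipschitz1_clamp01.
  by apply: lipschitz1Z; exact: lipschitz1_id.
by apply: lipschitz1B; [exact: lipschitz1_cst|apply: lipschitz1Z; exact: lipschitz1_id].
Qed.

Section FixedWidth.
Variable s : nat.
Implicit Types (i j : 'I_s) (h : 'I_s -> R) (pi : {perm 'I_s}).

(* A letter [(pi, h)] stands for the braid on which string [i] travels to position [pi i] at constant
   height [h i], rising from height 0 before and returning to it afterwards. *)
Definition letter := ({perm 'I_s} * ('I_s -> R))%type.

Definition strand_x pi i u : R := i%:R + rho u * ((pi i)%:R - i%:R).
Definition strand_z h i u : R := lam u * h i.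

Definition slot k (l : letter) : set (R3pt R) :=
  slab k%:R (strand_x l.1) (strand_z l.2).

Fixpoint slots k (w : seq letter) : set (R3pt R) :=
  if w is l :: w' then slot k l `|` slots k.+1 w' else set0.

Definition arcs T : set (R3pt R) :=
  \bigcup_(p in [set p : nat | (p < s)%N]) closure_arc R T s p.

Definition word_closure (w : seq letter) := slots 0 w `|` arcs (size w).

Lemma strand_x0 pi i : strand_x pi i 0 = i%:R.
Proof. by rewrite /strand_x rho0 mul0r addr0. Qed.
Lemma strand_x1 pi i : strand_x pi i 1 = (pi i)%:R.
Proof. by rewrite /strand_x rho1 mul1r addrC subrK. Qed.
Lemma strand_x_ge0 pi i u : 0 <= strand_x pi i u.
Proof.
have /andP[r0 r1] := rho01 u.
rewrite /strand_x (_ : _ + _ = (1 - rho u) * i%:R + rho u * (pi i)%:R); last by ring.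
by rewrite addr_ge0// mulr_ge0// subr_ge0.
Qed.
Lemma strand_z0 h i : strand_z h i 0 = 0. Proof. by rewrite /strand_z lam0 mul0r. Qed.
Lemma strand_z1 h i : strand_z h i 1 = 0. Proof. by rewrite /strand_z lam1 mul0r. Qed.
Lemma lipschitz1_strand_x pi i : lipschitz1 (strand_x pi i).
Proof.
apply: lipschitz1D; first exact: lipschitz1_cst.
rewrite (_ : (fun u => _) = (fun u => ((pi i)%:R - i%:R) * rho u)); last by apply/funext => u; rewrite mulrC.
by apply: lipschitz1Z; exact: lipschitz1_rho.
Qed.
Lemma lipschitz1_strand_z h i : lipschitz1 (strand_z h i).
Proof.
rewrite /strand_z (_ : (fun u => _) = (fun u => h i * lam u)); last by apply/funext => u; rewrite mulrC.
by apply: lipschitz1Z; exact: lipschitz1_lam.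
Qed.

Lemma slots_cat k w1 w2 : slots k (w1 ++ w2) = slots k w1 `|` slots (k + size w1) w2.
Proof.
elim: w1 k => [|l w1 IH] k /=; first by rewrite set0U addn0.
by rewrite IH setUA addSnnS.
Qed.

Lemma slots_time k w p : slots k w p -> k%:R <= tc p <= (k + size w)%:R.
Proof.
elim: w k => [//|l w IH] k /= [[i [u [/andP[u0 u1] ->]]]|/IH].
  by rewrite tc_pt lerDl u0 natrD -natr1 /=; have := ler0n R (size w); lra.
by rewrite addSnnS -natr1 => /andP[? ->]; rewrite andbT; lra.
Qed.

Lemma slots_shift k w x t z : slots k.+1 w (pt x (t + 1) z) <-> slots k w (pt x t z).
Proof.
elim: w k => [//|l w IH] k /=; split => -[[i [u [u01 e]]]|/IH ?]; try by right.
- left; exists i, u; split=> //.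
  have := congr1 (@xc R) e; have := congr1 (@tc R) e; have := congr1 (@zc R) e.
  rewrite !xc_pt !tc_pt !zc_pt -natr1 => <- e2 <-; congr (pt _ _ _); lra.
- left; exists i, u; split=> //.
  have := congr1 (@xc R) e; have := congr1 (@tc R) e; have := congr1 (@zc R) e.
  rewrite !xc_pt !tc_pt !zc_pt -natr1 => <- e2 <-; congr (pt _ _ _); lra.
Qed.

Lemma slotsP k w p (d : letter) : slots k w p <->
  exists2 j, (j < size w)%N & slot (k + j) (nth d w j) p.
Proof.
elim: w k => [|l w IH] k /=; first by split => // -[].
split=> [[lp|/IH[j jw jp]]|[[|j] jw jp]].
- by exists 0%N => //=; rewrite addn0.
- by exists j.+1 => //=; rewrite addnS -addSn.
- by left; move: jp; rewrite /= addn0.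
- by right; apply/IH; exists j => //; rewrite addSnnS.
Qed.
End FixedWidth.

Lemma seg_vert x z t0 t1 q : t0 < t1 -> seg (pt x t0 z) (pt x t1 z) q <->
  [/\ xc q = x, zc q = z & t0 <= tc q <= t1].
Proof.
move=> t01; split => [[r /andP[r0 r1] <-]|[qx qz /andP[h1 h2]]].
  rewrite !(ptZ, ptD) xc_pt tc_pt zc_pt; split; try ring.
  have : 0 <= r * (t1 - t0) by rewrite mulr_ge0// subr_ge0 ltW.
  have : 0 <= (1 - r) * (t1 - t0) by rewrite mulr_ge0// subr_ge0// ltW.
  by move=> ? ?; apply/andP; split; lra.
have d0 : 0 < t1 - t0 by rewrite subr_gt0.
exists ((tc q - t0) / (t1 - t0)) => /=.
  by apply/andP; split; [rewrite divr_ge0 ?subr_ge0// ltW|rewrite ler_pdivrMr// mul1r; lra].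
rewrite !(ptZ, ptD) [RHS]pt_eta qx qz; congr (pt _ _ _); field; lra.
Qed.

Lemma seg_horiz t z x0 x1 q : x0 < x1 -> seg (pt x0 t z) (pt x1 t z) q <->
  [/\ tc q = t, zc q = z & x0 <= xc q <= x1].
Proof.
move=> t01; split => [[r /andP[r0 r1] <-]|[qx qz /andP[h1 h2]]].
  rewrite !(ptZ, ptD) xc_pt tc_pt zc_pt; split; try ring.
  have : 0 <= r * (x1 - x0) by rewrite mulr_ge0// subr_ge0 ltW.
  have : 0 <= (1 - r) * (x1 - x0) by rewrite mulr_ge0// subr_ge0// ltW.
  by move=> ? ?; apply/andP; split; lra.
have d0 : 0 < x1 - x0 by rewrite subr_gt0.
exists ((xc q - x0) / (x1 - x0)) => /=.
  by apply/andP; split; [rewrite divr_ge0 ?subr_ge0// ltW|rewrite ler_pdivrMr// mul1r; lra].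
rewrite !(ptZ, ptD) [RHS]pt_eta qx qz; congr (pt _ _ _); field; lra.
Qed.

Lemma segC p q : seg p q = seg q p.
Proof.
by apply/seteqP; split => _ [r /andP[r0 r1] <-]; exists (1 - r);
  [apply/andP; split; lra|rewrite addrC; congr (_ + _ *: _); ring|
   apply/andP; split; lra|rewrite addrC; congr (_ + _ *: _); ring].
Qed.

Lemma closure_arcP T m k q : closure_arc R T m k q <-> zc q = 0 /\
  [\/ xc q = k%:R /\ T%:R <= tc q <= T%:R + k.+1%:R,
      tc q = T%:R + k.+1%:R /\ - k.+1%:R <= xc q <= k%:R,
      xc q = - k.+1%:R /\ - k.+1%:R <= tc q <= T%:R + k.+1%:R |
      tc q = - k.+1%:R /\ - k.+1%:R <= xc q <= k%:R \/
      xc q = k%:R /\ - k.+1%:R <= tc q <= 0].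
Proof.
have k0 := ler0n R k; have T0 := ler0n R T; have kk : (k.+1%:R : R) = k%:R + 1 by rewrite -natr1.
have h1 : (T%:R : R) < T%:R + k.+1%:R by lra.
have h2 : - (k.+1%:R : R) < k%:R by lra.
have h3 : - (k.+1%:R : R) < T%:R + k.+1%:R by lra.
have h4 : - (k.+1%:R : R) < 0 by lra.
rewrite /closure_arc (segC (pt k%:R (T%:R + _) 0)) (segC (pt (- k.+1%:R) (T%:R + _) 0) (pt _ (- _) 0)).
have e1 := seg_vert k%:R 0 q h1; have e2 := seg_horiz (T%:R + k.+1%:R) 0 q h2.
have e3 := seg_vert (- k.+1%:R) 0 q h3; have e4 := seg_horiz (- k.+1%:R) 0 q h2.
have e5 := seg_vert k%:R 0 q h4.
split=> [[[[[/e1[? ? ?]|/e2[? ? ?]]|/e3[? ? ?]]|/e4[? ? ?]]|/e5[? ? ?]]|].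
- by split=> //; constructor 1.
- by split=> //; constructor 2.
- by split=> //; constructor 3.
- by split=> //; constructor 4; left.
- by split=> //; constructor 4; right.
move=> [? [[? ?]|[? ?]|[? ?]|[[? ?]|[? ?]]]].
- by left; left; left; left; apply/e1.
- by left; left; left; right; apply/e2.
- by left; left; right; apply/e3.
- by left; right; apply/e4.
- by right; apply/e5.
Qed.

Lemma arcs_region s T q : arcs s T q -> [\/ tc q <= 0, T%:R <= tc q | xc q <= -1].
Proof.
move=> [k _ /closure_arcP[_ H]].
have k0 := ler0n R k; have kk : (k.+1%:R : R) = k%:R + 1 by rewrite -natr1.
case: H => [[? /andP[? ?]]|[? /andP[? ?]]|[? /andP[? ?]]|[[? /andP[? ?]]|[? /andP[? ?]]]].
- by constructor 2.
- by constructor 2; lra.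
- by constructor 3; lra.
- by constructor 1; lra.
- by constructor 1; lra.
Qed.
End Words.

(** * Elementary moves *)

Section Moves.
Variable R : realType.
Variable s : nat.
Implicit Types (x y t z c r u v : R) (p q : R3pt R) (k T : nat).
Implicit Types (i j : 'I_s) (h : 'I_s -> R) (pi : {perm 'I_s}) (w : seq (letter R s)).

Local Notation isotopic w w' := (ambient_isotopic (word_closure w) (word_closure w')).

Lemma rest_region k w1 w2 T p : k = size w1 -> (k.+1 <= T)%N ->
  (slots 0 w1 `|` slots k.+1 w2 `|` @arcs R s T) p ->
  [\/ tc p <= k%:R, k%:R + 1 <= tc p | xc p <= -1].
Proof.
move=> -> kT; have kT' : (size w1).+1%:R <= T%:R :> R by rewrite ler_nat.
rewrite -natr1 in kT'; have k0 := ler0n R (size w1).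
case=> [[/slots_time/andP[_]|/slots_time/andP[+ _]]|/arcs_region[?|?|?]].
- by constructor 1.
- by rewrite -natr1; constructor 2.
- by constructor 1; lra.
- by constructor 2; lra.
- by constructor 3.
Qed.

Lemma word_closureE w1 l w2 : word_closure (w1 ++ l :: w2) =
  (slots 0 w1 `|` slots (size w1).+1 w2 `|` @arcs R s (size w1 + size w2).+1) `|` slot (size w1) l.
Proof.
rewrite /word_closure slots_cat size_cat /= add0n addnS.
by rewrite -!setUA; congr (_ `|` _); rewrite [RHS]setUA [RHS]setUC.
Qed.

Lemma perm_neq pi i j : i != j -> (pi i)%:R != (pi j)%:R :> R.
Proof. by move=> ij; rewrite eqr_nat (inj_eq val_inj) (inj_eq perm_inj). Qed.

(** The difference of two strands is a convex combination of the nonzero numbers [i - j] and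
    [pi i - pi j]; it vanishes only when these have opposite signs and neither weight is 0. *)
Lemma strand_x_cross pi i j u : i != j -> strand_x pi i u = strand_x pi j u ->
  (((i < j)%N /\ (pi j < pi i)%N) \/ ((j < i)%N /\ (pi i < pi j)%N)) /\ 0 < rho u < 1.
Proof.
rewrite /strand_x => ij e.
have e' : (1 - rho u) * (i%:R - j%:R) + rho u * ((pi i)%:R - (pi j)%:R) = 0 by lra.
have /andP[r0 r1] := rho01 u.
have ne : (i%:R - j%:R : R) != 0 by rewrite subr_eq0 eqr_nat (inj_eq val_inj).
have pne : ((pi i)%:R - (pi j)%:R : R) != 0 by rewrite subr_eq0 perm_neq.
have {}r0 : 0 < rho u.
  rewrite lt_neqAle r0 andbT; apply/eqP => r0'; move: e'; rewrite -r0' subr0 mul1r mul0r addr0.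
  exact/eqP.
have {}r1 : rho u < 1.
  rewrite lt_neqAle r1 andbT; apply/eqP => r1'; move: e'; rewrite r1' subrr mul1r mul0r add0r.
  exact/eqP.
split; last by rewrite r0.
have r1' : 0 < 1 - rho u by rewrite subr_gt0.
have [lij|lji|eij] := ltngtP i j; last by rewrite (val_inj eij) eqxx in ij.
- left; split=> //; rewrite ltnNge; apply/negP => pij.
  have : (1 - rho u) * (i%:R - j%:R) < 0 by rewrite nmulr_llt0// subr_lt0 ltr_nat.
  have : rho u * ((pi i)%:R - (pi j)%:R) <= 0 by rewrite pmulr_rle0// subr_le0 ler_nat.
  lra.
- right; split=> //; rewrite ltnNge; apply/negP => pij.
  have : 0 < (1 - rho u) * (i%:R - j%:R) by rewrite mulr_gt0// subr_gt0 ltr_nat.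
  have : 0 <= rho u * ((pi i)%:R - (pi j)%:R) by rewrite pmulr_rge0// subr_ge0 ler_nat.
  lra.
Qed.

(** The crossing signs agree on all pairs that cross. Both alternatives are strict, so heights of an
    inverted pair also differ. *)
Definition same_order_on_inversions pi h h' := forall i j, (i < j)%N -> (pi j < pi i)%N ->
  (h i < h j /\ h' i < h' j) \/ (h j < h i /\ h' j < h' i).

Lemma convex_comb_neq0 r a b : 0 <= r <= 1 -> (a < 0 /\ b < 0) \/ (0 < a /\ 0 < b) ->
  (1 - r) * a + r * b = 0 -> False.
Proof.
move=> /andP[r0 r1] H e.
wlog [a0 b0] : a b {H} e / 0 < a /\ 0 < b.
  move=> W; case: H => [[? ?]|]; last exact: W.
  by apply: (W (- a) (- b)); lra.
have [r12|r12] := leP r (2^-1).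
  have : 0 < (1 - r) * a by rewrite mulr_gt0//; lra.
  have : 0 <= r * b by rewrite mulr_ge0// ltW.
  lra.
have : 0 <= (1 - r) * a by rewrite mulr_ge0// ?subr_ge0// ltW.
have : 0 < r * b by rewrite mulr_gt0//; lra.
lra.
Qed.

Lemma change_heights w1 pi h h' w2 : same_order_on_inversions pi h h' ->
  isotopic (w1 ++ (pi, h) :: w2) (w1 ++ (pi, h') :: w2).
Proof.
move=> H; rewrite !word_closureE; apply: slab_isotopic => //=.
- by move=> i; exact: lipschitz1_strand_x.
- by move=> i; exact: lipschitz1_strand_z.
- by move=> i; exact: lipschitz1_strand_x.
- by move=> i; exact: lipschitz1_strand_z.
- by move=> i; rewrite !strand_z0.
- by move=> i; rewrite !strand_z1.
- by move=> i u _; rewrite strand_x_ge0.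
(* A collision needs equal projections, hence an inverted pair at full height, where both height
   differences have the same nonzero sign. *)
- move=> i j r u ij r01 u01 e1 e2.
  have e : strand_x pi i u = strand_x pi j u by move: e1; lra.
  have [inv /lam_rho lu] := strand_x_cross ij e.
  rewrite /strand_z lu !mul1r in e2.
  apply: (convex_comb_neq0 r01) e2.
  by case: inv => -[lij pij]; case: (H _ _ lij pij) => -[? ?]; [left|right|right|left]; lra.
- by move=> p; apply: rest_region => //; rewrite ltnS leq_addr.
Qed.

(** Compresses the time slots [k] and [k + 1] into one and moves everything later down by 1;
    [unsqueeze] is its inverse. *)
Definition squeeze k t : R := t - clamp01 ((t - k%:R) / 2).
Definition unsqueeze k t : R := t + clamp01 (t - k%:R).

Lemma unsqueezeK k t : squeeze k (unsqueeze k t) = t.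
Proof.
rewrite /squeeze /unsqueeze; case: (clamp01P (t - k%:R)) => -[? ->].
- by rewrite clamp01_eq0; lra.
- by rewrite (_ : _ / 2 = t - k%:R) ?clamp01_id//; [lra|field].
- by rewrite clamp01_eq1; lra.
Qed.

Lemma squeeze_mono k x y : x <= y -> 2^-1 * (y - x) <= squeeze k y - squeeze k x <= 2 * (y - x).
Proof.
move=> xy; have := @clamp01_homo R ((x - k%:R) / 2) ((y - k%:R) / 2).
by rewrite /squeeze ler_pM2r ?lerD2r// => /(_ xy) /andP[? ?]; apply/andP; split; lra.
Qed.

(** The two motions in succession, each at double speed. The clamps freeze one while the other runs,
    and a frozen term equals [pi1 i], which is subtracted once. *)
Definition comp_x pi1 pi2 i u : R :=
  strand_x pi1 i (clamp01 (2 * u)) + strand_x pi2 (pi1 i) (clamp01 (2 * u - 1)) - (pi1 i)%:R.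
Definition comp_lam u : R := lam (clamp01 (2 * u)) + lam (clamp01 (2 * u - 1)).

Lemma comp_lam_ge0 u : 0 <= comp_lam u.
Proof. by rewrite addr_ge0 ?lam_ge0. Qed.

Lemma comp_lam_eq0 u : 0 < u < 1 -> comp_lam u = 0 -> u = 2^-1.
Proof.
move=> u01 /eqP; rewrite paddr_eq0 ?lam_ge0// => /andP[/eqP h1 /eqP h2].
apply/eqP; rewrite eq_le; apply/andP; split; rewrite leNgt; apply/negP => lu.
  have := @lam_gt0 R (clamp01 (2 * u - 1)); rewrite h2 clamp01_id; lra.
have := @lam_gt0 R (clamp01 (2 * u)); rewrite h1 clamp01_id; lra.
Qed.

Lemma arcs_squeeze T k p : (k.+2 <= T.+1)%N ->
  @arcs R s T.+1 p -> @arcs R s T (pt (xc p) (squeeze k (tc p)) (zc p)).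
Proof.
rewrite ltnS => kT [j js /closure_arcP[z0 H]]; exists j => //; apply/closure_arcP.
rewrite xc_pt tc_pt zc_pt; split=> //.
have kT' : k%:R + 1 <= T%:R :> R by rewrite natr1 ler_nat.
have k0 := ler0n R k; have j0 := ler0n R j; move: H; rewrite -!natr1 => H.
rewrite /squeeze.
case: H => [[? /andP[? ?]]|[? /andP[? ?]]|[? /andP[? ?]]|[[? /andP[? ?]]|[? /andP[? ?]]]].
- by constructor 1; rewrite clamp01_eq1; [split=> //; lra|lra].
- by constructor 2; rewrite clamp01_eq1; [split; lra|lra].
- by constructor 3; split=> //; case: (clamp01P ((tc p - k%:R) / 2)) => -[? ->]; apply/andP; split; lra.
- by constructor 4; left; rewrite clamp01_eq0; [split; lra|lra].
- by constructor 4; right; rewrite clamp01_eq0; [split; lra|lra].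
Qed.

Lemma arcs_unsqueeze T k p : (k.+2 <= T.+1)%N ->
  @arcs R s T p -> @arcs R s T.+1 (pt (xc p) (unsqueeze k (tc p)) (zc p)).
Proof.
rewrite ltnS => kT [j js /closure_arcP[z0 H]]; exists j => //; apply/closure_arcP.
rewrite xc_pt tc_pt zc_pt; split=> //.
have kT' : k%:R + 1 <= T%:R :> R by rewrite natr1 ler_nat.
have k0 := ler0n R k; have j0 := ler0n R j; move: H; rewrite -!natr1 => H.
rewrite /unsqueeze.
case: H => [[? /andP[? ?]]|[? /andP[? ?]]|[? /andP[? ?]]|[[? /andP[? ?]]|[? /andP[? ?]]]].
- by constructor 1; rewrite clamp01_eq1; [split=> //; lra|lra].
- by constructor 2; rewrite clamp01_eq1; [split; lra|lra].
- by constructor 3; split=> //; case: (clamp01P (tc p - k%:R)) => -[? ->]; apply/andP; split; lra.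
- by constructor 4; left; rewrite clamp01_eq0; [split; lra|lra].
- by constructor 4; right; rewrite clamp01_eq0; [split; lra|lra].
Qed.

(** A letter indexes heights by the position of entry. The string at [i] after [pi] entered at the
    preimage of [i], so these are the heights of the same strings, indexed anew. *)
Definition inv_heights pi h : 'I_s -> R := fun i => h ((pi^-1)%g i).

Lemma squeeze_image w1 pi1 pi2 h w2 :
  (fun p => pt (xc p) (squeeze (size w1) (tc p)) (zc p)) @`
    word_closure (w1 ++ (pi1, h) :: (pi2, inv_heights pi1 h) :: w2) =
  (slots 0 w1 `|` slots (size w1).+1 w2 `|` @arcs R s (size w1 + size w2).+1)
    `|` slab (size w1)%:R (comp_x pi1 pi2) (fun i u => comp_lam u * h i).
Proof.
set k := size w1; set T := (k + size w2).+1.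
have kT : (k.+2 <= T.+1)%N by rewrite !ltnS leq_addr.
have -> : word_closure (w1 ++ (pi1, h) :: (pi2, inv_heights pi1 h) :: w2) =
   slots 0 w1 `|` (slot k (pi1, h) `|` (slot k.+1 (pi2, inv_heights pi1 h) `|` slots k.+2 w2))
   `|` @arcs R s T.+1.
  by rewrite /word_closure slots_cat size_cat /= add0n /T !addnS.
have ko (u : R) : 0 <= u <= 1 -> squeeze k (k%:R + u) = k%:R + u / 2.
  by move=> u01; rewrite /squeeze clamp01_id; lra.
have k1 (u : R) : 0 <= u <= 1 -> squeeze k (k.+1%:R + u) = k%:R + (1 + u) / 2.
  by move=> u01; rewrite /squeeze -natr1 clamp01_id; lra.
apply/seteqP; split.
- move=> _ [p + <-].
  case=> [[sp|[[i [u [u01 ->]]]|[[i [u [u01 ->]]]|sp]]]|ap].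
  + left; left; left; have /andP[_ h2] := slots_time sp.
    by rewrite /squeeze clamp01_eq0 ?subr0 -?pt_eta//; rewrite add0n in h2; lra.
  + right; exists i, (u / 2); split; first by lra.
    rewrite xc_pt tc_pt zc_pt ko// /comp_x /comp_lam.
    have -> : clamp01 (2 * (u / 2)) = u by rewrite clamp01_id; lra.
    have -> : clamp01 (2 * (u / 2) - 1) = 0 by rewrite clamp01_eq0; lra.
    by rewrite strand_x0 lam0 addr0 addrK.
  + right; exists ((pi1^-1)%g i), ((1 + u) / 2); split; first by lra.
    rewrite xc_pt tc_pt zc_pt k1// /comp_x /comp_lam.
    have -> : clamp01 (2 * ((1 + u) / 2)) = 1 by rewrite clamp01_eq1; lra.
    have -> : clamp01 (2 * ((1 + u) / 2) - 1) = u by rewrite clamp01_id; lra.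
    by rewrite strand_x1 lam1 add0r permKV /= addrAC subrr add0r.
  + left; left; right; have /andP[h1 _] := slots_time sp.
    rewrite -!natr1 in h1.
    rewrite /squeeze clamp01_eq1; last by lra.
    by apply/slots_shift; rewrite subrK -pt_eta.
  + by left; right; exact: arcs_squeeze.
- move=> q Kq; exists (pt (xc q) (unsqueeze k (tc q)) (zc q)); last first.
    by rewrite xc_pt tc_pt zc_pt unsqueezeK -pt_eta.
  case: Kq => [[[sp|sp]|ap]|[i [u [u01 ->]]]].
  + left; left; have /andP[_ h2] := slots_time sp.
    by rewrite /unsqueeze clamp01_eq0 ?addr0 -?pt_eta//; rewrite add0n in h2; lra.
  + left; right; right; right; have /andP[h1 _] := slots_time sp.
    rewrite -!natr1 in h1.
    rewrite /unsqueeze clamp01_eq1; last by lra.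
    by apply/slots_shift; rewrite -pt_eta.
  + by right; exact: arcs_unsqueeze.
  + left; right; rewrite xc_pt tc_pt zc_pt /unsqueeze.
    rewrite (_ : k%:R + u - k%:R = u) ?clamp01_id//; last by ring.
    have [u2|u2] := leP u (2^-1).
      left; exists i, (2 * u); split; first by lra.
      rewrite /comp_x /comp_lam [clamp01 (2 * u)]clamp01_id; last by lra.
      rewrite clamp01_eq0; last by lra.
      rewrite strand_x0 lam0 addr0 addrK; congr (pt _ _ _); ring.
    right; left; exists (pi1 i), (2 * u - 1); split; first by lra.
    rewrite /comp_x /comp_lam [clamp01 (2 * u)]clamp01_eq1; last by lra.
    rewrite clamp01_id; last by lra.
    rewrite strand_x1 lam1 add0r /= /strand_z /inv_heights permK -natr1.
    by congr (pt _ _ _); ring.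
Qed.

(** After squeezing, both motions live in one slab. Height differences during the homotopy are
    [h i - h j] times a common nonnegative factor, so injectivity of [h] leaves collisions possible
    only where that factor vanishes. *)
Lemma merge_letters w1 pi1 pi2 h w2 : injective h ->
  isotopic (w1 ++ (pi1, h) :: (pi2, inv_heights pi1 h) :: w2)
           (w1 ++ ((pi1 * pi2)%g, h) :: w2).
Proof.
move=> hinj; apply: ambient_isotopic_trans.
  apply: (@coord_isotopic _ _ id (squeeze (size w1)) (2^-1) 2); [lra|lra| |exact: squeeze_mono].
  by move=> x y xy; apply/andP; split; lra.
rewrite squeeze_image word_closureE; apply: slab_isotopic => /=.
- move=> i; apply: lipschitz1B; last exact: lipschitz1_cst.
  apply: lipschitz1D; apply: lipschitz1_comp; try exact: lipschitz1_strand_x;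
    apply: lipschitz1_comp; try exact: lipschitz1_clamp01.
    by apply: lipschitz1Z; exact: lipschitz1_id.
  by apply: lipschitz1B; [apply: lipschitz1Z; exact: lipschitz1_id|exact: lipschitz1_cst].
- move=> i; rewrite (_ : (fun u => _) = (fun u => h i * comp_lam u)); last by apply/funext => u; rewrite mulrC.
  apply: lipschitz1Z; apply: lipschitz1D; apply: lipschitz1_comp; try exact: lipschitz1_lam;
    apply: lipschitz1_comp; try exact: lipschitz1_clamp01.
    by apply: lipschitz1Z; exact: lipschitz1_id.
  by apply: lipschitz1B; [apply: lipschitz1Z; exact: lipschitz1_id|exact: lipschitz1_cst].
- by move=> i; exact: lipschitz1_strand_x.
- by move=> i; exact: lipschitz1_strand_z.
- by move=> i; rewrite /comp_x mulr0 !clamp01_eq0 ?strand_x0 ?addrK//; lra.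
- by move=> i; rewrite strand_z0 /comp_lam mulr0 !clamp01_eq0 ?lam0 ?addr0 ?mul0r//; lra.
- by move=> i; rewrite /comp_x mulr1 !clamp01_eq1 ?strand_x1 ?permM//; lra.
- by move=> i; rewrite strand_z1 /comp_lam mulr1 !clamp01_eq1 ?lam1 ?addr0 ?mul0r//; lra.
- move=> i u u01; rewrite strand_x_ge0; split=> //; rewrite /comp_x.
  have [u2|u2] := leP u (2^-1).
    by rewrite [clamp01 (2 * u - 1)]clamp01_eq0 ?strand_x0 ?addrK ?strand_x_ge0//; lra.
  by rewrite [clamp01 (2 * u)]clamp01_eq1 ?strand_x1 ?(addrC (pi1 i)%:R) ?addrK ?strand_x_ge0//; lra.
- move=> i j r u ij r01 u01 e1 e2.
  have hne : h i - h j != 0 by rewrite subr_eq0 (inj_eq hinj).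
  have ine : (i%:R - j%:R : R) != 0 by rewrite subr_eq0 eqr_nat (inj_eq val_inj).
  have /eqP : ((1 - r) * comp_lam u + r * lam u) * (h i - h j) = 0.
    by rewrite -e2 /strand_z; ring.
  have /andP[r0 r1] := r01.
  rewrite mulf_eq0 (negbTE hne) orbF paddr_eq0; last 2 first.
  + by rewrite mulr_ge0 ?comp_lam_ge0// subr_ge0.
  + by rewrite mulr_ge0// lam_ge0.
  have [u0|u0] := eqVneq u 0.
    move=> _; move: e1; rewrite u0 /comp_x mulr0 !clamp01_eq0 ?strand_x0 ?addrK; lra.
  have [u1|u1] := eqVneq u 1.
    move=> _; move: e1; rewrite u1 /comp_x mulr1 !clamp01_eq1 ?strand_x1 ?permM; try lra.
    by move=> e1'; have /eqP := @perm_neq (pi1 * pi2)%g i j ij; apply; rewrite !permM; lra.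
  have {u0 u1} u01' : 0 < u < 1.
    by have /andP[? ?] := u01; rewrite !lt_neqAle u1 eq_sym u0; apply/andP.
  rewrite !mulf_eq0 (gt_eqF (lam_gt0 u01')) orbF => /andP[/orP[/eqP ?|/eqP cl] /eqP r00]; first lra.
  (* The remaining moment: at [r = 0] the two-letter motion touches height 0 for [u = 1/2], and
     there the strings stand at the distinct positions [pi1 i] and [pi1 j]. *)
  have u2 := comp_lam_eq0 u01' cl.
  move: e1; rewrite r00 subr0 mul1r mul0r addr0 /comp_x u2.
  have -> : clamp01 (2 * 2^-1) = 1 :> R by rewrite clamp01_eq1//; lra.
  have -> : clamp01 (2 * 2^-1 - 1) = 0 :> R by rewrite clamp01_eq0//; lra.
  rewrite !strand_x0 !strand_x1 !addrK => e1.
  by have /eqP := @perm_neq pi1 i j ij; apply; lra.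
- by move=> p; apply: rest_region => //; rewrite ltnS leq_addr.
Qed.
End Moves.

(** * Polylines *)

Section Polylines.
Variable R : realType.
Implicit Types (x y t z c r u v a b : R) (p q : R3pt R).

Lemma clamp01_opp x : clamp01 (1 - x) = 1 - clamp01 x :> R.
Proof.
by case: (clamp01P x) => -[? ->]; [rewrite clamp01_eq1|rewrite clamp01_id|rewrite clamp01_eq0]; lra.
Qed.

(* The piecewise linear function with value [nth i (a :: l)] at the integer [i]. *)
Fixpoint pl a (l : seq R) v : R :=
  if l is b :: l' then (a - b) * (1 - clamp01 v) + pl b l' (v - 1) else a.

Lemma pl_le0 a l v : v <= 0 -> pl a l v = a.
Proof.
elim: l a v => //= b l IH a v v0; rewrite IH; last by lra.
by rewrite clamp01_eq0// subr0 mulr1 subrK.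
Qed.

Lemma pl_ge1 a b l v : 1 <= v -> pl a (b :: l) v = pl b l (v - 1).
Proof. by move=> v1 /=; rewrite clamp01_eq1// subrr mulr0 add0r. Qed.

Lemma pl_01 a b l v : 0 <= v <= 1 -> pl a (b :: l) v = (1 - v) * a + v * b.
Proof. by move=> /andP[v0 v1] /=; rewrite clamp01_id ?v0// pl_le0; [ring|lra]. Qed.

Lemma pl_cat a l1 l2 v : v <= (size l1)%:R -> pl a (l1 ++ l2) v = pl a l1 v.
Proof.
elim: l1 a v => [|b l1 IH] a v /= vs; first by rewrite pl_le0.
by rewrite IH// lerBlDr natr1.
Qed.

Lemma lipschitz1_pl a l : lipschitz1 (pl a l).
Proof.
elim: l a => [|b l IH] a /=; first exact: lipschitz1_cst.
apply: lipschitz1D.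
  apply: lipschitz1Z; apply: lipschitz1B; first exact: lipschitz1_cst.
  exact: lipschitz1_clamp01.
by apply: lipschitz1_comp => //; apply: lipschitz1B; [exact: lipschitz1_id|exact: lipschitz1_cst].
Qed.

Lemma pl_decr c a l u v : path (fun x y => y + c <= x) a l ->
  0 <= u -> u <= v -> v <= (size l)%:R -> c * (v - u) <= pl a l u - pl a l v.
Proof.
elim: l a u v => [|b l IH] a u v /=.
  by move=> _ ? ? ?; rewrite (_ : v - u = 0) ?mulr0 ?subrr//; lra.
rewrite -natr1 => /andP[ab pbl] u0 uv vs.
have [v1|v1] := leP v 1.
  rewrite !pl_le0 ?clamp01_id; try lra.
  have : 0 <= (a - b - c) * (v - u) by rewrite mulr_ge0; lra.
  by rewrite (_ : _ * _ = (a - b) * (v - u) - c * (v - u)) => [|]; [lra|ring].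
have [u1|u1] := leP u 1.
  have := IH b 0 (v - 1) pbl.
  rewrite (@pl_le0 b l 0)// (@pl_le0 b l (u - 1)); last by lra.
  rewrite clamp01_id; last by lra.
  rewrite (@clamp01_eq1 _ v); last by lra.
  have : 0 <= (a - b - c) * (1 - u) by rewrite mulr_ge0; lra.
  rewrite (_ : _ * _ = (a - b) * (1 - u) - c * (1 - u)); last by ring.
  move=> ? /(_ ltac:(lra) ltac:(lra) ltac:(lra)); lra.
have := IH b (u - 1) (v - 1) pbl.
by rewrite !clamp01_eq1; lra.
Qed.

Fixpoint polyline p (l : seq (R3pt R)) : set (R3pt R) :=
  if l is q :: l' then seg p q `|` polyline q l' else [set p].

Definition pl_pt p l v := pt (pl (xc p) (map (@xc R) l) v)
  (pl (tc p) (map (@tc R) l) v) (pl (zc p) (map (@zc R) l) v).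

Lemma pl_pt_01 p q l v : 0 <= v <= 1 -> pl_pt p (q :: l) v = (1 - v) *: p + v *: q.
Proof.
move=> v01; rewrite [p in RHS]pt_eta [q in RHS]pt_eta !(ptZ, ptD).
by congr (pt _ _ _); exact: pl_01.
Qed.

Lemma pl_pt_ge1 p q l v : 1 <= v -> pl_pt p (q :: l) v = pl_pt q l (v - 1).
Proof. by move=> v1; congr (pt _ _ _); exact: pl_ge1. Qed.

Lemma polylineE p l : polyline p l = pl_pt p l @` [set v | 0 <= v <= (size l)%:R].
Proof.
elim: l p => [|q l IH] p.
  apply/seteqP; split => [_ ->|_ [v _ <-]] /=; last by rewrite /pl_pt /= -pt_eta.
  by exists 0; rewrite /= ?lexx// /pl_pt /= -pt_eta.
have l0 := ler0n R (size l).
rewrite [LHS]/= IH; apply/seteqP; split.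
- move=> _ [[r r01 <-]|[v /= /andP[v0 v1] <-]].
    exists r; last by rewrite pl_pt_01.
    by case/andP: r01 => r0 r1; rewrite /= -natr1; apply/andP; split; lra.
  exists (v + 1) => /=; first by rewrite -natr1; apply/andP; split; lra.
  by rewrite pl_pt_ge1 ?addrK//; lra.
- move=> _ [v /= /andP[v0 v1] <-].
  have [v2|v2] := leP v 1.
    by left; exists v; rewrite ?pl_pt_01 /= ?v0.
  right; exists (v - 1) => /=; first by rewrite -natr1 in v1; apply/andP; split; lra.
  by rewrite pl_pt_ge1// ltW.
Qed.

Lemma seg_endr p q : seg p q q.
Proof. by exists 1; rewrite /= ?lexx ?ler01// subrr scale1r scale0r add0r. Qed.

(** Height of a string that rises to [a], slopes to [b] while it travels and then descends;
    constant-height strings are the case [a = b]. *)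
Definition plateau a b u : R := a * clamp01 (4 * u) + (b - a) * clamp01 (2 * u - 2^-1) - b * clamp01 (4 * u - 3).

Lemma lipschitz1_plateau a b : lipschitz1 (plateau a b).
Proof.
have lin (c d : R) : lipschitz1 (fun u => c * u - d).
  by apply: lipschitz1B; [apply: lipschitz1Z; exact: lipschitz1_id|exact: lipschitz1_cst].
apply: lipschitz1B; [apply: lipschitz1D|]; apply: lipschitz1Z; apply: lipschitz1_comp;
  try exact: lipschitz1_clamp01; try exact: lin.
by apply: lipschitz1Z; exact: lipschitz1_id.
Qed.

Lemma plateau_lam a u : plateau a a u = lam u * a.
Proof.
rewrite /plateau /lam subrr mul0r addr0.
rewrite (_ : 4 - 4 * u = 1 - (4 * u - 3)) ?clamp01_opp; by ring.
Qed.

Lemma plateau_segs x x1 t a b :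
  [set p | exists2 u, 0 <= u <= 1 & p = pt (x + rho u * (x1 - x)) (t + u) (plateau a b u)] =
  seg (pt x t 0) (pt x (t + 4^-1) a) `|`
  seg (pt x (t + 4^-1) a) (pt x1 (t + 3 / 4) b) `|`
  seg (pt x1 (t + 3 / 4) b) (pt x1 (t + 1) 0).
Proof.
rewrite /plateau /rho; apply/seteqP; split.
- move=> _ [u /andP[u0 u1] ->].
  have [u4|u4] := leP u (4^-1).
    left; left; exists (4 * u) => /=; first by apply/andP; split; lra.
    rewrite !(ptZ, ptD) [clamp01 (4 * u)]clamp01_id; last by lra.
    rewrite clamp01_eq0; last by lra.
    rewrite clamp01_eq0; last by lra.
    by congr (pt _ _ _); field.
  have [u5|u5] := leP u (3 / 4).
    left; right; exists (2 * u - 2^-1) => /=; first by apply/andP; split; lra.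
    rewrite !(ptZ, ptD) [clamp01 (2 * u - _)]clamp01_id; last by lra.
    rewrite [clamp01 (4 * u)]clamp01_eq1; last by lra.
    rewrite clamp01_eq0; last by lra.
    by congr (pt _ _ _); field.
  right; exists (4 * u - 3) => /=; first by apply/andP; split; lra.
  rewrite !(ptZ, ptD) [clamp01 (4 * u)]clamp01_eq1; last by lra.
  rewrite [clamp01 (2 * u - _)]clamp01_eq1; last by lra.
  rewrite clamp01_id; last by lra.
  by congr (pt _ _ _); field.
- move=> _ [[[r /= /andP[r0 r1] <-]|[r /= /andP[r0 r1] <-]]|[r /= /andP[r0 r1] <-]]; rewrite !(ptZ, ptD).
  + exists (r / 4); first by apply/andP; split; lra.
    rewrite (_ : 4 * (r / 4) = r); last by field.
    rewrite (@clamp01_id _ r); last by lra.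
    rewrite clamp01_eq0; last by lra.
    rewrite clamp01_eq0; last by lra.
    by congr (pt _ _ _); field.
  + exists (4^-1 + r / 2); first by apply/andP; split; lra.
    rewrite (_ : 2 * (4^-1 + r / 2) - 2^-1 = r); last by field.
    rewrite (@clamp01_id _ r); last by lra.
    rewrite (@clamp01_eq1 _ (4 * _)); last by lra.
    rewrite clamp01_eq0; last by lra.
    by congr (pt _ _ _); field.
  + exists (3 / 4 + r / 4); first by apply/andP; split; lra.
    rewrite (_ : 4 * (3 / 4 + r / 4) - 3 = r); last by field.
    rewrite (@clamp01_id _ r); last by lra.
    rewrite (@clamp01_eq1 _ (4 * _)); last by lra.
    rewrite clamp01_eq1; last by lra.
    by congr (pt _ _ _); field.
Qed.

Lemma straight_seg x t : [set p | exists2 u, 0 <= u <= 1 & p = pt x (t + u) 0] =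
  seg (pt x t 0) (pt x (t + 1) 0).
Proof.
apply/seteqP; split=> [_ [r r01 ->]|_ [r r01 <-]]; exists r => //;
  by rewrite !(ptZ, ptD); congr (pt _ _ _); ring.
Qed.

Lemma shear_seg (f : R -> R -> R) p q :
  (forall r, 0 <= r <= 1 -> f ((1 - r) * xc p + r * xc q) ((1 - r) * tc p + r * tc q) =
      (1 - r) * f (xc p) (tc p) + r * f (xc q) (tc q)) ->
  (fun p => pt (xc p) (tc p) (zc p + f (xc p) (tc p))) @` seg p q =
  seg (pt (xc p) (tc p) (zc p + f (xc p) (tc p))) (pt (xc q) (tc q) (zc q + f (xc q) (tc q))).
Proof.
move=> fl; have e r : 0 <= r <= 1 ->
    pt (xc ((1 - r) *: p + r *: q)) (tc ((1 - r) *: p + r *: q)) (zc ((1 - r) *: p + r *: q)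
      + f (xc ((1 - r) *: p + r *: q)) (tc ((1 - r) *: p + r *: q))) =
    (1 - r) *: pt (xc p) (tc p) (zc p + f (xc p) (tc p)) +
      r *: pt (xc q) (tc q) (zc q + f (xc q) (tc q)).
  move=> r01; rewrite !(ptZ, ptD).
  have -> : xc ((1 - r) *: p + r *: q) = (1 - r) * xc p + r * xc q by rewrite /xc !mxE.
  have -> : tc ((1 - r) *: p + r *: q) = (1 - r) * tc p + r * tc q by rewrite /tc !mxE.
  have -> : zc ((1 - r) *: p + r *: q) = (1 - r) * zc p + r * zc q by rewrite /zc !mxE.
  by rewrite fl//; congr (pt _ _ _); ring.
apply/seteqP; split => [_ [_ [r r01 <-] <-]|_ [r r01 <-]].
  by exists r => //; rewrite e.
by exists ((1 - r) *: p + r *: q); [exists r|rewrite e].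
Qed.
End Polylines.

(** * Removing a kink *)

Arguments pl : simpl never.

Section Kink.
Variables (R : realType) (T : R).
Hypothesis T1 : 1 <= T.
Implicit Types (x y t z c r u v m : R) (p q : R3pt R).

(* The loop of the additional string, lifted so that its height strictly decreases between the second
   knot and the last but one: it can then be contracted level by level. *)
Definition kink_start := pt (1 : R) T 0.
Definition kink_knots : seq (R3pt R) :=
  [:: pt 1 (T + 4^-1) 2; pt 0 (T + 3 / 4) 1; pt 0 (T + 1) 2^-1; pt 0 (T + 2) 4^-1;
      pt (-1) (T + 2) 8^-1; pt (-1) (-1) (- 8^-1); pt 0 (-1) (- 4^-1); pt 0 0 (- (3 / 8));
      pt 0 T (- 2^-1); pt 0 (T + 4^-1) (-1); pt 1 (T + 3 / 4) (-2); pt 1 (T + 1) 0].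

Let path_x v : R := pl 1 [:: 1; 0; 0; 0; -1; -1; 0; 0; 0; 0; 1; 1] v.
Let path_t v : R := pl T [:: T + 4^-1; T + 3 / 4; T + 1; T + 2; T + 2; -1; -1; 0; T; T + 4^-1; T + 3 / 4; T + 1] v.
Let path_z v : R := pl 0 [:: 2; 1; 2^-1; 4^-1; 8^-1; - 8^-1; - 4^-1; - (3 / 8); - 2^-1; -1; -2; 0] v.
(** The halfway position of the loop: an arc beside the line [x = 1] along which time increases.
    Each of the two stages then keeps one coordinate that tells points of the loop apart: the height
    [path_z] on the way to this arc, and the time [target_t] when it is straightened. *)
Let target_x v : R := 1 - 2^-1 * clamp01 (v - 1) + 2^-1 * clamp01 (v - 10).
Let target_t v : R := T + 4^-1 * clamp01 v + 2^-1 * clamp01 (10^-1 * v - 10^-1) + 4^-1 * clamp01 (v - 11).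

Let segment_cases v (P : Prop) : 0 <= v <= 12 ->
  (0 <= v <= 1 -> P) -> (1 <= v <= 2 -> P) -> (2 <= v <= 10 -> P) ->
  (10 <= v <= 11 -> P) -> (11 <= v <= 12 -> P) -> P.
Proof.
move=> /andP[v0 v12] h1 h2 h3 h4 h5.
have [v1|v1] := leP v 1; first by apply: h1; rewrite v0.
have [v2|v2] := leP v 2; first by apply: h2; rewrite v2 ltW.
have [v3|v3] := leP v 10; first by apply: h3; rewrite v3 ltW.
have [v4|v4] := leP v 11; first by apply: h4; rewrite v4 ltW.
by apply: h5; rewrite v12 ltW.
Qed.

Lemma pl_bounds lo hi a (l : seq R) v : all (fun x => lo <= x <= hi) (a :: l) -> lo <= pl a l v <= hi.
Proof.
elim: l a v => [|b l IH] a v /=; first by rewrite andbT.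
rewrite -[pl a (b :: l) v]/((a - b) * (1 - clamp01 v) + pl b l (v - 1)); move=> /and3P[/andP[la ah] bb bl].
have [v1|v1] := leP 1 v.
  by rewrite clamp01_eq1// subrr mulr0 add0r; apply: IH; rewrite /= bb.
rewrite pl_le0; last by lra.
have c0 := clamp01_ge0 v; have c1 := clamp01_le1 v; case/andP: bb => lb hb.
have : 0 <= clamp01 v * (b - lo) by rewrite mulr_ge0// subr_ge0.
have : 0 <= clamp01 v * (hi - b) by rewrite mulr_ge0// subr_ge0.
have : 0 <= (1 - clamp01 v) * (a - lo) by rewrite mulr_ge0// subr_ge0.
have : 0 <= (1 - clamp01 v) * (hi - a) by rewrite mulr_ge0// subr_ge0.
by move=> ? ? ? ?; apply/andP; split; lra.
Qed.

Lemma pl_drop (n : nat) a l v : n%:R <= v -> (n <= size l)%N ->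
  pl a l v = pl (nth 0 (a :: l) n) (drop n l) (v - n%:R).
Proof.
elim: n a l v => [|n IH] a [|b l] v //=; rewrite ?subr0// -natr1 => nv ln.
rewrite -[pl a (b :: l) v]/((a - b) * (1 - clamp01 v) + pl b l (v - 1)).
have n0 := ler0n R n.
rewrite clamp01_eq1 ?subrr ?mulr0 ?add0r; last by lra.
rewrite IH//; last by lra.
by rewrite opprD addrA addrAC.
Qed.

Let path_rise v : 0 <= v <= 1 -> [/\ path_x v = 1, path_t v = T + v / 4 & path_z v = 2 * v].
Proof. by move=> v01; rewrite /path_x /path_t /path_z !pl_01//; split; ring. Qed.
Let path_over v : 1 <= v <= 2 -> [/\ path_x v = 2 - v, path_t v = T + 4^-1 + (v - 1) / 2 & path_z v = 3 - v].
Proof.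
move=> /andP[v1 v2]; rewrite /path_x /path_t /path_z !(pl_ge1 _ _ _ v1).
have v01 : 0 <= v - 1 <= 1 by apply/andP; split; lra.
by rewrite !pl_01//; split; field.
Qed.
Let path_under v : 10 <= v <= 11 -> [/\ path_x v = v - 10, path_t v = T + 4^-1 + (v - 10) / 2 & path_z v = - 1 - (v - 10)].
Proof.
move=> /andP[v1 v2]; rewrite /path_x /path_t /path_z (@pl_drop 10 0)// (@pl_drop 10 T)// (@pl_drop 10 1)//=.
have v01 : 0 <= v - 10 <= 1 by apply/andP; split; lra.
by rewrite !(pl_01 _ _ _ v01); split; field.
Qed.
Let path_return v : 11 <= v <= 12 -> [/\ path_x v = 1, path_t v = T + 3 / 4 + (v - 11) / 4 & path_z v = - 2 + 2 * (v - 11)].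
Proof.
move=> /andP[v1 v2]; rewrite /path_x /path_t /path_z (@pl_drop 11 0)// (@pl_drop 11 T)// (@pl_drop 11 1)//=.
have v01 : 0 <= v - 11 <= 1 by apply/andP; split; lra.
by rewrite !(pl_01 _ _ _ v01); split; field.
Qed.
Let path_around v : 2 <= v <= 10 -> -1 <= path_x v <= 0 /\ -1 <= path_t v <= T + 2.
Proof.
move=> /andP[v1 v2]; rewrite /path_x /path_t (@pl_drop 2 T)// (@pl_drop 2 1)//=.
split.
  rewrite (@pl_cat _ _ [:: 0; 0; -1; -1; 0; 0; 0; 0] [:: 1; 1]) /=; last by lra.
  by apply: pl_bounds => /=; rewrite ?lexx ?lerN10 ?oppr_le0 ?ler01.
rewrite (@pl_cat _ _ [:: T + 1; T + 2; T + 2; -1; -1; 0; T; T + 4^-1] [:: T + 3 / 4; T + 1]) /=; last by lra.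
by apply: pl_bounds => /=; do ?[apply/andP; split] => //; have := T1; lra.
Qed.
(** The rate 1/8 is the smallest drop between consecutive heights of [kink_knots], from the entry 2
    to the entry -2. *)
Let path_z_decr u v : 1 <= u -> u <= v -> v <= 11 -> 8^-1 * (v - u) <= path_z u - path_z v.
Proof.
move=> u1 uv v1; have v1' : 1 <= v by exact: le_trans uv.
rewrite /path_z (@pl_drop 1 0 _ u)// (@pl_drop 1 0 _ v)//=.
rewrite !(@pl_cat _ _ [:: 1; 2^-1; 4^-1; 8^-1; - 8^-1; - 4^-1; - (3 / 8); - 2^-1; -1; -2] [:: 0]) /=; try lra.
have := @pl_decr R 8^-1 2 [:: 1; 2^-1; 4^-1; 8^-1; - 8^-1; - 4^-1; - (3 / 8); - 2^-1; -1; -2] (u - 1) (v - 1).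
rewrite (_ : v - 1 - (u - 1) = v - u); last by ring.
apply; rewrite /= ?subr_ge0// ?lerD2r//; last by lra.
by do ?[apply/andP; split] => //; lra.
Qed.

Let target_t_mid v : 1 <= v <= 11 -> target_t v = T + 4^-1 + (v - 1) / 20.
Proof.
move=> /andP[v1 v2]; rewrite /target_t (@clamp01_eq1 _ v)// (@clamp01_eq0 _ (v - 11)); last by lra.
by rewrite clamp01_id; [field|lra].
Qed.
Let target_rise v : 0 <= v <= 1 -> target_x v = 1 /\ target_t v = T + v / 4.
Proof.
move=> /andP[v0 v1]; rewrite /target_x /target_t (@clamp01_id _ v) ?v0//.
by rewrite !(@clamp01_eq0 _ (_ - _)); try lra; split; field.
Qed.
Let target_over v : 1 <= v <= 2 -> target_x v = 1 - (v - 1) / 2.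
Proof.
move=> /andP[v0 v1]; rewrite /target_x (@clamp01_id _ (v - 1)); last by lra.
by rewrite (@clamp01_eq0 _ (v - 10)); [field|lra].
Qed.
Let target_around v : 2 <= v <= 10 -> target_x v = 2^-1.
Proof.
move=> /andP[v0 v1]; rewrite /target_x (@clamp01_eq1 _ (v - 1)); last by lra.
by rewrite (@clamp01_eq0 _ (v - 10)); [field|lra].
Qed.
Let target_under v : 10 <= v <= 11 -> target_x v = 2^-1 + (v - 10) / 2.
Proof.
move=> /andP[v0 v1]; rewrite /target_x (@clamp01_eq1 _ (v - 1)); last by lra.
by rewrite (@clamp01_id _ (v - 10)); [field|lra].
Qed.
Let target_return v : 11 <= v <= 12 -> target_x v = 1 /\ target_t v = T + 3 / 4 + (v - 11) / 4.
Proof.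
move=> /andP[v0 v1]; rewrite /target_x /target_t (@clamp01_id _ (v - 11)); last by lra.
by rewrite !clamp01_eq1; try lra; split; field.
Qed.
Let target_x_range v : 0 <= v <= 12 -> 2^-1 <= target_x v <= 1.
Proof.
move=> v01; apply: (segment_cases v01) => hv.
- by rewrite (target_rise hv).1; apply/andP; split; lra.
- by rewrite (target_over hv); apply/andP; split; lra.
- by rewrite (target_around hv); apply/andP; split; lra.
- by rewrite (target_under hv); apply/andP; split; lra.
- by rewrite (target_return hv).1; apply/andP; split; lra.
Qed.
Let target_t_incr u v : 0 <= u -> u <= v -> v <= 12 -> (v - u) / 20 <= target_t v - target_t u.
Proof.
move=> u0 uv v1; rewrite /target_t.
have id3 (w : R) : 0 <= w <= 12 -> clamp01 w + 10 * clamp01 (10^-1 * w - 10^-1) + clamp01 (w - 11) = w.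
  move=> w12; case: (clamp01P w) => -[? ->]; case: (clamp01P (10^-1 * w - 10^-1)) => -[? ->];
  case: (clamp01P (w - 11)) => -[? ->]; lra.
have iu : 0 <= u <= 12 by apply/andP; split; lra.
have iv : 0 <= v <= 12 by apply/andP; split; lra.
have h1 := clamp01_homo uv.
have h2 : 0 <= clamp01 (10^-1 * v - 10^-1) - clamp01 (10^-1 * u - 10^-1).
  by have /andP[] := @clamp01_homo R (10^-1 * u - 10^-1) (10^-1 * v - 10^-1) ltac:(lra).
have h3 : 0 <= clamp01 (v - 11) - clamp01 (u - 11).
  by have /andP[] := @clamp01_homo R (u - 11) (v - 11) ltac:(lra).
have := id3 u iu; have := id3 v iv; lra.
Qed.

Let mix_x r v := (1 - r) * path_x v + r * target_x v.
Let mix_t r v := (1 - r) * path_t v + r * target_t v.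

Let mix_rise r v : 0 <= v <= 1 -> mix_x r v = 1 /\ mix_t r v = T + v / 4.
Proof. by move=> v01; rewrite /mix_x /mix_t; case: (path_rise v01) (target_rise v01) => -> -> _ [-> ->];
  split; ring. Qed.
Let mix_over r v : 0 <= r <= 1 -> 1 <= v <= 2 -> [/\ 0 <= mix_x r v <= 1, T + 4^-1 <= mix_t r v <= T + 3 / 4 &
   T + 4^-1 + (v - 1) / 20 <= mix_t r v].
Proof.
move=> /andP[r0 r1'] /andP[v0 v1]; have v01 : 1 <= v <= 2 by rewrite v0.
rewrite /mix_x /mix_t; case: (path_over v01) (target_over v01) => -> -> _ ->; rewrite target_t_mid; last by lra.
have w0 : 0 <= v - 1 by lra.
have w1 : 0 <= 1 - (v - 1) by lra.
have rw := mulr_ge0 r0 w0; have rw' := mulr_ge0 r0 w1.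
have q0 : 0 <= 1 - r by lra.
have qw := mulr_ge0 q0 w0; have qw' := mulr_ge0 q0 w1.
by split; try (apply/andP; split); lra.
Qed.
Let mix_around r v : 0 <= r <= 1 -> 2 <= v <= 10 -> -1 <= mix_x r v <= 2^-1 /\ -1 <= mix_t r v <= T + 2.
Proof.
move=> /andP[r0 r1'] v01; have /andP[v0 v1] := v01.
rewrite /mix_x /mix_t; case: (path_around v01) (target_around v01) => /andP[x1 x2] /andP[t1 t2] ->.
have : T + 4^-1 <= target_t v <= T + 3 / 4 by rewrite target_t_mid; lra.
move=> /andP[y1 y2]; have T1' := T1.
have q0 : 0 <= 1 - r by lra.
have : 0 <= (1 - r) * (path_x v + 1) by rewrite mulr_ge0//; lra.
have : 0 <= (1 - r) * (- path_x v) by rewrite mulr_ge0//; lra.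
have : 0 <= (1 - r) * (path_t v + 1) by rewrite mulr_ge0//; lra.
have : 0 <= (1 - r) * (T + 2 - path_t v) by rewrite mulr_ge0//; lra.
have : 0 <= r * (target_t v + 1) by rewrite mulr_ge0//; lra.
have : 0 <= r * (T + 2 - target_t v) by rewrite mulr_ge0//; lra.
by move=> ? ? ? ? ? ?; split; apply/andP; split; lra.
Qed.
Let mix_under r v : 0 <= r <= 1 -> 10 <= v <= 11 -> [/\ 0 <= mix_x r v <= 1, T + 4^-1 <= mix_t r v <= T + 3 / 4 &
   mix_t r v <= T + 3 / 4 - (11 - v) / 20].
Proof.
move=> /andP[r0 r1'] /andP[v0 v1]; have v01 : 10 <= v <= 11 by rewrite v0.
rewrite /mix_x /mix_t; case: (path_under v01) (target_under v01) => -> -> _ ->; rewrite target_t_mid; last by lra.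
have w0 : 0 <= v - 10 by lra.
have w1 : 0 <= 1 - (v - 10) by lra.
have rw := mulr_ge0 r0 w0; have rw' := mulr_ge0 r0 w1.
have q0 : 0 <= 1 - r by lra.
have qw := mulr_ge0 q0 w0; have qw' := mulr_ge0 q0 w1.
by split; try (apply/andP; split); lra.
Qed.
Let mix_return r v : 11 <= v <= 12 -> mix_x r v = 1 /\ mix_t r v = T + 3 / 4 + (v - 11) / 4.
Proof. by move=> v01; rewrite /mix_x /mix_t; case: (path_return v01) (target_return v01) => -> -> _ [-> ->];
  split; ring. Qed.

Let path_z_range v : 0 <= v <= 12 -> [/\ (v <= 2 -> 0 <= path_z v), (1 <= v <= 2 -> 1 <= path_z v),
  (10 <= v <= 11 -> path_z v <= -1) & (10 <= v -> path_z v <= 0)].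
Proof.
move=> v01; apply: (segment_cases v01) => w.
- by have [_ _ ->] := path_rise w; split; lra.
- by have [_ _ ->] := path_over w; split; lra.
- have [v10|v10] := eqVneq v 10.
    by have [_ _ ->] := @path_under v ltac:(lra); split; lra.
  have [v2|v2] := eqVneq v 2.
    by have [_ _ ->] := @path_over v ltac:(lra); split; lra.
  have /andP[h1 h2] := w.
  have : v < 10 by rewrite lt_neqAle v10.
  have : 2 < v by rewrite lt_neqAle eq_sym v2.
  by split; lra.
- by have [_ _ ->] := path_under w; split; lra.
- by have [_ _ ->] := path_return w; split; lra.
Qed.

(** On [1, 11] the height separates. Elsewhere, on one piece or on adjacent pieces, some coordinate
    is monotone with slope at least 1/20, and the remaining pairs of pieces are at distance at least
    1/2, while [v - u <= 12]; the constant 24 covers all cases. *)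
Let path_separated r m u v : 0 <= r <= 1 -> 0 <= u <= 12 -> 0 <= v <= 12 -> u <= v ->
  `|mix_x r u - mix_x r v| <= m -> `|mix_t r u - mix_t r v| <= m -> `|path_z u - path_z v| <= m ->
  v - u <= 24 * m.
Proof.
move=> r01 u01 v01 uv.
have [zu1 zu2 zu3 zu4] := path_z_range u01; have [zv1 zv2 zv3 zv4] := path_z_range v01.
rewrite !ler_norml => /andP[x1 x2] /andP[t1 t2] /andP[z1 z2].
have main : 1 <= u -> v - u <= 24 * m.
  move=> u1; have [v11|v11] := leP v 11; first by have := path_z_decr u1 uv v11; lra.
  have hv : 11 <= v <= 12 by have /andP[_ v12] := v01; rewrite v12 ltW.
  have [xv tv] := mix_return r hv; rewrite xv in x1 x2; rewrite tv in t1 t2.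
  have /andP[_ v12] := v01; apply: (segment_cases u01) => hu.
  - by have [_ tu] := mix_rise r hu; lra.
  - by have := zu2 hu; have := zv4; lra.
  - by have [/andP[? ?] _] := mix_around r01 hu; lra.
  - by have [_ _ ?] := mix_under r01 hu; lra.
  - by have [_ tu] := mix_return r hu; lra.
apply: (segment_cases u01) => hu; try by apply: main; case/andP: hu => hu _; apply: le_trans hu; rewrite ?ler1n.
have [xu tu] := mix_rise r hu; have [_ _ zu] := path_rise hu.
apply: (segment_cases v01) => hv.
- by have [_ _ zv] := path_rise hv; lra.
- by have [_ _ tv] := mix_over r01 hv; lra.
- by have [/andP[? ?] _] := mix_around r01 hv; lra.
- by have := zv3 hv; lra.
- by have [xv tv] := mix_return r hv; lra.
Qed.

Let lipschitz1_displacement_x : lipschitz1 (fun v => target_x v - path_x v).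
Proof.
have lin (d : R) : lipschitz1 (fun u => u - d).
  by apply: lipschitz1B; [exact: lipschitz1_id|exact: lipschitz1_cst].
apply: lipschitz1B; last exact: lipschitz1_pl.
apply: lipschitz1D; last by apply: lipschitz1Z; apply: lipschitz1_comp; [exact: lipschitz1_clamp01|exact: lin].
apply: lipschitz1B; first exact: lipschitz1_cst.
by apply: lipschitz1Z; apply: lipschitz1_comp; [exact: lipschitz1_clamp01|exact: lin].
Qed.
Let lipschitz1_target_t : lipschitz1 target_t.
Proof.
apply: lipschitz1D; [apply: lipschitz1D; [apply: lipschitz1D|]|].
- exact: lipschitz1_cst.
- by apply: lipschitz1Z; exact: lipschitz1_clamp01.
- apply: lipschitz1Z; apply: lipschitz1_comp; first exact: lipschitz1_clamp01.
  by apply: lipschitz1B; [apply: lipschitz1Z; exact: lipschitz1_id|exact: lipschitz1_cst].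
- apply: lipschitz1Z; apply: lipschitz1_comp; first exact: lipschitz1_clamp01.
  by apply: lipschitz1B; [exact: lipschitz1_id|exact: lipschitz1_cst].
Qed.
Let lipschitz1_pull_x : lipschitz1 (fun v => 1 - target_x v).
Proof.
have lin (d : R) : lipschitz1 (fun u => u - d).
  by apply: lipschitz1B; [exact: lipschitz1_id|exact: lipschitz1_cst].
apply: lipschitz1B; first exact: lipschitz1_cst.
apply: lipschitz1D; last by apply: lipschitz1Z; apply: lipschitz1_comp; [exact: lipschitz1_clamp01|exact: lin].
apply: lipschitz1B; first exact: lipschitz1_cst.
by apply: lipschitz1Z; apply: lipschitz1_comp; [exact: lipschitz1_clamp01|exact: lin].
Qed.

(** The complement of what the loop sweeps: the rest of the link may touch the loop only at its
    ends, on the line [x = 1] at times [T] and [T + 1]. *)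
Definition off_kink q := [\/ 1 <= xc q /\ [\/ tc q <= T, T + 1 <= tc q | 2 <= xc q],
  xc q <= -2, T + 3 <= tc q | tc q <= -2].

Variable B : set (R3pt R).
Hypothesis B_off : forall q, B q -> off_kink q.

Let J := (R + R3pt R)%type.
Let S : set J := fun w => match w with inl v => 0 <= v <= 12 | inr q => B q end.
Let cx (f : R -> R) (w : J) := match w with inl v => f v | inr q => xc q end.
Let ct (f : R -> R) (w : J) := match w with inl v => f v | inr q => tc q end.
Let cz (f : R -> R) (w : J) := match w with inl v => f v | inr q => zc q end.

Let split_index (f g h : R -> R) : B `|` [set p | exists2 v, 0 <= v <= 12 & p = pt (f v) (g v) (h v)] =
  (fun w => pt (cx f w) (ct g w) (cz h w)) @` S.
Proof.
apply/seteqP; split => [p [Bp|[v v01 ->]]|_ [[v|q] /= Sw <-]].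
- by exists (inr p) => //=; rewrite -pt_eta.
- by exists (inl v).
- by right; exists v.
- by left; rewrite -pt_eta.
Qed.

Let far_from_B r m v q : 0 <= r <= 1 -> 1 <= v <= 11 -> B q ->
  `|mix_x r v - xc q| <= m -> `|mix_t r v - tc q| <= m -> 4^-1 <= m.
Proof.
move=> r01 v01 /B_off Bq; rewrite !ler_norml => /andP[x1 x2] /andP[t1 t2]; have T1' := T1.
have v12 : 0 <= v <= 12 by have /andP[? ?] := v01; apply/andP; split; lra.
have H : [/\ -1 <= mix_x r v <= 1, -1 <= mix_t r v <= T + 2 & mix_x r v <= 2^-1 \/ T + 4^-1 <= mix_t r v <= T + 3 / 4].
  apply: (segment_cases v12) => hv.
  - by have [xv tv] := mix_rise r hv; split; [..|right]; apply/andP; split; lra.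
  - by have [/andP[? ?] /andP[? ?] _] := mix_over r01 hv; split; [..|right]; apply/andP; split; lra.
  - by have [/andP[? ?] /andP[? ?]] := mix_around r01 hv; split; [..|left]; try (apply/andP; split); lra.
  - by have [/andP[? ?] /andP[? ?] _] := mix_under r01 hv; split; [..|right]; apply/andP; split; lra.
  - by have [xv tv] := mix_return r hv; split; [..|right]; apply/andP; split; lra.
have [/andP[? ?] /andP[? ?] H3] := H.
by case: Bq => [[? [?|?|?]]|?|?|?]; case: H3 => [?|/andP[? ?]]; lra.
Qed.

Let displacement_bound r m v q C : 0 <= C -> (forall u v, `|(target_x u - path_x u) - (target_x v - path_x v)| <= C * `|u - v|) ->
  (forall u v, `|(target_t u - path_t u) - (target_t v - path_t v)| <= C * `|u - v|) ->
  0 <= r <= 1 -> 0 <= v <= 12 -> B q ->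
  `|mix_x r v - xc q| <= m -> `|mix_t r v - tc q| <= m ->
  `|target_x v - path_x v| <= 48 * C * m /\ `|target_t v - path_t v| <= 48 * C * m.
Proof.
move=> C0 hx ht r01 v01 Bq h1 h2.
have m0 : 0 <= m by exact: le_trans h1.
have Cm : 0 <= 48 * C * m by rewrite !mulr_ge0.
have main : 1 <= v <= 11 -> `|target_x v - path_x v| <= 48 * C * m /\ `|target_t v - path_t v| <= 48 * C * m.
  move=> v11; have m4 := far_from_B r01 v11 Bq h1 h2.
  (* The displacement vanishes at [v = 0], so it is at most [12 * C], and the rest of the link is at
     distance at least 1/4; hence the factor 48. *)
  have Cm' : C * 12 <= 48 * C * m.
    by rewrite (_ : 48 * C * m = C * (48 * m)); [apply: ler_wpM2l => //; lra|ring].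
  have v12 : C * `|v - 0| <= C * 12.
    by apply: ler_wpM2l => //; rewrite subr0 ger0_norm; lra.
  have [xa0 ta0 _] := @path_rise 0 ltac:(lra).
  have [xb0 tb0] := @target_rise 0 ltac:(lra).
  have := hx v 0; have := ht v 0; rewrite xa0 ta0 xb0 tb0 !subrr !subr0 => ? ?.
  by rewrite subr0 in v12; split; lra.
have [v1|v1] := leP v 1.
  have hv : 0 <= v <= 1 by have /andP[-> _] := v01.
  by have [-> -> _] := path_rise hv; have [-> ->] := target_rise hv; rewrite !subrr normr0.
have [v11|v11] := leP v 11; first by apply: main; rewrite ltW.
have hv : 11 <= v <= 12 by have /andP[_ ->] := v01; rewrite ltW.
by have [-> -> _] := path_return hv; have [-> ->] := target_return hv; rewrite !subrr normr0.
Qed.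

(** Heights are kept, so the middle of the loop cannot meet itself whatever its projection does, and
    the two end pieces do not move at all. *)
Lemma contract_loop :
  ambient_isotopic (B `|` [set p | exists2 v, 0 <= v <= 12 & p = pt (path_x v) (path_t v) (path_z v)])
                   (B `|` [set p | exists2 v, 0 <= v <= 12 & p = pt (target_x v) (target_t v) (path_z v)]).
Proof.
rewrite !split_index.
have [C1 C10 hx1] := lipschitz1_displacement_x.
have [C2 C20 ht2] := lipschitz1B lipschitz1_target_t (lipschitz1_pl T _ : lipschitz1 path_t).
pose C := C1 + C2; have C0 : 0 <= C by exact: addr_ge0.
have hx u v : `|(target_x u - path_x u) - (target_x v - path_x v)| <= C * `|u - v|.
  by apply: le_trans (hx1 u v) _; apply: ler_wpM2r => //; rewrite lerDl.
have ht u v : `|(target_t u - path_t u) - (target_t v - path_t v)| <= C * `|u - v|.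
  by apply: le_trans (ht2 u v) _; apply: ler_wpM2r => //; rewrite lerDr.
apply: (@straight_line_pt _ _ _ _ _ _ _ _ _ (48 * C)) => -[u|p] [v|q] r m /= Su Sv r01 h1 h2 h3.
- have m0 : 0 <= m by exact: le_trans h1.
  rewrite (_ : _ + _ = mix_x r u - mix_x r v) in h1; last by rewrite /mix_x; ring.
  rewrite (_ : _ + _ = mix_t r u - mix_t r v) in h2; last by rewrite /mix_t; ring.
  rewrite (_ : _ + _ = path_z u - path_z v) in h3; last by ring.
  have uv : `|u - v| <= 24 * m.
    have [uv|/ltW uv] := leP u v.
      by rewrite ler0_norm ?subr_le0// opprB; apply: path_separated h1 h2 h3.
    rewrite ger0_norm ?subr_ge0//; rewrite distrC in h1; rewrite distrC in h2; rewrite distrC in h3.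
    exact: path_separated h1 h2 h3.
  have Cuv : C * `|u - v| <= 48 * C * m.
    have := ler_wpM2l C0 uv; have := mulr_ge0 C0 m0.
    by rewrite (_ : C * (24 * m) = 24 * (C * m)) 1?(_ : 48 * C * m = 48 * (C * m)); [lra|ring|ring].
  split; [exact: le_trans (hx u v) Cuv|exact: le_trans (ht u v) Cuv|].
  by rewrite !subrr normr0 !mulr_ge0.
- have m0 : 0 <= m by exact: le_trans h1.
  rewrite (_ : _ + _ = mix_x r u - xc q) in h1; last by rewrite /mix_x; ring.
  rewrite (_ : _ + _ = mix_t r u - tc q) in h2; last by rewrite /mix_t; ring.
  have [k1 k2] := displacement_bound C0 hx ht r01 Su Sv h1 h2.
  by rewrite !subrr !subr0 normr0; split=> //; rewrite !mulr_ge0.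
- have m0 : 0 <= m by exact: le_trans h1.
  rewrite (_ : _ + _ = - (mix_x r v - xc p)) in h1; last by rewrite /mix_x; ring.
  rewrite (_ : _ + _ = - (mix_t r v - tc p)) in h2; last by rewrite /mix_t; ring.
  rewrite normrN in h1; rewrite normrN in h2.
  have [k1 k2] := displacement_bound C0 hx ht r01 Sv Su h1 h2.
  by rewrite !subrr !sub0r !normrN normr0; split=> //; rewrite !mulr_ge0.
- have m0 : 0 <= m by exact: le_trans h1.
  by rewrite !subrr normr0 !mulr_ge0.
Qed.

Let pull_bound r m v q C : 0 <= C -> (forall u v, `|(1 - target_x u) - (1 - target_x v)| <= C * `|u - v|) ->
  (forall u v, `|(0 - path_z u) - (0 - path_z v)| <= C * `|u - v|) ->
  0 <= r <= 1 -> 0 <= v <= 12 -> B q ->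
  `|(1 - r) * (target_x v - xc q) + r * (1 - xc q)| <= m -> `|target_t v - tc q| <= m ->
  `|1 - target_x v| <= 20 * C * m /\ `|0 - path_z v| <= 20 * C * m.
Proof.
move=> C0 hx hz r01 v01 /B_off Bq h1 h2; have T1' := T1.
have m0 : 0 <= m by exact: le_trans h1.
have /andP[v0 v12] := v01; have /andP[rr0 rr1] := r01.
have [xb0 tb0] := @target_rise 0 ltac:(lra).
have [_ _ za0] := @path_rise 0 ltac:(lra).
have [xbe tbe] := @target_return 12 ltac:(lra).
have [_ _ zae] := @path_return 12 ltac:(lra).
have t0 := target_t_incr (lexx 0) v0 v12; have te := target_t_incr v0 v12 (lexx 12).
rewrite tb0 in t0; rewrite tbe in te.
have xbr := target_x_range v01.
have /andP[xb1 xb2] := xbr.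
have : 0 <= r * (1 - target_x v) by rewrite mulr_ge0// subr_ge0.
have : 0 <= (1 - r) * (1 - target_x v) by rewrite mulr_ge0// subr_ge0.
move=> n1 n2.
(* [target_t] climbs from [T] to [T + 1] at rate at least 1/20, and [B] comes near only at times
   outside this range. So a nearby point of [B] forces [v] close to an end of the loop, where the
   displacement vanishes. *)
have vm : v <= 20 * m \/ 12 - v <= 20 * m.
  move: h1 h2; rewrite !ler_norml => /andP[x1 x2] /andP[t1 t2].
  case: Bq => [[? [?|?|?]]|?|?|?].
  - by left; lra.
  - by right; lra.
  - by left; lra.
  - by left; lra.
  - by right; lra.
  - by left; lra.
have eC : 20 * C * m = C * (20 * m) by ring.
rewrite eC; case: vm => /(ler_wpM2l C0) vm.
  have := hx v 0; have := hz v 0; rewrite xb0 za0 mulr0 !subrr !subr0 (ger0_norm v0) => kz kx.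
  by split; [exact: le_trans kx vm|exact: le_trans kz vm].
have := hx v 12; have := hz v 12.
rewrite xbe zae (_ : 0 - (-2 + 2 * (12 - 11)) = 0 :> R) ?subrr ?subr0; last by ring.
rewrite (distrC v) (ger0_norm (_ : 0 <= 12 - v)) ?subr_ge0// => kz kx.
by split; [exact: le_trans kx vm|exact: le_trans kz vm].
Qed.

(** The roles are exchanged: time is kept and separates the points of the arc, while the other two
    coordinates become constant. *)
Lemma pull_tight :
  ambient_isotopic (B `|` [set p | exists2 v, 0 <= v <= 12 & p = pt (target_x v) (target_t v) (path_z v)])
                   (B `|` [set p | exists2 v, 0 <= v <= 12 & p = pt 1 (target_t v) 0]).
Proof.
rewrite (split_index target_x target_t path_z) (split_index (fun=> 1) target_t (fun=> 0)).
have [C1 C10 hx1] := lipschitz1_pull_x.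
have [C2 C20 hz2] := lipschitz1B (lipschitz1_cst 0) (lipschitz1_pl 0 _ : lipschitz1 path_z).
pose C := C1 + C2; have C0 : 0 <= C by exact: addr_ge0.
have hx u v : `|(1 - target_x u) - (1 - target_x v)| <= C * `|u - v|.
  by apply: le_trans (hx1 u v) _; apply: ler_wpM2r => //; rewrite lerDl.
have hz u v : `|(0 - path_z u) - (0 - path_z v)| <= C * `|u - v|.
  by apply: le_trans (hz2 u v) _; apply: ler_wpM2r => //; rewrite lerDr.
apply: (@straight_line_pt _ _ _ _ _ _ _ _ _ (20 * C)) => -[u|p] [v|q] r m /= Su Sv r01 h1 h2 h3.
- have m0 : 0 <= m by exact: le_trans h1.
  rewrite (_ : _ + _ = target_t u - target_t v) in h2; last by ring.
  have uv : `|u - v| <= 20 * m.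
    have [uv|/ltW uv] := leP u v.
      rewrite ler0_norm ?subr_le0// opprB.
      have /andP[u0 _] := Su; have /andP[_ v12] := Sv; have := target_t_incr u0 uv v12.
      by move: h2; rewrite ler_norml => /andP[? ?]; lra.
    rewrite ger0_norm ?subr_ge0//.
    have /andP[_ u0] := Su; have /andP[v12 _] := Sv; have := target_t_incr v12 uv u0.
    by move: h2; rewrite ler_norml => /andP[? ?]; lra.
  have Cuv : C * `|u - v| <= 20 * C * m.
    by have := ler_wpM2l C0 uv; rewrite (_ : 20 * C * m = C * (20 * m)) //; ring.
  split; [exact: le_trans (hx u v) Cuv| |exact: le_trans (hz u v) Cuv].
  by rewrite !subrr normr0 !mulr_ge0.
- have m0 : 0 <= m by exact: le_trans h1.
  rewrite (_ : _ + _ = target_t u - tc q) in h2; last by ring.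
  have [k1 k2] := pull_bound C0 hx hz r01 Su Sv h1 h2.
  by rewrite !subrr !subr0 normr0; split=> //; rewrite ?mulr_ge0// -[X in `|X|]opprK normrN opprB -sub0r opprB addrC.
- have m0 : 0 <= m by exact: le_trans h1.
  rewrite (_ : _ + _ = - ((1 - r) * (target_x v - xc p) + r * (1 - xc p))) in h1; last by ring.
  rewrite (_ : _ + _ = - (target_t v - tc p)) in h2; last by ring.
  rewrite normrN in h1; rewrite normrN in h2.
  have [k1 k2] := pull_bound C0 hx hz r01 Sv Su h1 h2.
  by rewrite !subrr normr0 !sub0r !normrN; rewrite sub0r normrN in k2; split=> //; rewrite !mulr_ge0.
- have m0 : 0 <= m by exact: le_trans h1.
  by rewrite !subrr normr0 !mulr_ge0.
Qed.

Lemma kink_removal : ambient_isotopic (B `|` polyline kink_start kink_knots)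
  (B `|` [set p | exists2 t, T <= t <= T + 1 & p = pt 1 t 0]).
Proof.
have -> : polyline kink_start kink_knots =
    [set p | exists2 v, 0 <= v <= 12 & p = pt (path_x v) (path_t v) (path_z v)].
  rewrite polylineE; apply/seteqP; split => [_ [v v01 <-]|_ [v v01 ->]]; exists v => //;
    by rewrite /pl_pt /kink_knots /kink_start /= !(xc_pt, tc_pt, zc_pt).
have -> : [set p | exists2 t, T <= t <= T + 1 & p = pt 1 t 0] =
    [set p | exists2 v, 0 <= v <= 12 & p = pt 1 (target_t v) 0].
  apply/seteqP; split => [_ [t /andP[t0 t1] ->]|_ [v /andP[v0 v1] ->]].
    have [t4|t4] := leP t (T + 4^-1).
      exists (4 * (t - T)); first by apply/andP; split; lra.
      by rewrite (target_rise _).2; [congr (pt _ _ _); field|apply/andP; split; lra].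
    have [t5|t5] := leP t (T + 3 / 4).
      exists (1 + 20 * (t - T - 4^-1)); first by apply/andP; split; lra.
      by rewrite target_t_mid; [congr (pt _ _ _); field|apply/andP; split; lra].
    exists (11 + 4 * (t - T - 3 / 4)); first by apply/andP; split; lra.
    by rewrite (target_return _).2; [congr (pt _ _ _); field|apply/andP; split; lra].
  have [_ tb0] := @target_rise 0 ltac:(lra).
  have [_ tbe] := @target_return 12 ltac:(lra).
  have := target_t_incr (lexx 0) v0 v1; have := target_t_incr v0 v1 (lexx 12).
  by rewrite tb0 tbe => ? ?; exists (target_t v) => //; apply/andP; split; lra.
exact: ambient_isotopic_trans contract_loop pull_tight.
Qed.
End Kink.

(** * Lifting the flat loop by a shear *)

Section KinkLift.
Variables (R : realType) (T : R).
Hypothesis T1 : 1 <= T.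
Implicit Types (x y t z c r u v m : R) (p q : R3pt R).

(* On the plane of the projection this height function decreases along the innermost closing loop,
   and it vanishes on the rest of the link. *)
Definition loop_height0 t : R :=
  - 4^-1 * clamp01 (t + 2) - 8^-1 * clamp01 (t + 1) - 8^-1 * clamp01 (t / T)
  + 2^-1 * clamp01 (4 * (t - T)) + 2^-1 * clamp01 (4 * (t - T) - 3)
  - 4^-1 * clamp01 (t - T - 1) - 4^-1 * clamp01 (t - T - 2).
Definition loop_height1 t : R :=
  - 8^-1 * clamp01 (t + 2) + 4^-1 * clamp01 ((t + 1) / (T + 3)) - 8^-1 * clamp01 (t - T - 2).
(** The two factors in [x] are hat functions centred at 0 and -1, the lines that carry the long
    sides of the innermost closing arc. *)
Definition loop_height x t : R :=
  (clamp01 (x + 1) - clamp01 x) * loop_height0 t + (clamp01 (x + 2) - clamp01 (x + 1)) * loop_height1 t.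

Lemma loop_height_ge1 x t : 1 <= x -> loop_height x t = 0.
Proof. by move=> x1; rewrite /loop_height !clamp01_eq1; [ring|lra..]. Qed.
Lemma loop_height_leN2 x t : x <= -2 -> loop_height x t = 0.
Proof. by move=> x1; rewrite /loop_height !clamp01_eq0; [ring|lra..]. Qed.
Lemma loop_height_low x t : t <= -2 -> loop_height x t = 0.
Proof.
move=> t2; rewrite /loop_height /loop_height0 /loop_height1.
have T0 : 0 < T := lt_le_trans ltr01 T1.
have h1 : t / T <= 0 by rewrite pmulr_lle0 ?invr_gt0//; lra.
have h2 : (t + 1) / (T + 3) <= 0 by rewrite pmulr_lle0 ?invr_gt0//; lra.
rewrite (@clamp01_eq0 _ (t / T))// (@clamp01_eq0 _ ((t + 1) / _))//.
rewrite (@clamp01_eq0 _ (t + 2)) ?(@clamp01_eq0 _ (t + 1)) ?(@clamp01_eq0 _ (4 * (t - T))); try lra.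
rewrite (@clamp01_eq0 _ (4 * (t - T) - 3)) ?(@clamp01_eq0 _ (t - T - 1)) ?(@clamp01_eq0 _ (t - T - 2)); lra.
Qed.
Lemma loop_height_high x t : T + 3 <= t -> loop_height x t = 0.
Proof.
move=> t2; rewrite /loop_height /loop_height0 /loop_height1; have T1' := T1.
have T0 : 0 < T := lt_le_trans ltr01 T1.
have h1 : 1 <= t / T by rewrite ler_pdivlMr//; lra.
have h2 : 1 <= (t + 1) / (T + 3) by rewrite ler_pdivlMr//; lra.
rewrite (@clamp01_eq1 _ (t / T))// (@clamp01_eq1 _ ((t + 1) / _))//.
rewrite (@clamp01_eq1 _ (t + 2)) ?(@clamp01_eq1 _ (t + 1)) ?(@clamp01_eq1 _ (4 * (t - T))); try lra.
rewrite (@clamp01_eq1 _ (4 * (t - T) - 3)) ?(@clamp01_eq1 _ (t - T - 1)) ?(@clamp01_eq1 _ (t - T - 2)); lra.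
Qed.
Lemma loop_heightE0 t : loop_height 0 t = loop_height0 t.
Proof.
rewrite /loop_height (@clamp01_eq1 _ (0 + 1)) ?(@clamp01_eq0 _ 0) ?(@clamp01_eq1 _ (0 + 2)); lra.
Qed.
Lemma loop_heightEN1 t : loop_height (-1) t = loop_height1 t.
Proof.
rewrite /loop_height (@clamp01_eq0 _ (-1 + 1)) ?(@clamp01_eq0 _ (-1)) ?(@clamp01_eq1 _ (-1 + 2)); lra.
Qed.
Lemma loop_height_bar x t : -1 <= x <= 0 ->
  loop_height x t = (1 + x) * loop_height0 t - x * loop_height1 t.
Proof.
move=> /andP[x1 x0]; rewrite /loop_height (@clamp01_id _ (x + 1)); last by apply/andP; split; lra.
by rewrite (@clamp01_eq0 _ x)// (@clamp01_eq1 _ (x + 2)); [ring|lra].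
Qed.
Lemma loop_height_cross x t : 0 <= x <= 1 -> T + 4^-1 <= t <= T + 3 / 4 -> loop_height x t = 0.
Proof.
move=> /andP[x0 x1] /andP[t0 t1]; rewrite /loop_height /loop_height0; have T1' := T1.
have T0 : 0 < T := lt_le_trans ltr01 T1.
rewrite (@clamp01_eq1 _ (x + 1)) ?(@clamp01_eq1 _ (x + 2)); try lra.
have h1 : 1 <= t / T by rewrite ler_pdivlMr//; lra.
rewrite (@clamp01_eq1 _ (t / T))//.
rewrite (@clamp01_eq1 _ (t + 2)) ?(@clamp01_eq1 _ (t + 1)) ?(@clamp01_eq1 _ (4 * (t - T))); try lra.
rewrite (@clamp01_eq0 _ (4 * (t - T) - 3)) ?(@clamp01_eq0 _ (t - T - 1)) ?(@clamp01_eq0 _ (t - T - 2)); lra.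
Qed.

Lemma loop_height0_1 t : -1 <= t <= 0 -> loop_height0 t = - 4^-1 - (t + 1) / 8.
Proof.
move=> /andP[t0 t1]; rewrite /loop_height0; have T1' := T1.
have T0 : 0 < T := lt_le_trans ltr01 T1.
have h1 : t / T <= 0 by rewrite pmulr_lle0 ?invr_gt0.
rewrite (@clamp01_eq0 _ (t / T))// (@clamp01_eq1 _ (t + 2)) ?(@clamp01_id _ (t + 1)) ?(@clamp01_eq0 _ (4 * (t - T))); try lra.
rewrite (@clamp01_eq0 _ (4 * (t - T) - 3)) ?(@clamp01_eq0 _ (t - T - 1)) ?(@clamp01_eq0 _ (t - T - 2)); lra.
Qed.
Lemma loop_height0_2 t : 0 <= t <= T -> loop_height0 t = - (3 / 8) - t / T / 8.
Proof.
move=> /andP[t0 t1]; rewrite /loop_height0; have T1' := T1.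
have T0 : 0 < T := lt_le_trans ltr01 T1.
have h1 : 0 <= t / T <= 1 by rewrite ler_pdivrMr// mul1r t1 divr_ge0// ltW.
rewrite (@clamp01_id _ (t / T))// (@clamp01_eq1 _ (t + 2)) ?(@clamp01_eq1 _ (t + 1)) ?(@clamp01_eq0 _ (4 * (t - T))); try lra.
rewrite (@clamp01_eq0 _ (4 * (t - T) - 3)) ?(@clamp01_eq0 _ (t - T - 1)) ?(@clamp01_eq0 _ (t - T - 2)); lra.
Qed.
Lemma loop_height0_3 t : T <= t <= T + 4^-1 -> loop_height0 t = - 2^-1 + 2 * (t - T).
Proof.
move=> /andP[t0 t1]; rewrite /loop_height0; have T1' := T1.
have T0 : 0 < T := lt_le_trans ltr01 T1.
have h1 : 1 <= t / T by rewrite ler_pdivlMr//; lra.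
rewrite (@clamp01_eq1 _ (t / T))// (@clamp01_eq1 _ (t + 2)) ?(@clamp01_eq1 _ (t + 1)) ?(@clamp01_id _ (4 * (t - T))); try lra.
rewrite (@clamp01_eq0 _ (4 * (t - T) - 3)) ?(@clamp01_eq0 _ (t - T - 1)) ?(@clamp01_eq0 _ (t - T - 2)); lra.
Qed.
Lemma loop_height0_5 t : T + 3 / 4 <= t <= T + 1 -> loop_height0 t = 2 * (t - T) - 3 / 2.
Proof.
move=> /andP[t0 t1]; rewrite /loop_height0; have T1' := T1.
have T0 : 0 < T := lt_le_trans ltr01 T1.
have h1 : 1 <= t / T by rewrite ler_pdivlMr//; lra.
rewrite (@clamp01_eq1 _ (t / T))// (@clamp01_eq1 _ (t + 2)) ?(@clamp01_eq1 _ (t + 1)) ?(@clamp01_eq1 _ (4 * (t - T))); try lra.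
rewrite (@clamp01_id _ (4 * (t - T) - 3)) ?(@clamp01_eq0 _ (t - T - 1)) ?(@clamp01_eq0 _ (t - T - 2)); lra.
Qed.
Lemma loop_height0_6 t : T + 1 <= t <= T + 2 -> loop_height0 t = 2^-1 - (t - T - 1) / 4.
Proof.
move=> /andP[t0 t1]; rewrite /loop_height0; have T1' := T1.
have T0 : 0 < T := lt_le_trans ltr01 T1.
have h1 : 1 <= t / T by rewrite ler_pdivlMr//; lra.
rewrite (@clamp01_eq1 _ (t / T))// (@clamp01_eq1 _ (t + 2)) ?(@clamp01_eq1 _ (t + 1)) ?(@clamp01_eq1 _ (4 * (t - T))); try lra.
rewrite (@clamp01_eq1 _ (4 * (t - T) - 3)) ?(@clamp01_id _ (t - T - 1)) ?(@clamp01_eq0 _ (t - T - 2)); lra.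
Qed.
Lemma loop_height1_mid t : -1 <= t <= T + 2 -> loop_height1 t = - 8^-1 + (t + 1) / (T + 3) / 4.
Proof.
move=> /andP[t0 t1]; rewrite /loop_height1; have T1' := T1.
have T0 : 0 < T + 3 by lra.
have h1 : 0 <= (t + 1) / (T + 3) <= 1.
  by rewrite ler_pdivrMr// mul1r divr_ge0; lra.
rewrite (@clamp01_id _ ((t + 1) / _))// (@clamp01_eq1 _ (t + 2)) ?(@clamp01_eq0 _ (t - T - 2)); lra.
Qed.

Lemma loop_height_lipschitz : exists L, forall x t x' t',
  `|loop_height x t - loop_height x' t'| <= L * (`|x - x'| + `|t - t'|).
Proof.
have lin (a b d : R) : lipschitz1 (fun u => d * clamp01 (a * u + b)).
  apply: lipschitz1Z; apply: lipschitz1_comp; first exact: lipschitz1_clamp01.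
  by apply: lipschitz1D; [apply: lipschitz1Z; exact: lipschitz1_id|exact: lipschitz1_cst].
have ext f g : lipschitz1 g -> (forall u : R, f u = g u) -> lipschitz1 f.
  by move=> gl fg; rewrite (_ : f = g)//; apply/funext.
have l0 : lipschitz1 loop_height0.
  apply: (ext _ _ (lipschitz1D (lipschitz1D (lipschitz1D (lipschitz1D (lipschitz1D (lipschitz1D
    (lin 1 2 (- 4^-1)) (lin 1 1 (- 8^-1))) (lin T^-1 0 (- 8^-1))) (lin 4 (- (4 * T)) (2^-1)))
    (lin 4 (- (4 * T) - 3) (2^-1))) (lin 1 (- T - 1) (- 4^-1))) (lin 1 (- T - 2) (- 4^-1)))).
  move=> u; rewrite /loop_height0 !mul1r addr0 (mulrC T^-1) mulrBr !addrA.
  by rewrite -!mulNr.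
have l1 : lipschitz1 loop_height1.
  apply: (ext _ _ (lipschitz1D (lipschitz1D
    (lin 1 2 (- 8^-1)) (lin (T + 3)^-1 (T + 3)^-1 (4^-1))) (lin 1 (- T - 2) (- 8^-1)))).
  by move=> u; rewrite /loop_height1 !mul1r mulrDl mul1r (mulrC (T + 3)^-1) !addrA -!mulNr.
have lA : lipschitz1 (fun x : R => clamp01 (x + 1) - clamp01 x).
  apply: (ext _ _ (lipschitz1D (lin 1 1 1) (lin 1 0 (-1)))).
  by move=> u; rewrite !mul1r addr0 mulN1r.
have lB : lipschitz1 (fun x : R => clamp01 (x + 2) - clamp01 (x + 1)).
  apply: (ext _ _ (lipschitz1D (lin 1 2 1) (lin 1 1 (-1)))).
  by move=> u; rewrite !mul1r mulN1r.
have b0 t : `|loop_height0 t| <= 2.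
  rewrite /loop_height0 ler_norml.
  repeat match goal with |- context [clamp01 ?a] => move: (clamp01_ge0 a) (clamp01_le1 a);
    generalize (clamp01 a) => ? ? ? end.
  by apply/andP; split; lra.
have b1 t : `|loop_height1 t| <= 2.
  rewrite /loop_height1 ler_norml.
  repeat match goal with |- context [clamp01 ?a] => move: (clamp01_ge0 a) (clamp01_le1 a);
    generalize (clamp01 a) => ? ? ? end.
  by apply/andP; split; lra.
have bc (a b : R) : `|clamp01 a - clamp01 b| <= 1.
  rewrite ler_norml; have := clamp01_ge0 a; have := clamp01_le1 a.
  have := clamp01_ge0 b; have := clamp01_le1 b; move=> ? ? ? ?; apply/andP; split; lra.
have prod f g : lipschitz1 f -> lipschitz1 g -> (forall u : R, `|f u| <= 1) -> (forall u : R, `|g u| <= 2) ->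
  exists2 L, 0 <= L & forall x t x' t', `|f x * g t - f x' * g t'| <= L * (`|x - x'| + `|t - t'|).
  move=> [C C0 fC] [D D0 gD] f1 g2; exists (2 * C + D) => [|x t x' t']; first by lra.
  rewrite (_ : f x * g t - f x' * g t' = (f x - f x') * g t + f x' * (g t - g t')); last by ring.
  apply: le_trans (ler_normD _ _) _; rewrite !normrM.
  have h1 : `|f x - f x'| * `|g t| <= C * `|x - x'| * 2 by apply: ler_pM.
  have h2 : `|f x'| * `|g t - g t'| <= 1 * (D * `|t - t'|) by apply: ler_pM.
  have := mulr_ge0 C0 (normr_ge0 (t - t')); have := mulr_ge0 D0 (normr_ge0 (x - x')).
  by rewrite mulrDr !mulrDl; lra.
have [L1 L10 H1] := prod _ _ lA l0 (fun u => bc _ _) b0.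
have [L2 L20 H2] := prod _ _ lB l1 (fun u => bc _ _) b1.
exists (L1 + L2) => x t x' t'; rewrite /loop_height opprD addrACA [leRHS]mulrDl.
by apply: le_trans (ler_normD _ _) _; apply: lerD; [exact: H1|exact: H2].
Qed.

Definition lift_loop p := pt (xc p) (tc p) (zc p + loop_height (xc p) (tc p)).

Fixpoint linear_along (f : R -> R -> R) p (l : seq (R3pt R)) : Prop :=
  if l is q :: l' then (forall r, 0 <= r <= 1 ->
      f ((1 - r) * xc p + r * xc q) ((1 - r) * tc p + r * tc q) =
      (1 - r) * f (xc p) (tc p) + r * f (xc q) (tc q)) /\ linear_along f q l'
  else True.

Lemma lift_polyline p l : linear_along loop_height p l ->
  lift_loop @` polyline p l = polyline (lift_loop p) (map lift_loop l).
Proof.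
elim: l p => [|q l IH] p /=; first by rewrite image_set1.
by move=> [h1 h2]; rewrite image_setU IH// shear_seg.
Qed.

(** The loop as it occurs in the closure: the upper string of the added crossing, the innermost
    closing arc, the idle string from 0 to [T], and the lower string of the crossing. *)
Definition flat_knots : seq (R3pt R) :=
  [:: pt 1 (T + 4^-1) 2; pt 0 (T + 3 / 4) 1; pt 0 (T + 1) 0; pt 0 (T + 2) 0;
      pt (-1) (T + 2) 0; pt (-1) (-1) 0; pt 0 (-1) 0; pt 0 0 0;
      pt 0 T 0; pt 0 (T + 4^-1) (-1); pt 1 (T + 3 / 4) (-2); pt 1 (T + 1) 0].

Lemma lift_flat_knots : lift_loop @` polyline (kink_start T) flat_knots =
  polyline (kink_start T) (kink_knots T).
Proof.
have T1' := T1; have T0 : 0 < T := lt_le_trans ltr01 T1.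
have Tn0 : T != 0 by rewrite gt_eqF.
have T3 : 0 < T + 3 by lra. have Tn3 : T + 3 != 0 by rewrite gt_eqF.
have e1 t : loop_height 1 t = 0 by rewrite loop_height_ge1.
rewrite lift_polyline; last first.
  rewrite /= !(xc_pt, tc_pt).
  have x0 r : (1 - r) * 0 + r * 0 = 0 :> R by ring.
  have x1 r : (1 - r) * 1 + r * 1 = 1 :> R by ring.
  have xN1 r : (1 - r) * -1 + r * -1 = -1 :> R by ring.
  do ![split => [r /andP[r0 r1]|]].
  - by rewrite x1 !e1; ring.
  - rewrite !loop_height_cross; lra.
  - rewrite x0 !loop_heightE0 !loop_height0_5; lra.
  - rewrite x0 !loop_heightE0 !loop_height0_6; lra.
  - rewrite (_ : (1 - r) * (T + 2) + r * (T + 2) = T + 2); last by ring.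
    rewrite (@loop_height_bar (_ + _)); last by apply/andP; split; lra.
    by rewrite loop_heightE0 loop_heightEN1; ring.
  - have ? : 0 <= r * (T + 3) by rewrite mulr_ge0// ltW.
    have ? : 0 <= (1 - r) * (T + 3) by rewrite mulr_ge0// ?subr_ge0// ltW.
    rewrite xN1 !loop_heightEN1 !loop_height1_mid; try lra; by field.
  - rewrite (_ : (1 - r) * -1 + r * -1 = -1); last by ring.
    rewrite (@loop_height_bar (_ + _)); last by apply/andP; split; lra.
    by rewrite loop_heightE0 loop_heightEN1; ring.
  - rewrite x0 !loop_heightE0 !loop_height0_1; lra.
  - have ? : 0 <= r * T by rewrite mulr_ge0// ltW.
    have ? : 0 <= (1 - r) * T by rewrite mulr_ge0// ?subr_ge0// ltW.
    rewrite x0 !loop_heightE0 !loop_height0_2; try lra; by field.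
  - rewrite x0 !loop_heightE0 !loop_height0_3; lra.
  - rewrite !loop_height_cross; lra.
  - by rewrite x1 !e1; ring.
have l1 t z : lift_loop (pt 1 t z) = pt 1 t z by rewrite /lift_loop xc_pt tc_pt zc_pt e1 addr0.
have l0 t z : lift_loop (pt 0 t z) = pt 0 t (z + loop_height0 t).
  by rewrite /lift_loop xc_pt tc_pt zc_pt loop_heightE0.
have lN1 t z : lift_loop (pt (-1) t z) = pt (-1) t (z + loop_height1 t).
  by rewrite /lift_loop xc_pt tc_pt zc_pt loop_heightEN1.
congr (polyline _ _); first by rewrite /kink_start l1.
rewrite /flat_knots /kink_knots /= !l1 !l0 !lN1.
rewrite (@loop_height0_5 (T + 3 / 4)); last by lra.
rewrite (@loop_height0_5 (T + 1)); last by lra.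
rewrite (@loop_height0_6 (T + 2)); last by lra.
rewrite (@loop_height0_1 (-1)); last by lra.
rewrite (@loop_height0_1 0); last by lra.
rewrite (@loop_height0_2 T); last by lra.
rewrite (@loop_height0_3 (T + 4^-1)); last by lra.
rewrite (@loop_height1_mid (T + 2)); last by lra.
rewrite (@loop_height1_mid (-1)); last by lra.
do ![congr (_ :: _)]; congr (pt _ _ _); try lra; field; lra.
Qed.
End KinkLift.

(** * Stabilization *)

Section Stabilization.
Variables (R : realType) (n : nat).
Implicit Types (x y t z c r u v m : R) (p q : R3pt R) (k : nat).

(** The new string stays at position 0, the one whose closing arc is innermost. *)
Definition lift_letter c (l : letter R n.+1) : letter R n.+2 :=
  (lift_perm ord0 ord0 l.1, fun i => if unlift ord0 i is Some j then l.2 j else c).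

Definition string1 : 'I_n.+2 := lift ord0 ord0.

Definition shift_right (K : set (R3pt R)) : set (R3pt R) :=
  [set p | K (pt (xc p - 1) (tc p) (zc p))].

Definition idle_string k T : set (R3pt R) :=
  [set p | [/\ xc p = 0, zc p = 0 & k%:R <= tc p <= T%:R]].

Lemma lift_letter_x c (l : letter R n.+1) (j : 'I_n.+1) u :
  strand_x (lift_letter c l).1 (lift ord0 j) u = strand_x l.1 j u + 1.
Proof.
rewrite /strand_x /= lift_perm_lift !lift0 -!natr1; ring.
Qed.
Lemma lift_letter_z c (l : letter R n.+1) (j : 'I_n.+1) u :
  strand_z (lift_letter c l).2 (lift ord0 j) u = strand_z l.2 j u.
Proof. by rewrite /strand_z /= liftK. Qed.
Lemma lift_letter_x0 c (l : letter R n.+1) u : strand_x (lift_letter c l).1 ord0 u = 0.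
Proof. by rewrite /strand_x /= lift_perm_id subrr mulr0 addr0. Qed.
Lemma lift_letter_z0 (l : letter R n.+1) u : strand_z (lift_letter 0 l).2 ord0 u = 0.
Proof. by rewrite /strand_z /= unlift_none mulr0. Qed.

Lemma slot_lift k (l : letter R n.+1) :
  slot k (lift_letter 0 l) = shift_right (slot k l) `|` idle_string k k.+1.
Proof.
apply/seteqP; split => p.
- move=> [i [u [u01 ->]]]; case: (unliftP ord0 i) => [j|] ->.
    left; exists j, u; split=> //.
    by rewrite lift_letter_x lift_letter_z xc_pt tc_pt zc_pt addrK.
  right; split; rewrite ?xc_pt ?tc_pt ?zc_pt ?lift_letter_x0 ?lift_letter_z0// -natr1.
  by have /andP[? ?] := u01; apply/andP; split; lra.
- move=> [[j [u [u01 e]]]|[x0 z0 /andP[t0 t1]]].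
    exists (lift ord0 j), u; split=> //.
    have := congr1 (@xc R) e; have := congr1 (@tc R) e; have := congr1 (@zc R) e.
    rewrite !xc_pt !tc_pt !zc_pt => ez et ex.
    by rewrite [p]pt_eta lift_letter_x lift_letter_z; congr (pt _ _ _) => //; lra.
  rewrite -natr1 in t1; exists ord0, (tc p - k%:R); split; first by apply/andP; split; lra.
  rewrite lift_letter_x0 lift_letter_z0 [LHS]pt_eta x0 z0; congr (pt _ _ _); ring.
Qed.

Lemma slots_lift k (w : seq (letter R n.+1)) : (0 < size w)%N ->
  slots k (map (lift_letter 0) w) = shift_right (slots k w) `|` idle_string k (k + size w).
Proof.
elim: w k => [//|l w IH] k _; rewrite [LHS]/= slot_lift [slots k (l :: w)]/=.
case: w IH => [_|l' w IH]; first by rewrite /= !setU0 addn1.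
rewrite IH// -[shift_right (_ `|` _)]/(shift_right _ `|` shift_right _).
have -> : idle_string k (k + size (l :: l' :: w)) =
    idle_string k k.+1 `|` idle_string k.+1 (k.+1 + size (l' :: w)).
  rewrite -addSnnS; apply/seteqP; split => p.
    move=> [x0 z0 /andP[t0 t1]]; have [t2|t2] := leP (tc p) k.+1%:R.
      by left; split=> //; rewrite t0.
    by right; split=> //; rewrite t1 ltW.
  have h1 : k%:R <= k.+1%:R :> R by rewrite ler_nat.
  have h2 : k.+1%:R <= (k.+1 + size (l' :: w))%:R :> R by rewrite ler_nat leq_addr.
  move=> [[x0 z0 /andP[t0 t1]]|[x0 z0 /andP[t0 t1]]]; split=> //; apply/andP; split=> //.
    exact: le_trans t1 h2.
  exact: le_trans h1 t0.
by rewrite setUACA.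
Qed.

Lemma slots_x_ge0 k (w : seq (letter R n.+1)) p : slots k w p -> 0 <= xc p.
Proof. by elim: w k => [//|l w IH] k /= [[i [u [_ ->]]]|/IH//]; rewrite xc_pt strand_x_ge0. Qed.

Section Word.
Variable w : seq (letter R n.+1).
Hypothesis w_gt0 : (0 < size w)%N.
Let T := size w.

Let T1 : 1 <= T%:R :> R. Proof. by rewrite ler1n. Qed.

(* What the two links of the stabilization have in common. *)
Definition stab_rest : set (R3pt R) :=
  shift_right (slots 0 w) `|`
  [set p | zc p = 0 /\ exists j : nat, [/\ (2 <= j < n.+2)%N, xc p = j%:R & T%:R <= tc p <= T%:R + 1]] `|`
  [set p | exists2 j : nat, (1 <= j < n.+2)%N & closure_arc R T.+1 n.+2 j p].

Lemma stab_rest_off q : stab_rest q -> off_kink T%:R q.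
Proof.
have T1' := T1; case=> [[sq|[z0 [j [/andP[j2 _] xj /andP[t0 t1]]]]]|[j /andP[j1 _] /closure_arcP[z0]]].
- have := slots_x_ge0 sq; have := slots_time sq; rewrite tc_pt xc_pt add0n => /andP[? ?] ?.
  by constructor 1; split; [lra|constructor 1].
- have : 2 <= j%:R :> R by rewrite ler_nat.
  by move=> ?; constructor 1; split; [lra|constructor 3; lra].
- have : 1 <= j%:R :> R by rewrite ler1n.
  rewrite -!natr1 => ?.
  case=> [[? /andP[? ?]]|[? /andP[? ?]]|[? /andP[? ?]]|[[? /andP[? ?]]|[? /andP[? ?]]]].
  + by constructor 1; split; [lra|constructor 2; lra].
  + by constructor 3; lra.
  + by constructor 2; lra.
  + by constructor 4; lra.
  + by constructor 1; split; [lra|constructor 1; lra].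
Qed.

(** Opens a gap for the innermost loop: position [j] becomes [j + 1], and the closing arc [j] of a
    braid of length [T] becomes the arc [j + 1] of one of length [T + 1], up to vertical pieces
    between the times [T] and [T + 1]. The [gather] functions invert this. *)
Let spread_x x : R := x - 1 + 2 * clamp01 (x + 1).
Let spread_t t : R := t - clamp01 (- t) + 2 * clamp01 (t - T%:R).
Let gather_x x : R := x + 1 - 2 * clamp01 ((x + 2) / 3).
Let gather_t t : R := t + clamp01 (- t / 2) - 2 * clamp01 ((t - T%:R) / 3).

Let gather_xK x : spread_x (gather_x x) = x.
Proof.
rewrite /spread_x /gather_x; case: (clamp01P ((x + 2) / 3)) => -[? ->].
- by rewrite clamp01_eq0; lra.
- by rewrite clamp01_id; lra.
- by rewrite clamp01_eq1; lra.
Qed.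
Let gather_tK t : spread_t (gather_t t) = t.
Proof.
have T1' := T1; rewrite /spread_t /gather_t.
case: (clamp01P (- t / 2)) => -[? ->]; case: (clamp01P ((t - T%:R) / 3)) => -[? ->]; try lra.
- by rewrite !clamp01_eq0; lra.
- by rewrite clamp01_eq0 ?clamp01_id; lra.
- by rewrite clamp01_eq0 ?clamp01_eq1; lra.
- by rewrite clamp01_id ?clamp01_eq0; lra.
- by rewrite clamp01_eq1 ?clamp01_eq0; lra.
Qed.

Lemma spread_closure : ambient_isotopic (word_closure w)
  (stab_rest `|` [set p | exists2 t, T%:R <= t <= T%:R + 1 & p = pt 1 t 0]).
Proof.
have T1' := T1.
apply: (ambient_isotopic_trans (B := (fun p => pt (spread_x (xc p)) (spread_t (tc p)) (zc p)) @` word_closure w)).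
  apply: (@coord_isotopic _ _ _ _ 1 4); [lra|lra| |].
  - move=> x y xy; have := @clamp01_homo R (x + 1) (y + 1) ltac:(lra).
    by rewrite /spread_x => /andP[? ?]; apply/andP; split; lra.
  - move=> x y xy; have := @clamp01_homo R (- y) (- x) ltac:(lra).
    have := @clamp01_homo R (x - T%:R) (y - T%:R) ltac:(lra).
    by rewrite /spread_t => /andP[? ?] /andP[? ?]; apply/andP; split; lra.
rewrite (_ : _ @` _ = stab_rest `|` [set p | exists2 t, T%:R <= t <= T%:R + 1 & p = pt 1 t 0]);
  first exact: ambient_isotopic_refl.
apply/seteqP; split.
- move=> _ [p + <-] => -[sp|[j jn /closure_arcP[z0 H]]].
    have := slots_x_ge0 sp; have := slots_time sp; rewrite add0n => /andP[? ?] ?.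
    left; left; left; rewrite /shift_right /= xc_pt tc_pt zc_pt.
    have -> : spread_x (xc p) - 1 = xc p by rewrite /spread_x clamp01_eq1; lra.
    have -> : spread_t (tc p) = tc p.
      by rewrite /spread_t (@clamp01_eq0 _ (- tc p)) ?(@clamp01_eq0 _ (tc p - _)); lra.
    by rewrite -pt_eta.
  have j0 := ler0n R j; rewrite -!natr1 in H.
  have arcj : closure_arc R T.+1 n.+2 j.+1 (pt (spread_x (xc p)) (spread_t (tc p)) (zc p)) -> 
    (stab_rest `|` [set p | exists2 t, T%:R <= t <= T%:R + 1 & p = pt 1 t 0]) (pt (spread_x (xc p)) (spread_t (tc p)) (zc p)).
    by move=> h; left; right; exists j.+1.
  rewrite z0 in arcj *.
  case: H => [[xj /andP[t0 t1]]|[tj /andP[x0 x1]]|[xj /andP[t0 t1]]|[[tj /andP[x0 x1]]|[xj /andP[t0 t1]]]].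
  + have ex : spread_x (xc p) = j.+1%:R by rewrite /spread_x clamp01_eq1 -?natr1; lra.
    have [ts|ts] := leP (spread_t (tc p)) (T%:R + 1).
      have st : T%:R <= spread_t (tc p).
        by rewrite /spread_t (@clamp01_eq0 _ (- _)); have := clamp01_ge0 (tc p - T%:R); lra.
      rewrite ex; case: (posnP j) => [->|jpos].
        by right; exists (spread_t (tc p)) => //; rewrite st.
      left; left; right; rewrite /= xc_pt tc_pt zc_pt; split=> //; exists j.+1; rewrite ?st//.
      by rewrite ltnS jpos ltnS.
    apply: arcj; apply/closure_arcP; rewrite xc_pt tc_pt zc_pt; split=> //; constructor 1.
    split=> //; rewrite -!natr1 (ltW ts) /= /spread_t (@clamp01_eq0 _ (- _)); last by lra.
    by have := clamp01_le1 (tc p - T%:R); lra.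
  + apply: arcj; apply/closure_arcP; rewrite xc_pt tc_pt zc_pt; split=> //; constructor 2.
    rewrite -!natr1 /spread_t /spread_x (@clamp01_eq0 _ (- _)) ?(@clamp01_eq1 _ (_ - T%:R)); try lra.
    by split; [lra|]; case: (clamp01P (xc p + 1)) => -[? ->]; apply/andP; split; lra.
  + apply: arcj; apply/closure_arcP; rewrite xc_pt tc_pt zc_pt; split=> //; constructor 3.
    rewrite -!natr1 /spread_t /spread_x (@clamp01_eq0 _ (xc p + 1)); last by lra.
    split; first by lra.
    by case: (clamp01P (- tc p)) => -[? ->]; case: (clamp01P (tc p - T%:R)) => -[? ->]; apply/andP; split; lra.
  + apply: arcj; apply/closure_arcP; rewrite xc_pt tc_pt zc_pt; split=> //; constructor 4; left.
    rewrite -!natr1 /spread_t /spread_x (@clamp01_eq1 _ (- _)) ?(@clamp01_eq0 _ (_ - T%:R)); try lra.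
    by split; [lra|]; case: (clamp01P (xc p + 1)) => -[? ->]; apply/andP; split; lra.
  + apply: arcj; apply/closure_arcP; rewrite xc_pt tc_pt zc_pt; split=> //; constructor 4; right.
    rewrite -!natr1 /spread_t /spread_x (@clamp01_eq1 _ (xc p + 1)) ?(@clamp01_eq0 _ (_ - T%:R)); try lra.
    by split; [lra|]; case: (clamp01P (- tc p)) => -[? ->]; apply/andP; split; lra.
- move=> q Kq; exists (pt (gather_x (xc q)) (gather_t (tc q)) (zc q)); last first.
    by rewrite xc_pt tc_pt zc_pt gather_xK gather_tK -pt_eta.
  have inarc (j : nat) (p : R3pt R) : (j < n.+1)%N -> closure_arc R T n.+1 j p -> word_closure w p.
    by move=> jn h; right; exists j.
  case: Kq => [[[sq|[z0 [j [/andP[j2 jn] xj /andP[t0 t1]]]]]|[j /andP[j1 jn] /closure_arcP[z0 H]]]|[t /andP[t0 t1] ->]].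
  + have := slots_x_ge0 sq; have := slots_time sq; rewrite xc_pt tc_pt add0n => /andP[? ?] ?.
    left.
    have -> : gather_x (xc q) = xc q - 1 by rewrite /gather_x clamp01_eq1; lra.
    have -> // : gather_t (tc q) = tc q.
    by rewrite /gather_t (@clamp01_eq0 _ (- tc q / 2)) ?(@clamp01_eq0 _ (_ / 3)); lra.
  + have h2 : 2 <= j%:R :> R by rewrite ler_nat.
    have jE : j%:R = j.-1%:R + 1 :> R by rewrite natr1 prednK// (leq_trans _ j2).
    apply: (inarc j.-1); first by rewrite -ltnS prednK// (leq_trans _ j2).
    apply/closure_arcP; rewrite xc_pt tc_pt zc_pt; split=> //; constructor 1.
    rewrite -natr1 /gather_x /gather_t (@clamp01_eq1 _ ((_ + 2) / 3)) ?(@clamp01_eq0 _ (- tc q / 2)) ?(@clamp01_id _ (_ / 3)); lra.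
  + have h1 : 1 <= j%:R :> R by rewrite ler1n.
    have jE : j%:R = j.-1%:R + 1 :> R by rewrite natr1 prednK.
    apply: (inarc j.-1); first by rewrite -ltnS prednK.
    apply/closure_arcP; rewrite xc_pt tc_pt zc_pt; split=> //.
    rewrite -!natr1 in H *.
    case: H => [[xj /andP[t0 t1]]|[tj /andP[x0 x1]]|[xj /andP[t0 t1]]|[[tj /andP[x0 x1]]|[xj /andP[t0 t1]]]].
    * constructor 1; rewrite /gather_x /gather_t (@clamp01_eq1 _ ((_ + 2) / 3)) ?(@clamp01_eq0 _ (- tc q / 2)); try lra.
      by split; [lra|]; case: (clamp01P ((tc q - T%:R) / 3)) => -[? ->]; apply/andP; split; lra.
    * constructor 2; rewrite /gather_x /gather_t (@clamp01_eq1 _ ((_ - T%:R) / 3)) ?(@clamp01_eq0 _ (- tc q / 2)); try lra.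
      by split; [lra|]; case: (clamp01P ((xc q + 2) / 3)) => -[? ->]; apply/andP; split; lra.
    * constructor 3; rewrite /gather_x /gather_t (@clamp01_eq0 _ ((_ + 2) / 3)); last by lra.
      split; first by lra.
      by case: (clamp01P (- tc q / 2)) => -[? ->]; case: (clamp01P ((tc q - T%:R) / 3)) => -[? ->];
        apply/andP; split; lra.
    * constructor 4; left; rewrite /gather_x /gather_t (@clamp01_eq0 _ ((_ - T%:R) / 3)) ?(@clamp01_eq1 _ (- tc q / 2)); try lra.
      by split; [lra|]; case: (clamp01P ((xc q + 2) / 3)) => -[? ->]; apply/andP; split; lra.
    * constructor 4; right; rewrite /gather_x /gather_t (@clamp01_eq1 _ ((_ + 2) / 3)) ?(@clamp01_eq0 _ ((_ - T%:R) / 3)); try lra.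
      by split; [lra|]; case: (clamp01P (- tc q / 2)) => -[? ->]; apply/andP; split; lra.
  + apply: (inarc 0%N) => //; apply/closure_arcP; rewrite !xc_pt !tc_pt !zc_pt; split=> //; constructor 1.
    rewrite /gather_x /gather_t (@clamp01_eq1 _ ((_ + 2) / 3)) ?(@clamp01_eq0 _ (- t / 2)) ?(@clamp01_id _ (_ / 3)); lra.
Qed.
(** Sloping heights in place of constant ones: the upper string falls from 2 to 1 and the lower from
    -1 to -2, as the monotone height along the loop will require. *)
Let kink_z (i : 'I_n.+2) : R -> R :=
  if i == string1 then plateau 2 1 else if i == ord0 then plateau (-1) (-2) else fun=> 0.

Lemma plateau0 a b : plateau a b 0 = 0 :> R.
Proof. by rewrite /plateau mulr0 !clamp01_eq0; lra. Qed.
Lemma plateau1 a b : plateau a b 1 = 0 :> R.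
Proof. by rewrite /plateau mulr1 !clamp01_eq1; lra. Qed.

Lemma plateau_rho a b u : 0 < rho u < 1 -> plateau a b u = a + (b - a) * rho u.
Proof.
rewrite /rho /plateau; case: (clamp01P (2 * u - 2^-1)) => -[? ->] ?; try lra.
by rewrite clamp01_eq1 ?clamp01_eq0; lra.
Qed.
Lemma string1E : string1 = 1%N :> nat. Proof. by rewrite /string1 lift0. Qed.

Lemma tperm_inversion (i j : 'I_n.+2) : (i < j)%N ->
  (tperm ord0 string1 j < tperm ord0 string1 i)%N -> i = ord0 /\ j = string1.
Proof.
have tE (k : 'I_n.+2) : tperm ord0 string1 k = (if k == 0 :> nat then 1 else if k == 1 :> nat then 0 else k)%N :> nat.
  case: tpermP => [->|->|/eqP k0 /eqP k1]; rewrite ?string1E//.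
  have k0' : (k == 0 :> nat) = false by apply/negbTE; move: k0; rewrite -val_eqE.
  have k1' : (k == 1 :> nat) = false by apply/negbTE; move: k1; rewrite -val_eqE.
  by rewrite k0' k1'.
rewrite !tE => ij; do 4?case: eqP => ?; move=> ?; try lia.
by split; apply: ord_inj; rewrite ?string1E /=; lia.
Qed.

Let arc0E : closure_arc R T.+1 n.+2 0 =
  seg (pt 0 (T%:R + 1) 0) (pt 0 (T%:R + 2) 0) `|` seg (pt 0 (T%:R + 2) 0) (pt (-1) (T%:R + 2) 0) `|`
  seg (pt (-1) (T%:R + 2) 0) (pt (-1) (-1) 0) `|` seg (pt (-1) (-1) 0) (pt 0 (-1) 0) `|`
  seg (pt 0 (-1) 0) (pt 0 0 0).
Proof. by rewrite /closure_arc -natr1 (_ : T%:R + 1 + 1%:R = T%:R + 2)//; lra. Qed.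

Lemma flatten_kink h : h ord0 < h string1 ->
  ambient_isotopic (word_closure (map (lift_letter 0) w ++ [:: (tperm ord0 string1, h)]))
    (stab_rest `|` polyline (kink_start T%:R) (flat_knots T%:R)).
Proof.
move=> h01; have T1' := T1; pose tau := tperm (ord0 : 'I_n.+2) string1.
pose A := slots 0 (map (lift_letter 0) w) `|` @arcs R n.+2 T.+1.
have Tn0 : T%:R != 0 :> R by rewrite pnatr_eq0 -lt0n.
have tau0 : tau ord0 = string1 by rewrite /tau tpermL.
have tau1 : tau string1 = ord0 by rewrite /tau tpermR.
apply: (ambient_isotopic_trans (B := A `|` slab T%:R (strand_x tau) kink_z)).
  rewrite word_closureE /= setU0 size_map addn0; apply: slab_isotopic => //=.
  - by move=> i; exact: lipschitz1_strand_x.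
  - by move=> i; exact: lipschitz1_strand_z.
  - by move=> i; exact: lipschitz1_strand_x.
  - move=> i; rewrite /kink_z; do 2?[case: ifP => _]; try exact: lipschitz1_plateau.
    exact: lipschitz1_cst.
  - by move=> i; rewrite strand_z0 /kink_z; do 2?[case: ifP => _]; rewrite ?plateau0.
  - by move=> i; rewrite strand_z1 /kink_z; do 2?[case: ifP => _]; rewrite ?plateau1.
  - by move=> i u _; rewrite strand_x_ge0.
  - move=> i j r u ij r01 u01 e1 e2.
    have e : strand_x tau i u = strand_x tau j u by move: e1; lra.
    have [inv rho01] := strand_x_cross ij e.
    have lu := lam_rho rho01.
    have pl1 : 0 < plateau 2 1 u :> R by rewrite plateau_rho//; lra.
    have pl2 : plateau (-1) (-2) u < 0 :> R by rewrite plateau_rho//; lra.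
    have kz1 : kink_z string1 u = plateau 2 1 u by rewrite /kink_z eqxx.
    have kz0 : kink_z ord0 u = plateau (-1) (-2) u by rewrite /kink_z.
    rewrite /strand_z lu !mul1r in e2.
    (* Strings 0 and 1 form the only inverted pair, and [h01] places string 1 above, in agreement
       with [kink_z]. *)
    case: inv => -[lij tij]; have [? ?] := tperm_inversion lij tij; subst i j;
      rewrite kz1 kz0 in e2; apply: (convex_comb_neq0 r01) e2; [left|right]; split; lra.
  - move=> p [sp|/arcs_region[?|tT|?]].
    + by have := slots_time sp; rewrite size_map add0n => /andP[_ ?]; constructor 1.
    + by constructor 1; lra.
    + by rewrite -natr1 in tT; constructor 2.
    + by constructor 3.
have Useg := plateau_segs (1 : R) 0 T%:R 2 1.
have Vseg := plateau_segs (0 : R) 1 T%:R (-1) (-2).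
have Uslab u : strand_x tau string1 u = 1 + rho u * (0 - 1).
  by rewrite /strand_x tau1 string1E.
have Vslab u : strand_x tau ord0 u = 0 + rho u * (1 - 0).
  by rewrite /strand_x tau0 string1E.
have T0 : 0 < T%:R :> R by rewrite ltr0n.
have lineE := seg_vert (0 : R) 0 _ T0.
rewrite (_ : A `|` _ = stab_rest `|` polyline (kink_start T%:R) (flat_knots T%:R)); first exact: ambient_isotopic_refl.
rewrite /A slots_lift// add0n /=.
apply/seteqP; split => p.
- case=> [[[sp|lp]|[j jn]]|[i [u [u01 ->]]]].
  + by left; left; left.
  + by right; do 8!right; left; apply/lineE; case: lp.
  + case: j jn => [_|j jn]; last by left; right; exists j.+1.
    rewrite arc0E => -[[[[?|?]|?]|?]|?]; right; do 3!right.
    * by left. * by right; left. * by do 2!right; left. * by do 3!right; left. * by do 4!right; left.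
  + case: (eqVneq i string1) => [->|i1].
      rewrite /kink_z eqxx Uslab; right.
      have : [set p | exists2 u, 0 <= u <= 1 & p = pt (1 + rho u * (0 - 1)) (T%:R + u) (plateau 2 1 u)]
         (pt (1 + rho u * (0 - 1)) (T%:R + u) (plateau 2 1 u)) by exists u.
      rewrite Useg => -[[?|?]|?]; [by left|by right; left|by do 2!right; left].
    case: (eqVneq i ord0) => [->|i0].
      rewrite /kink_z /= Vslab; right.
      have : [set p | exists2 u, 0 <= u <= 1 & p = pt (0 + rho u * (1 - 0)) (T%:R + u) (plateau (-1) (-2) u)]
         (pt (0 + rho u * (1 - 0)) (T%:R + u) (plateau (-1) (-2) u)) by exists u.
      rewrite Vseg => -[[?|?]|?]; do 9!right; [by left|by right; left|by do 2!right; left].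
    left; left; right; rewrite /= /kink_z (negbTE i1) (negbTE i0) xc_pt tc_pt zc_pt; split=> //.
    exists i; rewrite /strand_x tpermD 1?eq_sym// subrr mulr0 addr0; split=> //.
      by rewrite ltn_ord andbT; move: i0 i1; rewrite -!val_eqE /= -[bump 0 0]/1%N; lia.
    by have /andP[? ?] := u01; apply/andP; split; lra.
- have inU q : (seg (pt 1 T%:R 0) (pt 1 (T%:R + 4^-1) 2) `|`
     seg (pt 1 (T%:R + 4^-1) 2) (pt 0 (T%:R + 3 / 4) 1) `|` seg (pt 0 (T%:R + 3 / 4) 1) (pt 0 (T%:R + 1) 0)) q ->
     slab T%:R (strand_x tau) kink_z q.
    by rewrite -Useg => -[u u01 ->]; exists string1, u; rewrite Uslab /kink_z eqxx.
  have inV q : (seg (pt 0 T%:R 0) (pt 0 (T%:R + 4^-1) (-1)) `|`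
     seg (pt 0 (T%:R + 4^-1) (-1)) (pt 1 (T%:R + 3 / 4) (-2)) `|` seg (pt 1 (T%:R + 3 / 4) (-2)) (pt 1 (T%:R + 1) 0)) q ->
     slab T%:R (strand_x tau) kink_z q.
    by rewrite -Vseg => -[u u01 ->]; exists ord0, u; rewrite Vslab.
  have in0 q : closure_arc R T.+1 n.+2 0 q -> @arcs R n.+2 T.+1 q by move=> ?; exists 0%N.
  rewrite arc0E in in0.
  case=> [[[sp|[z0 [j [/andP[j2 jn] xj tt]]]]|[j /andP[j1 jn] jp]]|].
  + by left; left; left.
  + right; exists (Ordinal jn), (tc p - T%:R); split; first by move: tt => /andP[? ?]; apply/andP; split; lra.
    have j1 : Ordinal jn != string1 by apply/eqP => /(congr1 (@nat_of_ord _)); rewrite string1E /=; lia.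
    have j0 : Ordinal jn != ord0 by rewrite -val_eqE /=; lia.
    rewrite /kink_z (negbTE j1) (negbTE j0) /strand_x tpermD 1?eq_sym// subrr mulr0 addr0.
    by rewrite [LHS]pt_eta xj z0; congr (pt _ _ _); ring.
  + by left; right; exists j.
  + case=> [?|[?|[?|[?|[?|[?|[?|[?|[?|[?|[?|[?|->]]]]]]]]]]]].
    * by right; apply: inU; left; left.
    * by right; apply: inU; left; right.
    * by right; apply: inU; right.
    * by left; right; apply: in0; do 4!left.
    * by left; right; apply: in0; do 3!left; right.
    * by left; right; apply: in0; do 2!left; right.
    * by left; right; apply: in0; left; right.
    * by left; right; apply: in0; right.
    * by left; left; right; apply/lineE.
    * by right; apply: inV; left; left.
    * by right; apply: inV; left; right.
    * by right; apply: inV; right.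
    * by right; apply: inV; right; exact: seg_endr.
Qed.

Lemma lift_stab_rest : lift_loop T%:R @` stab_rest = stab_rest.
Proof.
have id p : stab_rest p -> lift_loop T%:R p = p.
  move=> /stab_rest_off offp; rewrite /lift_loop.
  have -> : loop_height T%:R (xc p) (tc p) = 0.
    case: offp => [[? _]|?|?|?]; [exact: loop_height_ge1|exact: loop_height_leN2|
      exact: loop_height_high|exact: loop_height_low].
  by rewrite addr0 -pt_eta.
by apply/seteqP; split=> [_ [p Bp <-]|p Bp]; [rewrite id|exists p => //; rewrite id].
Qed.

(* Markov's stabilization, with the additional string innermost: the disc bounded by its closing arc
   misses the rest of the link. *)
Theorem stabilization h : h ord0 < h string1 ->
  ambient_isotopic (word_closure w)
    (word_closure (map (lift_letter 0) w ++ [:: (tperm ord0 string1, h)])).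
Proof.
move=> h01; apply: ambient_isotopic_trans spread_closure _.
apply: ambient_isotopic_sym; apply: ambient_isotopic_trans (flatten_kink h01) _.
have [L HL] := loop_height_lipschitz (T%:R : R).
apply: ambient_isotopic_trans (shear_isotopic _ HL) _.
rewrite -[X in X @` _]/(lift_loop T%:R) image_setU lift_stab_rest lift_flat_knots//.
by apply: kink_removal => // q; exact: stab_rest_off.
Qed.
End Word.
End Stabilization.

(** * The group generated by reversals *)

Ltac decide_ifs := repeat match goal with |- context [if ?b then _ else _] =>
  first [rewrite (_ : b = true); [|lia] | rewrite (_ : b = false); [|lia]] end.

Section ReversalGroup.
Variables (s n : nat).
Local Notation S := s.+1.
Local Open Scope group_scope.

Definition rev_gens : {set {perm 'I_S}} := [set rev_perm S (j : 'I_S) n | j : 'I_S & (j + n <= S)%N].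
Local Notation G := <<rev_gens>>.

Lemma rev_gensP (j : nat) : (0 < n)%N -> (j + n <= S)%N -> rev_perm S j n \in G.
Proof.
move=> n0 jn; have jS : (j < S)%N by apply: leq_trans jn; rewrite -addn1 leq_add2l.
by apply: mem_gen; apply/imsetP; exists (Ordinal jS); rewrite ?inE.
Qed.

Lemma perm_val_inj (p q : {perm 'I_S}) : (forall i, p i = q i :> nat) -> p = q.
Proof. by move=> e; apply/permP => i; apply: ord_inj. Qed.

Definition adj (a : nat) : {perm 'I_S} := tperm (inord a) (inord a.+1).

Lemma adjE a i : (a.+1 < S)%N -> adj a i =
  (if i == a :> nat then a.+1 else if i == a.+1 :> nat then a else i)%N :> nat.
Proof.
move=> aS; have aS' := ltnW aS; rewrite /adj.
case: tpermP => [->|->|/eqP i0 /eqP i1]; rewrite ?inordK ?eqxx//.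
  by rewrite gtn_eqF.
have -> : (i == a :> nat) = false by apply: contraNF i0 => /eqP e; apply/eqP/ord_inj; rewrite inordK.
by have -> : (i == a.+1 :> nat) = false by apply: contraNF i1 => /eqP e; apply/eqP/ord_inj; rewrite inordK.
Qed.

(** Two reversals with windows one apart compose to the rotation by 2 of [n + 1] positions. As
    [n + 1] is odd, a power of it is the rotation by 1: the exponent [n/2 + 1] gives [n + 2], which
    is 1 modulo [n + 1]. *)
Lemma rotation_in (j : nat) : ~~ odd n -> (0 < n)%N -> (j + n < S)%N -> exists2 rho : {perm 'I_S}, rho \in G &
  forall i, rho i = (if j <= i < j + n then i.+1 else if i == j + n :> nat then j else i)%N :> nat.
Proof.
move=> nodd n0 jn; pose c := rev_perm S j n * rev_perm S j.+1 n.
have cG : c \in G by rewrite groupM// rev_gensP//; lia.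
have cE i : c i = (if j <= i <= j + n then j + (i - j + 2) %% n.+1 else i)%N :> nat.
  rewrite permM !rev_permE; try lia.
  case: (boolP (j <= i <= j + n)%N) => [/andP[ji ijn]|]; last by do ?case: ifP; lia.
  have [d1|d1] := leqP (i - j + 2) n.
    by rewrite modn_small; do ?case: ifP; lia.
  have [d2|d2] := eqVneq (i - j + 2)%N n.+1; first by rewrite d2 modnn; do ?case: ifP; lia.
  have -> : (i - j + 2)%N = (1 + n.+1)%N by lia.
  by rewrite modnDr modn_small; do ?case: ifP; lia.
have ckE k i : (c ^+ k) i = (if j <= i <= j + n then j + (i - j + k.*2) %% n.+1 else i)%N :> nat.
  elim: k i => [|k IH] i.
    rewrite expg0 perm1; case: ifP => // h; rewrite addn0 modn_small; lia.
  rewrite expgSr permM cE IH; case: (boolP (j <= i <= j + n)%N) => [h|]; last by case: ifP => //; lia.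
  have h2 : ((i - j + k.*2) %% n.+1 < n.+1)%N by rewrite ltn_mod.
  rewrite ifT; last by lia.
  by rewrite addKn modnDml doubleS; congr (_ + _ %% _)%N; lia.
exists (c ^+ (n./2).+1); first by rewrite groupX.
move=> i; rewrite ckE doubleS.
have nE : (n./2).*2 = n by have := odd_double_half n; rewrite (negbTE nodd).
rewrite nE; case: (boolP (j <= i <= j + n)%N) => [h|]; last by do ?case: ifP; lia.
have -> : (i - j + n.+2)%N = (i - j + 1 + n.+1)%N by lia.
rewrite modnDr; have [d|d] := eqVneq (i : nat) (j + n)%N.
  by rewrite (_ : (i - j + 1)%N = n.+1) ?modnn; do ?case: ifP; lia.
by rewrite modn_small; do ?case: ifP; lia.
Qed.

Hypotheses (neven : ~~ odd n) (n2 : (2 <= n)%N) (nS : (2 * n <= S)%N).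

(* The rotations of two overlapping windows of odd length n + 1 differ by a 3-cycle; at the left end of
   the row it is found with the windows starting at a and a + 1, at the right end with those ending
   at a + 1 and a + 2. *)
Lemma adj_adj_in a : (a.+2 < S)%N -> adj a * adj a.+1 \in G.
Proof.
move=> aS; have n0 : (0 < n)%N by lia.
have [al|ar] := leqP (a + n.+2) S.
  have [r1 r1G r1E] := @rotation_in a neven n0 ltac:(lia).
  have [r2 r2G r2E] := @rotation_in a.+1 neven n0 ltac:(lia).
  have e : r1 * r2 * (adj a.+1 * adj a) = r2 * r2.
    apply: perm_val_inj => i; rewrite !permM !adjE ?r2E ?r1E; try lia.
    have [?|[?|[?|[?|?]]]] : (i < a \/ i = a :> nat \/ a < i < a + n \/ i = a + n :> nat \/ a + n < i)%N by lia.
    - by decide_ifs.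
    - by decide_ifs.
    - by decide_ifs.
    - by decide_ifs; lia.
    - by case: (eqVneq (i : nat) (a + n).+1) => [?|?]; decide_ifs.
  have <- : (adj a.+1 * adj a)^-1 = adj a * adj a.+1 by rewrite invMg /adj !tpermV.
  rewrite groupV (_ : _ * _ = (r1 * r2)^-1 * (r2 * r2)); last by rewrite -e mulKg.
  by rewrite groupM ?groupV ?groupM.
have [j jE] : exists j, a = (j + n.-1)%N by exists (a - n.-1)%N; lia.
have [r1 r1G r1E] := @rotation_in j neven n0 ltac:(lia).
have [r2 r2G r2E] := @rotation_in j.+1 neven n0 ltac:(lia).
have e : adj a * adj a.+1 * (r1 * r1) = r1 * r2.
  apply: perm_val_inj => i; rewrite !permM ?r2E ?r1E !adjE; try lia.
  have [?|[?|[?|[?|?]]]] : (i < j \/ i = a :> nat \/ j <= i < a \/ i = a.+1 :> nat \/ a.+1 < i)%N by lia.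
  - by decide_ifs.
  - by decide_ifs; lia.
  - by decide_ifs.
  - by decide_ifs; lia.
  - by case: (eqVneq (i : nat) a.+2) => [?|?]; decide_ifs; lia.
rewrite (_ : _ * _ = (r1 * r2) * (r1 * r1)^-1); last by rewrite -e mulgK.
by rewrite groupM ?groupV ?groupM.
Qed.

(** [adj 0] acts as a fixed odd companion: once its product with every transposition lies in the
    group, even products of transpositions do too. For adjacent transpositions the products of
    neighbours telescope. *)
Lemma adj0_adj_in a : (a.+1 < S)%N -> adj 0 * adj a \in G.
Proof.
elim: a => [|a IH] aS; first by rewrite /adj tperm2 group1.
rewrite (_ : adj 0 * adj a.+1 = (adj 0 * adj a) * (adj a * adj a.+1)).
  by rewrite groupM ?adj_adj_in ?IH// ltnW.
by rewrite -!mulgA; congr (_ * _); rewrite mulgA {1 2}/adj tperm2 mul1g.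
Qed.

Lemma adj0_tperm_in (x y : 'I_S) : x != y -> adj 0 * tperm x y \in G.
Proof.
wlog xy : x y / (x < y)%N.
  move=> W ne; have [|/W|e] := ltngtP x y; [by move/W; apply|by rewrite tpermC; apply; rewrite eq_sym|].
  by rewrite (ord_inj e) eqxx in ne.
move=> _; have [d dE] : exists d, (y = x + d.+1 :> nat)%N by exists (y - x).-1; lia.
elim: d x y xy dE => [|d IH] x y xy dE.
  have xS : (x.+1 < S)%N by have := ltn_ord y; lia.
  rewrite (_ : tperm x y = adj x) ?adj0_adj_in// /adj; congr tperm; apply: ord_inj; rewrite inordK//; lia.
have yS := ltn_ord y; have y1S : (y.-1 < S)%N by lia.
pose z : 'I_S := Ordinal y1S; have xz : (x < z)%N by rewrite /=; lia.
have zy : adj z = tperm z y.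
  by rewrite /adj; congr tperm; apply: ord_inj; rewrite inordK//=; lia.
have -> : tperm x y = adj z * tperm x z * adj z.
  rewrite zy -mulgA -{1}(tpermV z y) -conjgE tpermJ tpermL tpermD//.
    by rewrite eq_sym -val_eqE /= ltn_eqF.
  by rewrite -val_eqE /= gtn_eqF//; lia.
have h1 : adj 0 * adj z \in G by apply: adj0_adj_in => /=; lia.
have h2 : adj 0 * tperm x z \in G by apply: IH => //=; lia.
(* The inverse of [adj 0 * tperm x z] is [tperm x z * adj 0], and its [adj 0] cancels the next
   one. *)
have -> : adj 0 * (adj z * tperm x z * adj z) = (adj 0 * adj z) * (adj 0 * tperm x z)^-1 * (adj 0 * adj z).
  rewrite invMg /adj !tpermV -!mulgA; do 3![congr (_ * _)].
  by rewrite [in RHS]mulgA tperm2 mul1g.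
by rewrite groupM// groupM// groupV.
Qed.

Lemma even_perm_in (p : {perm 'I_S}) : ~~ odd_perm p -> p \in G.
Proof.
case: (prod_tpermP p) => ts -> dts; rewrite odd_perm_prod//.
(* The induction over the factors passes through odd products, which are corrected by [adj 0]. *)
suff H : if odd (size ts) then adj 0 * \prod_(t <- ts) tperm t.1 t.2 \in G
         else \prod_(t <- ts) tperm t.1 t.2 \in G.
  by move=> /negbTE e; rewrite e in H.
elim: ts dts => [|t ts IH] /=; first by rewrite big_nil group1.
move=> /andP[dt /IH]; rewrite big_cons if_neg; case: ifP => _ h.
  rewrite (_ : _ * _ = (adj 0 * tperm t.1 t.2)^-1 * (adj 0 * \prod_(t0 <- ts) tperm t0.1 t0.2)).
    by rewrite groupM// groupV; exact: adj0_tperm_in.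
  by rewrite invMg -!mulgA (mulgA (_^-1) (adj 0)) mulVg mul1g tpermV.
by rewrite mulgA groupM//; exact: adj0_tperm_in.
Qed.

End ReversalGroup.

(** * Parity of a reversal *)

Section ReversalParity.
Variable s : nat.
Local Open Scope group_scope.

(** A reversal is the reversal of its interior followed by the exchange of its two ends, so it
    counts one transposition for every two positions. *)
Lemma odd_rev_perm j m : (j + m <= s)%N -> odd_perm (rev_perm s j m) = odd m./2.
Proof.
elim/ltn_ind: m j => -[|[|m]] IH j jm.
- rewrite (_ : rev_perm s j 0 = 1) ?odd_perm1//; apply/permP => i; apply: ord_inj.
  by rewrite perm1 rev_permE//; case: ifP => //; lia.
- rewrite (_ : rev_perm s j 1 = 1) ?odd_perm1//; apply/permP => i; apply: ord_inj.
  by rewrite perm1 rev_permE//; case: ifP => //; lia.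
have jS : (j < s)%N by lia.
have kS : (j + m.+1 < s)%N by lia.
have -> : rev_perm s j m.+2 = rev_perm s j.+1 m * tperm (Ordinal jS) (Ordinal kS).
  apply/permP => i; apply: ord_inj; rewrite permM rev_permE//.
  case: tpermP => [e|e|/eqP + /eqP].
  - by have := congr1 (@nat_of_ord _) e; rewrite /= rev_permE; do ?case: ifP; lia.
  - by have := congr1 (@nat_of_ord _) e; rewrite /= rev_permE; do ?case: ifP; lia.
  - by rewrite -!val_eqE /= rev_permE; do ?case: ifP; lia.
rewrite odd_permM odd_tperm IH; try lia.
by rewrite -val_eqE /=; lia.
Qed.
End ReversalParity.

(** * Realization by n-crossings *)

Section Crossings.
Variable R : realType.

Section Width.
Variable s : nat.
Implicit Types (w : seq (letter R s)).

Local Notation isotopic w w' := (ambient_isotopic (word_closure w) (word_closure w')).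

(** With [idle] equal to 0 this reproduces [strand_piece] exactly; other choices serve to make the
    heights injective. *)
Definition crossing_letter (idle : nat -> R) n (c : ncrossing n) : letter R s :=
  (rev_perm s c.1 n, fun i : 'I_s => if (c.1 <= i < c.1 + n)%N then cross_height R n c (i - c.1) else idle i).

Lemma slot_crossing n (c : ncrossing n) k : (c.1 + n <= s)%N ->
  \bigcup_(p in [set p : nat | (p < s)%N]) strand_piece R n c k p =
  slot k (crossing_letter (fun=> 0) c).
Proof.
move=> cs; have xE (i : 'I_s) u : strand_x (rev_perm s c.1 n) i u = (i%:R : R) + rho u *
    ((if (c.1 <= i < c.1 + n)%N then c.1 + (n - 1 - (i - c.1)) else i)%N%:R - i%:R).
  by rewrite /strand_x rev_permE.
apply/seteqP; split => p.
- move=> [j js]; rewrite /strand_piece; case: ifP => jc.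
    rewrite -plateau_segs => -[u u01 ->]; exists (Ordinal js), u; split=> //.
    by rewrite xE /= jc /strand_z /= jc plateau_lam.
  rewrite -straight_seg => -[u u01 ->]; exists (Ordinal js), u; split=> //.
  by rewrite xE /= jc /strand_z /= jc subrr !mulr0 addr0.
- move=> [i [u [u01 ->]]]; exists i => //=; rewrite /strand_piece xE /strand_z /=; case: ifP => jc.
    by rewrite -plateau_segs; exists u; rewrite ?plateau_lam.
  by rewrite -straight_seg; exists u; rewrite // subrr !mulr0 addr0.
Qed.

Lemma braid_closureE n (w : seq (ncrossing n)) : all (fun c => c.1 + n <= s)%N w ->
  braid_closure n s w = word_closure (map (crossing_letter (fun=> 0) (n:=n)) w) :> set (R3pt R).
Proof.
move=> ws; rewrite /braid_closure /word_closure size_map; congr (_ `|` _).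
pose d : letter R s := crossing_letter (fun=> 0) ((0%N, 1%g) : ncrossing n).
apply/seteqP; split => p.
- move=> [k kw kp]; apply/(slotsP _ _ _ d); exists k; rewrite ?size_map// add0n (nth_map (0%N, 1%g))//.
  by rewrite -slot_crossing//; move/all_nthP: ws; apply.
- move/(slotsP _ _ _ d) => [k]; rewrite size_map => kw; rewrite add0n (nth_map (0%N, 1%g))//.
  by rewrite -slot_crossing; [exists k|move/all_nthP: ws; apply].
Qed.

(** [rk a] counts the strings above [a]. The highest one gets 0, which is level 1, so levels run
    opposite to heights. *)
Lemma rank_perm n (g : 'I_n -> R) : injective g ->
  exists sg : {perm 'I_n}, forall a b, g a < g b -> (sg b < sg a)%N.
Proof.
move=> ginj; pose rk a := #|[pred b | g a < g b]|.
have rk_lt a : (rk a < n)%N.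
  rewrite -[X in (_ < X)%N]card_ord; apply: proper_card; apply/properP; split; first exact: subset_predT.
  by exists a => //; rewrite inE ltxx.
have rk_decr a b : g a < g b -> (rk b < rk a)%N.
  move=> ab; apply: proper_card; apply/properP; split.
    by apply/fintype.subsetP => c; rewrite !inE; exact: lt_trans.
  by exists b; rewrite !inE// ltxx.
have finj : injective (fun a => Ordinal (rk_lt a)).
  move=> a b /(congr1 (@nat_of_ord _)) /= e; apply: ginj; apply/eqP.
  by case: ltgtP => // /rk_decr; rewrite e ltnn.
by exists (perm finj) => a b /rk_decr; rewrite !permE.
Qed.

Lemma rev_inversion j n (i i' : 'I_s) : (j + n <= s)%N -> (i < i')%N ->
  (rev_perm s j n i' < rev_perm s j n i)%N -> (j <= i < j + n)%N /\ (j <= i' < j + n)%N.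
Proof. by move=> jn ii'; rewrite !rev_permE//; do 2![case: ifP]; lia. Qed.

Lemma cross_heightE n (c : ncrossing n) (a : 'I_n) : cross_height R n c a = (n - c.2 a)%:R.
Proof. by rewrite /cross_height valK. Qed.

(** Inversions occur only inside the window, so it is enough to rank the heights of its [n]
    strings. *)
Lemma crossing_of_heights j n (h : 'I_s -> R) : (j + n <= s)%N -> injective h ->
  exists sg : {perm 'I_n}, same_order_on_inversions (rev_perm s j n) h
    (crossing_letter (fun=> 0) (j, sg)).2.
Proof.
move=> jn hinj.
have jb (a : 'I_n) : (j + a < s)%N by apply: leq_trans jn; rewrite ltn_add2l.
have [|sg sgP] := @rank_perm n (fun a => h (Ordinal (jb a))).
  by move=> a b /hinj /(congr1 (@nat_of_ord _)) /= /addnI /ord_inj.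
exists sg => i i' ii' /(rev_inversion jn ii')[iw iw'] /=; rewrite iw iw'.
have ilt : (i - j < n)%N by lia.
have ilt' : (i' - j < n)%N by lia.
have hE (k : 'I_s) (kl : (k - j < n)%N) : (j <= k)%N -> h k = h (Ordinal (jb (Ordinal kl))).
  by move=> jk; congr h; apply: ord_inj => /=; rewrite subnKC.
have cE (k : nat) (kl : (k - j < n)%N) : cross_height R n (j, sg) (k - j) = (n - sg (Ordinal kl))%:R.
  exact: (cross_heightE (j, sg) (Ordinal kl)).
rewrite (cE _ ilt) (cE _ ilt') !ltr_nat.
have : h i != h i' by rewrite (inj_eq hinj) -val_eqE /= ltn_eqF.
rewrite (hE _ ilt) ?(hE _ ilt'); [|lia..].
have l1 := ltn_ord (sg (Ordinal ilt)); have l2 := ltn_ord (sg (Ordinal ilt')).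
case: ltgtP => // hh _; have := sgP _ _ hh; [left|right]; split=> //; lia.
Qed.

(** Strings in the crossing have nonnegative heights; negative ones that depend on the position make
    all heights of the letter distinct. *)
Definition negative_idle (i : nat) : R := - i.+1%:R.

Lemma crossing_letter_inj n (c : ncrossing n) : (c.1 + n <= s)%N ->
  injective (crossing_letter negative_idle c).2.
Proof.
move=> cs i i' /=; have chE (k : nat) : (c.1 <= k < c.1 + n)%N ->
    exists2 a : 'I_n, k = (c.1 + a)%N & cross_height R n c (k - c.1) = (n - c.2 a)%:R.
  move=> kc; have kl : (k - c.1 < n)%N by lia.
  by exists (Ordinal kl); [rewrite /=; lia|exact: (cross_heightE c (Ordinal kl))].
rewrite /negative_idle; case: ifP => [/chE[a ia ->]|_]; case: ifP => [/chE[b ib ->]|_].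
- move/eqP; rewrite eqr_nat => /eqP e; apply: ord_inj; rewrite ia ib; congr (_ + _)%N.
  have := ltn_ord (c.2 a); have := ltn_ord (c.2 b) => l1 l2.
  have : c.2 a = c.2 b by apply: ord_inj; lia.
  by move/perm_inj => ->.
- by move=> e; exfalso; have := ler0n R (n - c.2 a); have := ltr0Sn R i'; lra.
- by move=> e; exfalso; have := ler0n R (n - c.2 b); have := ltr0Sn R i; lra.
- by move/oppr_inj/eqP; rewrite eqr_nat eqSS => /eqP/ord_inj.
Qed.

(** An idle string is in no inversion, so its height does not enter the comparison. *)
Lemma crossing_letter_idle n (c : ncrossing n) (f g : nat -> R) : (c.1 + n <= s)%N ->
  same_order_on_inversions (rev_perm s c.1 n) (crossing_letter f c).2 (crossing_letter g c).2.
Proof.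
move=> cs i i' ii' /(rev_inversion cs ii')[iw iw'] /=; rewrite iw iw'.
have ilt : (i - c.1 < n)%N by lia.
have ilt' : (i' - c.1 < n)%N by lia.
have cE (k : nat) (kl : (k - c.1 < n)%N) : cross_height R n c (k - c.1) = (n - c.2 (Ordinal kl))%:R.
  exact: (cross_heightE c (Ordinal kl)).
rewrite (cE _ ilt) (cE _ ilt') !ltr_nat.
have := ltn_ord (c.2 (Ordinal ilt)); have := ltn_ord (c.2 (Ordinal ilt')) => l1 l2.
have ne : c.2 (Ordinal ilt) != c.2 (Ordinal ilt').
  by rewrite (inj_eq perm_inj) -val_eqE /=; lia.
by move: ne; rewrite -val_eqE /= => ne; lia.
Qed.

(** Valued in [Prop], since injectivity of heights is not a boolean predicate. *)
Fixpoint all_letters (P : letter R s -> Prop) w : Prop :=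
  if w is l :: w' then P l /\ all_letters P w' else True.

Lemma injective_heights n (v : seq (ncrossing n)) w1 : all (fun c => c.1 + n <= s)%N v ->
  isotopic (w1 ++ map (crossing_letter (fun=> 0) (n:=n)) v)
           (w1 ++ map (crossing_letter negative_idle (n:=n)) v).
Proof.
elim: v w1 => [|c v IH] w1 /=; first by move=> _; exact: ambient_isotopic_refl.
move=> /andP[cs vs]; apply: ambient_isotopic_trans.
  exact: (change_heights _ _ (crossing_letter_idle _ negative_idle cs)).
by rewrite -!cat_rcons; exact: IH.
Qed.

Lemma inv_heights_inj (pi : {perm 'I_s}) (h : 'I_s -> R) : injective h -> injective (inv_heights pi h).
Proof. by move=> hinj i j /hinj /perm_inj. Qed.
End Width.

(** * Factoring letters and correcting their parity *)

Section PositiveWidth.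
Variables (s n : nat).
Local Notation S := s.+1.
Implicit Types (w : seq (letter R S)).
Local Notation isotopic w w' := (ambient_isotopic (word_closure w) (word_closure w')).
Local Notation crossings := (map (crossing_letter S (fun=> 0) (n:=n))).

Lemma realize_letter (p : {perm 'I_S}) (h : 'I_S -> R) : (0 < n)%N -> (n <= S)%N ->
  p \in <<rev_gens s n>>%g -> injective h ->
  exists2 v : seq (ncrossing n), all (fun c => c.1 + n <= S)%N v &
    forall w1 w2, isotopic (w1 ++ (p, h) :: w2) (w1 ++ crossings v ++ w2).
Proof.
move=> n0 nS pG hinj.
have [ps psE psG] : exists2 ps : seq {perm 'I_S}, (p = \prod_(q <- ps) q)%g &
    ps <> [::] /\ all (fun q => q \in rev_gens s n) ps.
  have /gen_prodgP[m [c cG ->]] := pG; case: m c cG => [|m] c cG.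
    (* The identity is written as the square of a reversal: merging starts from at least one letter,
       so the empty product has to be avoided. *)
    exists [:: rev_perm S 0 n; rev_perm S 0 n].
      rewrite big_ord0 !big_cons big_nil mulg1; apply/permP => i; apply: ord_inj.
      by rewrite permM perm1 !rev_permE//; do ?case: ifP; lia.
    have r0 : rev_perm S 0 n \in rev_gens s n by apply/imsetP; exists ord0; rewrite ?inE.
    by split=> //=; rewrite r0.
  exists (map c (index_enum 'I_m.+1)); first by rewrite big_map.
  split; first by have := mem_index_enum (ord0 : 'I_m.+1); case: (index_enum _).
  by apply/allP => q /mapP[i _ ->]; exact: cG.
case: psG => psn psG; elim: ps p h psE psn psG hinj {pG} => [//|q ps IH] p h psE _ /= /andP[qG psG] hinj.
have [j jn qE] : exists2 j : nat, (j + n <= S)%N & q = rev_perm S j n.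
  by case/imsetP: qG => j; rewrite inE => jn ->; exists j.
have [sg sgP] := crossing_of_heights jn hinj.
have one w1 w2 : isotopic (w1 ++ (q, h) :: w2) (w1 ++ crossing_letter S (fun=> 0) (j, sg) :: w2).
  by rewrite qE; exact: change_heights.
case: ps IH psE psG => [_ pE _|q' ps IH pE psG].
  exists [:: (j, sg)]; first by rewrite /= jn.
  by move=> w1 w2; rewrite pE big_seq1.
have [v vs vP] := IH (\prod_(q0 <- q' :: ps) q0)%g (inv_heights q h) erefl ltac:(by []) psG (inv_heights_inj hinj).
exists ((j, sg) :: v); first by rewrite /= jn.
move=> w1 w2; rewrite pE big_cons.
apply: ambient_isotopic_trans (ambient_isotopic_sym (merge_letters _ _ _ _ hinj)) _.
apply: ambient_isotopic_trans (one _ _) _.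
by rewrite /= -cat_rcons -[in X in ambient_isotopic _ X]cat_rcons; exact: vP.
Qed.

Lemma realize_word w : (0 < n)%N -> (n <= S)%N ->
  all_letters (fun l => l.1 \in <<rev_gens s n>>%g /\ injective l.2) w ->
  exists2 v : seq (ncrossing n), all (fun c => c.1 + n <= S)%N v &
    isotopic w (crossings v).
Proof.
move=> n0 nS; suff H w1 : all_letters (fun l => l.1 \in <<rev_gens s n>>%g /\ injective l.2) w ->
  exists2 v : seq (ncrossing n), all (fun c => c.1 + n <= S)%N v &
    isotopic (w1 ++ w) (w1 ++ crossings v) by exact: (H [::]).
elim: w w1 => [|[p h] w IH] w1 /=; first by exists [::] => //; exact: ambient_isotopic_refl.
move=> [[pG hinj] /IH{}IH]; have [v vs vP] := realize_letter n0 nS pG hinj.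
have [v' vs' vP'] := IH (w1 ++ crossings v).
exists (v ++ v'); first by rewrite all_cat vs.
apply: ambient_isotopic_trans (vP _ _) _; rewrite map_cat !catA.
exact: vP'.
Qed.

Lemma adj_inversion a (i j : 'I_S) : (a.+1 < S)%N -> (i < j)%N -> (adj s a j < adj s a i)%N ->
  i = a :> nat /\ j = a.+1 :> nat.
Proof. by move=> aS ij; rewrite !adjE//; do ?[case: eqP]; lia. Qed.

(* Two odd letters p1, p2 are replaced by the even letters p1 a, a b and b p2. *)
Lemma even_word w : (4 <= S)%N -> all_letters (fun l => injective l.2) w ->
  ~~ odd (count (fun l : letter R S => odd_perm l.1) w) ->
  exists2 w', all_letters (fun l => ~~ odd_perm l.1 /\ injective l.2) w' &
    forall w1, isotopic (w1 ++ w) (w1 ++ w').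
Proof.
move=> S4; have [k] := ubnP (size w); elim: k w => [//|k IH] [|[p1 h1] w] /=.
  by move=> _ _ _; exists [::] => // w1; exact: ambient_isotopic_refl.
rewrite ltnS => wk [h1inj winj]; case: (boolP (odd_perm p1)) => [odd1|even1]; last first.
  rewrite add0n => /(IH _ wk winj)[w' w'P w'E]; exists ((p1, h1) :: w') => // w1.
  by rewrite -!cat_rcons; exact: w'E.
case: w wk winj => [//|[p2 h2] w] /= wk [h2inj winj]; rewrite negbK => par.
pose a := adj s 0; pose b := adj s 2.
have oa : odd_perm a by rewrite odd_tperm -val_eqE /= !inordK//; lia.
have ob : odd_perm b by rewrite odd_tperm -val_eqE /= !inordK//; lia.
have aa : (a * a)%g = 1%g by rewrite /a /adj tperm2.
have bb : (b * b)%g = 1%g by rewrite /b /adj tperm2.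
pose o0 : 'I_S := inord 0; pose o1 : 'I_S := inord 1; pose o2 : 'I_S := inord 2; pose o3 : 'I_S := inord 3.
have e0 : o0 = 0%N :> nat by rewrite inordK. have e1 : o1 = 1%N :> nat by rewrite inordK//; lia.
have e2 : o2 = 2%N :> nat by rewrite inordK//; lia. have e3 : o3 = 3%N :> nat by rewrite inordK//; lia.
(* Heights of the strings after [p1 * a], that is, at the entry of the second [a] in
   [p1 = (p1 * a) * a]. *)
pose g1 := inv_heights (p1 * a)%g h1.
have g1inj : injective g1 by exact: inv_heights_inj.
(* The letter [a * b] needs heights that order positions 0, 1 as [g1] does and positions 2, 3 as
   [h2] does. The two demands are independent; starting from the position as height, each swap is
   made when required, and being a permutation [f] keeps the heights distinct. *)
pose f : {perm 'I_S} := ((if g1 o1 < g1 o0 then a else 1) * (if h2 o3 < h2 o2 then b else 1))%g.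
pose g (i : 'I_S) : R := (f i)%:R.
have ginj : injective g by move=> i j /eqP; rewrite eqr_nat => /eqP/ord_inj/perm_inj.
have aE (i : 'I_S) : a i = (if i == 0 :> nat then 1 else if i == 1 :> nat then 0 else i)%N :> nat.
  by rewrite adjE//; lia.
have bE (i : 'I_S) : b i = (if i == 2 :> nat then 3 else if i == 3 :> nat then 2 else i)%N :> nat.
  by rewrite adjE//; lia.
have so1 : same_order_on_inversions a g1 g.
  move=> i j ij inv; have [|i0 j1] := adj_inversion _ ij inv; first by lia.
  have -> : i = o0 by apply: ord_inj; lia.
  have -> : j = o1 by apply: ord_inj; lia.
  have : g1 o0 != g1 o1 by rewrite (inj_eq g1inj) -val_eqE /= e0 e1.
  rewrite /g /f !permM !ltr_nat; case: (ltgtP (g1 o1)) => // _ _; [right|left]; split=> //;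
    case: ifP => _; rewrite ?perm1 ?bE ?aE ?e0 ?e1//.
have so2 : same_order_on_inversions b h2 (inv_heights a g).
  move=> i j ij inv; have [|i0 j1] := adj_inversion _ ij inv; first by lia.
  have -> : i = o2 by apply: ord_inj; lia.
  have -> : j = o3 by apply: ord_inj; lia.
  have a2 : a^-1%g o2 = o2 by rewrite /a /adj tpermV; apply: ord_inj; rewrite -/(adj s 0) -/a aE e2.
  have a3 : a^-1%g o3 = o3 by rewrite /a /adj tpermV; apply: ord_inj; rewrite -/(adj s 0) -/a aE e3.
  have a2' : a o2 = o2 by apply: ord_inj; rewrite aE e2.
  have a3' : a o3 = o3 by apply: ord_inj; rewrite aE e3.
  have : h2 o2 != h2 o3 by rewrite (inj_eq h2inj) -val_eqE /= e2 e3.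
  rewrite /inv_heights a2 a3 /g /f !permM !ltr_nat.
  have -> : (if g1 o1 < g1 o0 then a else 1%g) o2 = o2 by case: ifP; rewrite ?perm1.
  have -> : (if g1 o1 < g1 o0 then a else 1%g) o3 = o3 by case: ifP; rewrite ?perm1.
  case: (ltgtP (h2 o3)) => // _ _; [right|left]; split=> //; rewrite ?perm1 ?bE ?e2 ?e3//.
(* [p2] may have either parity: [b * p2] returns to the head of a word that is one letter shorter,
   and the number of odd letters has dropped by 0 or 2. *)
have [|||w' w'P w'E] := IH ((b * p2, inv_heights b h2)%g :: w).
- by [].
- by split=> //=; exact: inv_heights_inj.
- by move: par; rewrite /= !oddD odd_permM ob; case: (odd_perm p2); case: (odd (count _ _)).
exists ((p1 * a, h1)%g :: (a * b, g)%g :: w') => [|w1].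
  by rewrite /= !odd_permM odd1 oa ob; do ?split.
have p1E : p1 = (p1 * a * a)%g by rewrite -mulgA aa mulg1.
have p2E : p2 = (b * (b * p2))%g by rewrite mulgA bb mul1g.
rewrite {1}p1E {1}p2E.
apply: ambient_isotopic_trans (ambient_isotopic_sym (merge_letters _ _ _ _ h1inj)) _.
rewrite -cat_rcons; apply: ambient_isotopic_trans (change_heights _ _ so1) _.
rewrite -cat_rcons; apply: ambient_isotopic_trans (ambient_isotopic_sym (merge_letters _ _ _ _ h2inj)) _.
apply: ambient_isotopic_trans (change_heights _ _ so2) _.
rewrite cat_rcons; apply: ambient_isotopic_trans (merge_letters _ _ _ _ ginj) _.
by rewrite -cat_rcons -[in X in ambient_isotopic _ X]cat_rcons -[in X in ambient_isotopic _ X]cat_rcons; exact: w'E.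
Qed.
End PositiveWidth.
End Crossings.

(** * Braid indices *)

Section Realizability.
Variable R : realType.
Implicit Types (L : set (R3pt R)).

Lemma all_letters_imp s (P Q : letter R s -> Prop) w :
  (forall l, P l -> Q l) -> all_letters P w -> all_letters Q w.
Proof. by move=> PQ; elim: w => //= l w IH [/PQ ? /IH]. Qed.

Lemma all_letters_map s s' (P : letter R s -> Prop) (Q : letter R s' -> Prop) f w :
  (forall l, P l -> Q (f l)) -> all_letters P w -> all_letters Q (map f w).
Proof. by move=> PQ; elim: w => //= l w IH [/PQ ? /IH]. Qed.

Lemma all_letters_cat s (P : letter R s -> Prop) w1 w2 :
  all_letters P w1 -> all_letters P w2 -> all_letters P (w1 ++ w2).
Proof. by elim: w1 => //= l w1 IH [? ?] ?; split=> //; exact: IH. Qed.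

(** The new string of a stabilization is put below all others; the sum of absolute values bounds
    every height at once. *)
Definition lowest_height s (h : 'I_s -> R) : R := - 1 - \sum_i `|h i|.

Lemma lowest_heightP s (h : 'I_s -> R) i : lowest_height h < h i.
Proof.
have : `|h i| <= \sum_j `|h j| by rewrite (bigD1 i)//= lerDl sumr_ge0.
by rewrite /lowest_height; have := ler_norm (- h i); rewrite normrN; lra.
Qed.

Lemma lift_letter_inj n (l : letter R n.+1) : injective l.2 ->
  injective (lift_letter (lowest_height l.2) l).2.
Proof.
move=> linj i j /=; case: (unliftP ord0 i) => [i'|] ->; case: (unliftP ord0 j) => [j'|] ->.
- by move=> /linj ->.
- by move=> e; have := lowest_heightP l.2 i'; rewrite e ltxx.
- by move=> e; have := lowest_heightP l.2 j'; rewrite -e ltxx.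
- by [].
Qed.

(** The string at position 0 stays leftmost and so is never inverted. This reconciles the height 0
    used by [stabilization] with the injective heights needed for merging. *)
Lemma lift_letter_heights n (l : letter R n.+1) c d : injective l.2 ->
  same_order_on_inversions (lift_letter c l).1 (lift_letter c l).2 (lift_letter d l).2.
Proof.
move=> linj i j ij; rewrite /=; case: (unliftP ord0 i) => [i'|] ei; case: (unliftP ord0 j) => [j'|] ej.
- move=> _; have : l.2 i' != l.2 j'.
    by rewrite (inj_eq linj); apply: contraTneq ij => e; rewrite ei ej e ltnn.
  by case: ltgtP => // ?; [left|right].
- by rewrite ej in ij.
- by rewrite ei lift_perm_id ltn0.
- by rewrite ei ej ltnn in ij.
Qed.

Lemma lift_word_heights n (w : seq (letter R n.+1)) w1 w2 : all_letters (fun l => injective l.2) w ->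
  ambient_isotopic (word_closure (w1 ++ map (lift_letter 0) w ++ w2))
    (word_closure (w1 ++ map (fun l => lift_letter (lowest_height l.2) l) w ++ w2)).
Proof.
elim: w w1 => [|l w IH] w1 /=; first by move=> _; exact: ambient_isotopic_refl.
move=> [linj winj].
have step := change_heights w1 (map (lift_letter 0) w ++ w2) (@lift_letter_heights n l 0 (lowest_height l.2) linj).
apply: ambient_isotopic_trans step _.
by have := IH (rcons w1 (lift_letter (lowest_height l.2) l)) winj; rewrite !cat_rcons.
Qed.

Lemma realizable_heights m s L : realizable m L s ->
  exists2 v : seq (ncrossing m), all (fun c => c.1 + m <= s)%N v &
    ambient_isotopic (word_closure (map (crossing_letter s (@negative_idle R) (n:=m)) v)) L.
Proof.
move=> [v [/andP[_ vs] vL]]; exists v => //; apply: ambient_isotopic_trans vL.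
by rewrite braid_closureE//; apply: ambient_isotopic_sym; exact: (injective_heights [::]).
Qed.

Lemma realizable_word n s L (w : seq (letter R s.+1)) : (2 <= n)%N -> (n <= s.+1)%N ->
  all_letters (fun l => l.1 \in <<rev_gens s n>>%g /\ injective l.2) w ->
  ambient_isotopic (word_closure w) L -> realizable n L s.+1.
Proof.
move=> n2 ns wG wL; have [v vs wv] := realize_word (ltnW n2) ns wG.
exists v; split; first by rewrite /nbraid n2.
rewrite braid_closureE//; apply: ambient_isotopic_trans wL.
exact: ambient_isotopic_sym.
Qed.

Lemma crossing_letters m s (v : seq (ncrossing m)) : all (fun c => c.1 + m <= s)%N v ->
  all_letters (fun l => odd_perm l.1 = odd m./2 /\ injective l.2)
    (map (crossing_letter s (@negative_idle R) (n:=m)) v).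
Proof.
elim: v => //= c v IH /andP[cs /IH ?]; split=> //; split; last exact: crossing_letter_inj.
by rewrite odd_rev_perm.
Qed.

Lemma realizable_of_even_crossings m n s L : ~~ odd n -> (2 <= n)%N -> (2 * n <= s)%N ->
  ~~ odd m./2 -> realizable m L s -> realizable n L s.
Proof.
case: s => [|s]; first by lia.
move=> ne n2 ns me /realizable_heights[v vs vL]; apply: realizable_word vL => //; first lia.
apply: all_letters_imp (crossing_letters vs) => l [lo linj]; split=> //.
by apply: even_perm_in => //; rewrite lo.
Qed.

Lemma realizable_of_odd_generators m n s L : ~~ odd n -> odd n./2 -> (2 <= n)%N -> (2 * n <= s)%N ->
  realizable m L s -> realizable n L s.
Proof.
case: s => [|s]; first by lia.
move=> ne no n2 ns /realizable_heights[v vs vL]; apply: realizable_word vL => //; first lia.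
apply: all_letters_imp (crossing_letters vs) => l [_ linj]; split=> //.
have [lo|le] := boolP (odd_perm l.1); last exact: even_perm_in.
have r0 : rev_perm s.+1 0 n \in <<rev_gens s n>>%g by apply: rev_gensP; lia.
rewrite -(mulKg (rev_perm s.+1 0 n) l.1) groupM ?groupV//.
apply: even_perm_in => //; rewrite odd_permM odd_rev_perm; last lia.
by rewrite no lo.
Qed.

Lemma realizable_even_word n s L (w : seq (letter R s.+1)) : ~~ odd n -> (2 <= n)%N ->
  (2 * n <= s.+1)%N -> all_letters (fun l => injective l.2) w ->
  ~~ odd (count (fun l : letter R s.+1 => odd_perm l.1) w) ->
  ambient_isotopic (word_closure w) L -> realizable n L s.+1.
Proof.
move=> ne n2 ns winj weven wL; have [|w' w'P ww'] := even_word _ winj weven; first by lia.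
apply: (realizable_word (w := w')) => //; first lia.
  by apply: all_letters_imp w'P => l [? ?]; split=> //; exact: even_perm_in.
exact: ambient_isotopic_trans (ambient_isotopic_sym (ww' [::])) wL.
Qed.

Lemma realizable_stabilized m n s L : ~~ odd n -> (2 <= n)%N -> (2 * n <= s)%N ->
  realizable m L s -> realizable n L s \/ realizable n L s.+1.
Proof.
case: s => [|s]; first by lia.
move=> ne n2 ns /realizable_heights[v vs vL].
set w := map _ v in vL; have winj : all_letters (fun l => injective l.2) w.
  by apply: all_letters_imp (crossing_letters vs) => l [].
have [wodd|weven] := boolP (odd (count (fun l : letter R s.+1 => odd_perm l.1) w)); last first.
  by left; exact: realizable_even_word weven vL.
have w0 : (0 < size w)%N by case: (w) wodd.
(* The added letter is a transposition and lifting preserves parity, so the total becomes even.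
   Heights increasing with the position put string 1 above string 0, as [stabilization] asks. *)
right; pose h (i : 'I_s.+2) : R := i%:R.
have hinj : injective h by move=> i j /eqP; rewrite eqr_nat => /eqP/ord_inj.
have h01 : h ord0 < h (string1 s) by rewrite ltr_nat string1E.
pose w' := map (fun l => lift_letter (lowest_height l.2) l) w ++ [:: (tperm ord0 (string1 s), h)].
apply: (@realizable_even_word n s.+1 L w') => //; first lia.
- apply: all_letters_cat; last by split.
  by apply: all_letters_map winj => l; exact: lift_letter_inj.
- rewrite count_cat count_map (eq_count (a2 := fun l : letter R s.+1 => odd_perm l.1)).
    by rewrite oddD wodd /= odd_tperm.
  by move=> l; rewrite /= odd_lift_perm.
- apply: ambient_isotopic_trans vL; apply: ambient_isotopic_sym.
  apply: ambient_isotopic_trans (stabilization w0 h01) _.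
  exact: (lift_word_heights [::]).
Qed.

(** A crossing that occurs must fit on the [s] strings. The empty word gives an unlink, or the empty
    set if [s = 0], which is no link. *)
Lemma realizable_size m s L : is_link L -> ~ is_unlink L -> realizable m L s -> (m <= s)%N.
Proof.
move=> [c [f [c0 [_ [_ [_ LE]]]]]] nunlink [v [vs vL]]; case: v vs vL => [|x v] vs vL; last first.
  by move: vs => /= /andP[_ /andP[xs _]]; apply: leq_trans xs; rewrite leq_addl.
exfalso; case: s vs vL => [|s] vs vL.
  have [H [_ [_ [_ HL]]]] := vL.
  have : L (f (Ordinal c0) 0) by rewrite LE; exists (Ordinal c0) => //; exists 0.
  rewrite -HL => -[p [[k //]|[k //]]].
apply: nunlink; exists s.+1; split=> //; move: vL; congr ambient_isotopic.
by rewrite /braid_closure; congr (_ `|` _); apply/seteqP; split => p [k].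
Qed.
End Realizability.

(** * Minimal numbers of strings and the comparison of indices *)

Section BraidIndex.
Variable R : realType.
Implicit Types (L : set (R3pt R)).

Lemma betaP n L : (exists s, realizable n L s) ->
  exists s, [/\ beta n L = Some s, realizable n L s & forall s', realizable n L s' -> (s <= s')%N].
Proof.
move=> ex; rewrite /beta; case: pselect => // ex'.
have [s [rs smin]] : exists s, realizable n L s /\ forall s', realizable n L s' -> (s <= s')%N.
  have exb : exists s, `[< realizable n L s >] by case: ex => s rs; exists s; apply/asboolP.
  exists (ex_minn exb); case: ex_minnP => s /asboolP rs smin; split=> // s' rs'.
  by apply: smin; apply/asboolP.
set A := [set m | _]; have As : A s by [].
exists (xget 0%N A); have [r1 r2] : A (xget 0%N A) by exact: (xgetI _ As).
by split.
Qed.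

Lemma beta_le n L s : realizable n L s -> le_ext (beta n L) (Some s).
Proof. by move=> rs; have [|t [-> _]] := @betaP n L; [exists s|apply]. Qed.

Lemma beta_None n L : ~ (exists s, realizable n L s) -> beta n L = None.
Proof. by move=> nex; rewrite /beta; case: pselect. Qed.

Lemma le_ext_None a : le_ext a None.
Proof. by case: a. Qed.
End BraidIndex.

Theorem theorem5p4 (R : realType) (L : set (R3pt R)) :
  is_link L -> ~ is_unlink L ->
  (forall k n m : nat, n = (4 * k + 2)%N -> (3 * n + 1 <= m)%N ->
     le_ext (beta n L) (beta m L)) /\
  (forall k n m : nat, (1 <= k)%N -> n = (4 * k)%N -> (3 * n + 1 <= m)%N ->
     le_ext (beta n L) (add1_ext (beta m L)) /\
     ((m %% 4 = 0 \/ m %% 4 = 1)%N -> le_ext (beta n L) (beta m L))).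
Proof.
move=> linkL nunlinkL; split=> [k n m nE nm|k n m k1 nE nm].
  have [ex|nex] := pselect (exists s, realizable m L s); last first.
    by rewrite (beta_None nex); exact: le_ext_None.
  have [s [-> rs _]] := betaP ex; apply: beta_le.
  (* Now [s >= m >= 3 * n + 1], which yields the bound [2 * n <= s] required below. *)
  have ms := realizable_size linkL nunlinkL rs.
  by apply: realizable_of_odd_generators rs; lia.
have [ex|nex] := pselect (exists s, realizable m L s); last first.
  by rewrite (beta_None nex); split=> [|_]; exact: le_ext_None.
have [s [-> rs _]] := betaP ex; have ms := realizable_size linkL nunlinkL rs.
split=> [|m4].
  (* Without stabilization the index is at most [s], which is weakened to [s + 1]. *)
  have [|||/beta_le|/beta_le//] := @realizable_stabilized _ m n s L _ _ _ rs; try lia.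
  by case: (beta n L) => // t /= ts; exact: leqW.
(* For [m] congruent to 0 or 1 modulo 4, half of [m] rounded down is even. *)
apply: beta_le; apply: realizable_of_even_crossings rs; lia.
Qed.
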